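(* Let $p$ be a prime, $K$ a finite unramified extension of $\mathbf{Q}_p$ with ring of integers $\mathcal{O}_K$, and $G$ a one-dimensional commutative formal group of height $2$ over $\mathcal{O}_K$ with coordinate ring $A(G)=\mathcal{O}_K[[X]]$, and let $H$ be its Cartier dual. Let $\widehat{U}(G)$, $\mathcal{K}$, $T_p^\times H$, $K_\infty$ and $\mathcal{K}_t$ be as described in the context. Then the Katz map $\mathcal{K}:\widehat{U}(G)\to C^0_{\mathrm{Gal}}(T_pH,\mathcal{O}_{\mathbf{C}_p})$ is injective, and for every $t\in T_p^\times H$ the map $\mathcal{K}_t:\widehat{U}(G)\to\mathcal{O}_{K_\infty}$, $u\mapsto \mathcal{K}(u)(t)$, is surjective.
   Context: Let $\overline{\mathbf{Q}}_p$ be an algebraic closure of $K$, $G_K=\mathrm{Gal}(\overline{\mathbf{Q}}_p/K)$, and $\mathbf{C}_p$ the completion of $\overline{\mathbf{Q}}_p$. The Cartier dual $H$ of $G$ is again a one-dimensional formal group of height $2$ over $\mathcal{O}_K$; its Tate module $T_pH$ (the inverse limit of the $p^n$-torsion points $H[p^n]$ under multiplication by $p$) is identified, $G_K$-equivariantly, with the set of formal group homomorphisms $G\to\mathbf{G}_{\mathrm m}$ over $\mathcal{O}_{\mathbf{C}_p}$, i.e. power series $t(X)\in\mathcal{O}_{\mathbf{C}_p}[[X]]$ with $t(0)=1$ and $t(X\oplus_G Y)=t(X)t(Y)$. Let $T_p^\times H=T_pH\setminus pT_pH$. Let $\widehat{U}(G)$ be the set of $\mathcal{O}_K$-linear maps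 $A(G)\to\mathcal{O}_K$ continuous for the $(p,X)$-adic topology (the $p$-adic completion of the covariant bialgebra of $G$); the evaluation pairing $\langle\cdot,\cdot\rangle$ extends to $\widehat{U}(G)\times\mathcal{O}_{\mathbf{C}_p}\widehat{\otimes}A(G)\to\mathcal{O}_{\mathbf{C}_p}$ by $\langle u,\sum c_iX^i\rangle=\sum c_i u(X^i)$. $C^0_{\mathrm{Gal}}(T_pH,\mathcal{O}_{\mathbf{C}_p})$ is the set of continuous functions $f:T_pH\to\mathcal{O}_{\mathbf{C}_p}$ with $f(\sigma(t))=\sigma(f(t))$ for all $\sigma\in G_K$, $t\in T_pH$. The Katz map is $\mathcal{K}(u)(t)=\langle u,t(X)\rangle$. For $t=(t_0,t_1,\dots)\in T_p^\times H$ (with $t_n\in H[p^n]$), $K_\infty$ is the completion of the field generated over $K$ by all $t_n$, $n\ge1$; one has $\mathcal{K}(u)(t)\in\mathcal{O}_{K_\infty}$. *)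

(* Defs.v *)
From mathcomp Require Import all_boot all_order all_algebra.
From mathcomp Require Import boolp classical_sets reals.
From mathcomp Require Import mpoly.

Set Implicit Arguments.
Unset Strict Implicit.
Unset Printing Implicit Defensive.

Import Order.TTheory GRing.Theory Num.Theory.
Local Open Scope ring_scope.

Section FormalPowerSeries.
Variable C : fieldType.

Definition mps (d : nat) := 'X_{1..d} -> C.

Definition coefs_in d (S : {pred C}) (f : mps d) : Prop := forall m, f m \in S.

Definition trunc d (n : nat) (f : mps d) : {mpoly C[d]} :=
  \sum_(k : 'X_{1..d < n.+1}) f k *: 'X_[k].

Definition mps0 d : mps d := fun=> 0.
Definition mps1 d : mps d := fun m => (m == 0%MM)%:R.
Arguments mps0 d : clear implicits.
Arguments mps1 d : clear implicits.
Definition mpsB d (f g : mps d) : mps d := fun m => f m - g m.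

(* The coefficient of total degree n of a product, or of a substitution of
   series without constant term, depends only on truncations at degree n. *)
Definition mpsM d (f g : mps d) : mps d :=
  fun m => (trunc (mdeg m) f * trunc (mdeg m) g)@_m.

(* f (g_0, ..., g_(e-1)), meaningful when the g_i have no constant term *)
Definition mps_comp d e (f : mps e) (g : e.-tuple (mps d)) : mps d :=
  fun m => (trunc (mdeg m) f \mPo [tuple of map (trunc (mdeg m)) g])@_m.

(* the k-th variable, with 0 <= k < d *)
Definition var d (k : nat) : mps d :=
  fun m => (m == [multinom (val i == k : nat) | i < d])%:R.
Arguments var d k : clear implicits.

Definition exp1 (i : nat) : 'X_{1..1} := [multinom [tuple i]].
Definition exp2 (i j : nat) : 'X_{1..2} := [multinom [tuple i; j]].

Definition Xn (i : nat) : mps 1 := fun m => (m == exp1 i)%:R.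
Arguments Xn i : clear implicits.

(* f belongs to the ideal generated by gs in S[[X_0, ..., X_(d-1)]] *)
Definition in_ideal d (S : {pred C}) k (gs : k.-tuple (mps d)) (f : mps d) :=
  exists2 h : 'I_k -> mps d, (forall i, coefs_in S (h i)) &
    forall m, f m = \sum_(i < k) mpsM (tnth gs i) (h i) m.

Definition formal_group_law (S : {pred C}) (F : mps 2) : Prop :=
  [/\ coefs_in S F,
      mps_comp F [tuple var 1 0; mps0 1] =1 var 1 0,
      mps_comp F [tuple mps0 1; var 1 0] =1 var 1 0,
      mps_comp F [tuple var 2 1; var 2 0] =1 F &
      mps_comp F [tuple mps_comp F [tuple var 3 0; var 3 1]; var 3 2]
        =1 mps_comp F [tuple var 3 0; mps_comp F [tuple var 3 1; var 3 2]]].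

(* the multiplication-by-n series [n]_F (X) *)
Fixpoint fg_mul (F : mps 2) (n : nat) : mps 1 :=
  if n is n'.+1 then mps_comp F [tuple var 1 0; fg_mul F n'] else mps0 1.

(* [n]_F evaluated at the k-th of d variables *)
Definition fg_mul_var d (F : mps 2) (n k : nat) : mps d :=
  mps_comp (fg_mul F n) [tuple var d k].

End FormalPowerSeries.

Arguments mps0 C d : clear implicits.
Arguments mps1 C d : clear implicits.
Arguments var C d k : clear implicits.
Arguments Xn C i : clear implicits.
Arguments fg_mul_var {C} d F n k.

Section PadicFields.
Variables (R : realType) (p : nat) (C : fieldType) (nrm : C -> R).

Definition cvg_seq (s : nat -> C) (l : C) : Prop :=
  forall e : R, 0 < e -> exists N, forall n, (N <= n)%N -> nrm (s n - l) < e.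

Definition cauchy_seq (s : nat -> C) : Prop :=
  forall e : R, 0 < e -> exists N, forall m n, (N <= m)%N -> (N <= n)%N ->
    nrm (s m - s n) < e.

(* the limit of s, and 0 if s does not converge *)
Definition lim_seq (s : nat -> C) : C := xget 0 [set l | cvg_seq s l]%classic.

Definition adherence (S : {pred C}) : {pred C} :=
  [pred x | `[< forall e : R, 0 < e -> exists2 y, y \in S & nrm (x - y) < e >]].

Definition padic_abs_value : Prop :=
  [/\ forall x, 0 <= nrm x,
      forall x, nrm x = 0 <-> x = 0,
      {morph nrm : x y / x * y},
      forall x y, nrm (x + y) <= Num.max (nrm x) (nrm y) &
      nrm p%:R = p%:R^-1].

(* Inside the complete field C_p, the completion of a subfield is its closure. *)
Definition Qp : {pred C} := adherence [pred x | `[< exists q : rat, x = ratr q >]].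

Definition Qpbar : {pred C} :=
  [pred x | `[< exists P : {poly C},
                  [/\ P != 0, P \is a polyOver Qp & root P x] >]].

(* C is the completion of an algebraic closure of Q_p. *)
Definition is_Cp : Prop :=
  [/\ padic_abs_value,
      forall s, cauchy_seq s -> exists l, cvg_seq s l,
      forall P : {poly C}, P \is a polyOver Qpbar -> (1 < size P)%N ->
        exists2 x, x \in Qpbar & root P x &
      forall x, x \in adherence Qpbar].

Definition finite_over_Qp (K : {pred C}) : Prop :=
  [/\ divring_closed K, {subset Qp <= K} &
      exists s : seq C, {subset s <= K} /\
        forall x, x \in K -> exists2 c : nat -> C, (forall i, c i \in Qp) &
          x = \sum_(i < size s) c i * s`_i].

(* Ramification index 1: K and Q_p have the same value group.  The residue
   extension, being one of finite fields, is always separable. *)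
Definition unramified (K : {pred C}) : Prop :=
  forall x, x \in K -> exists2 y, y \in Qp & nrm x = nrm y.

Definition integers (K : {pred C}) : {pred C} :=
  [pred x | (x \in K) && (nrm x <= 1)].

Definition OC : {pred C} := integers predT.

Definition continuous_map (s : C -> C) : Prop :=
  forall x (e : R), 0 < e -> exists2 d : R, 0 < d &
    forall y, nrm (y - x) < d -> nrm (s y - s x) < e.

(* s is the extension by continuity to C_p of an element of Gal(Qpbar / K). *)
Definition galois_aut (K : {pred C}) (s : {rmorphism C -> C}) : Prop :=
  [/\ {in Qpbar, forall x, s x \in Qpbar},
      forall y, y \in Qpbar -> exists2 x, x \in Qpbar & s x = y,
      {in K, forall x, s x = x} &
      continuous_map s].

(* the value at x of a one-variable series, for nrm x < 1 *)
Definition mps_eval (f : mps C 1) (x : C) : C :=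
  lim_seq (fun N => \sum_(i < N) f (exp1 i) * x ^+ i).

(* f (X, y) as a series in X, for nrm y < 1 *)
Definition mps_eval2 (f : mps C 2) (y : C) : mps C 1 :=
  fun m => lim_seq (fun N => \sum_(j < N) f (exp2 (mdeg m) j) * y ^+ j).

(* The reduction of [p]_F modulo the maximal ideal is g (X^(p^h)) with
   g'(0) <> 0. *)
Definition has_height (F : mps C 2) (h : nat) : Prop :=
  (forall i, ~~ (p ^ h %| i)%N -> nrm (fg_mul F p (exp1 i)) < 1) /\
  nrm (fg_mul F p (exp1 (p ^ h))) = 1.

Section Duality.
Variables (K : {pred C}) (G H : mps C 2).

Local Notation OK := (integers K).

(* An O_K-linear map A(G) -> O_K is represented by a function on all series,
   of which only the values on O_K[[X]] matter. *)
Definition OK_linear (u : mps C 1 -> C) : Prop :=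
  (forall f, coefs_in OK f -> u f \in OK) /\
  (forall c f g, c \in OK -> coefs_in OK f -> coefs_in OK g ->
    u (fun m => c * f m + g m) = c * u f + u g).

Definition in_pX_power (n : nat) (f : mps C 1) : Prop :=
  in_ideal OK [tuple (fun m => p%:R ^+ (n - i) * Xn C i m) | i < n.+1] f.

Definition Uhat (u : mps C 1 -> C) : Prop :=
  OK_linear u /\
  forall f (k : nat), coefs_in OK f -> exists n, forall g, coefs_in OK g ->
    in_pX_power n (mpsB g f) -> nrm (u g - u f) <= nrm p%:R ^+ k.

Definition pairing (u : mps C 1 -> C) (f : mps C 1) : C :=
  lim_seq (fun N => \sum_(i < N) f (exp1 i) * u (Xn C i)).

(* the dual O_K-module of A(G) / [p^n]_G A(G), i.e. of the algebra of G[p^n] *)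
Definition torsion_dual (n : nat) (u : mps C 1 -> C) : Prop :=
  OK_linear u /\
  forall f, coefs_in OK f -> u (mpsM (fg_mul G (p ^ n)) f) = 0.

(* u applied to Phi (X, Y) in the variable X *)
Definition contract (u : mps C 1 -> C) (Phi : mps C 2) : mps C 1 :=
  fun m => u (fun l => Phi (exp2 (mdeg l) (mdeg m))).

(* Phi (X, Y) defines a pairing of group schemes G[p^n] x H[p^n] -> G_m that is
   perfect, i.e. identifies H[p^n] with the Cartier dual Hom (G[p^n], G_m):
   the map from the linear dual of the algebra of G[p^n] (which is the algebra
   of the Cartier dual) to the algebra O_K[[Y]] / [p^n]_H is bijective. *)
Definition perfect_pairing (n : nat) (Phi : mps C 2) : Prop :=
  [/\ coefs_in OK Phi,
      in_ideal OK [tuple fg_mul H (p ^ n)]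
        (mpsB (mps_comp Phi [tuple mps0 C 1; var C 1 0]) (mps1 C 1)) /\
      in_ideal OK [tuple fg_mul G (p ^ n)]
        (mpsB (mps_comp Phi [tuple var C 1 0; mps0 C 1]) (mps1 C 1)),
      in_ideal OK [tuple fg_mul_var 3 G (p ^ n) 0; fg_mul_var 3 G (p ^ n) 1;
                         fg_mul_var 3 H (p ^ n) 2]
        (mpsB (mps_comp Phi [tuple mps_comp G [tuple var C 3 0; var C 3 1];
                                   var C 3 2])
              (mpsM (mps_comp Phi [tuple var C 3 0; var C 3 2])
                    (mps_comp Phi [tuple var C 3 1; var C 3 2]))),
      in_ideal OK [tuple fg_mul_var 3 G (p ^ n) 0; fg_mul_var 3 H (p ^ n) 1;
                         fg_mul_var 3 H (p ^ n) 2]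
        (mpsB (mps_comp Phi [tuple var C 3 0;
                                   mps_comp H [tuple var C 3 1; var C 3 2]])
              (mpsM (mps_comp Phi [tuple var C 3 0; var C 3 1])
                    (mps_comp Phi [tuple var C 3 0; var C 3 2]))) &
      (forall u, torsion_dual n u ->
         in_ideal OK [tuple fg_mul H (p ^ n)] (contract u Phi) ->
         forall f, coefs_in OK f -> u f = 0) /\
      (forall b, coefs_in OK b -> exists2 u, torsion_dual n u &
         in_ideal OK [tuple fg_mul H (p ^ n)] (mpsB (contract u Phi) b))].

(* H is the Cartier dual of G.  The dual of G[p^n] is identified with H[p^n] for
   every n, in such a way that the inclusions H[p^n] -> H[p^(n+1)] are dual to
   the maps p : G[p^(n+1)] -> G[p^n], and the maps p : H[p^(n+1)] -> H[p^n] are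
   dual to the inclusions G[p^n] -> G[p^(n+1)] (either condition implies the
   other one). *)
Definition cartier_dual (Phi : nat -> mps C 2) : Prop :=
  [/\ forall n, perfect_pairing n (Phi n),
      forall n, in_ideal OK [tuple fg_mul_var 2 G (p ^ n.+1) 0;
                                   fg_mul_var 2 H (p ^ n) 1]
        (mpsB (Phi n.+1)
              (mps_comp (Phi n) [tuple fg_mul_var 2 G p 0; var C 2 1])) &
      forall n, in_ideal OK [tuple fg_mul_var 2 G (p ^ n) 0;
                                   fg_mul_var 2 H (p ^ n.+1) 1]
        (mpsB (Phi n.+1)
              (mps_comp (Phi n) [tuple var C 2 0; fg_mul_var 2 H p 1]))].

Definition torsion_point (n : nat) (x : C) : Prop :=
  nrm x < 1 /\ mps_eval (fg_mul H (p ^ n)) x = 0.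

Definition TpH (t : nat -> C) : Prop :=
  forall n, torsion_point n (t n) /\ mps_eval (fg_mul H p) (t n.+1) = t n.

Definition TpHx (t : nat -> C) : Prop :=
  TpH t /\
  ~ exists2 s, TpH s & forall n, t n = mps_eval (fg_mul H p) (s n).

Definition hom_to_Gm (f : mps C 1) : Prop :=
  [/\ coefs_in OC f, f (exp1 0) = 1 &
      mps_comp f [tuple G]
        =1 mpsM (mps_comp f [tuple var C 2 0]) (mps_comp f [tuple var C 2 1])].

(* f is the homomorphism G -> G_m corresponding to t: on G[p^n] it is the
   character given by the point t_n of H[p^n]. *)
Definition corresponds (Phi : nat -> mps C 2) (t : nat -> C) (f : mps C 1) :=
  hom_to_Gm f /\
  forall n, in_ideal OC [tuple fg_mul G (p ^ n)]
              (mpsB f (mps_eval2 (Phi n) (t n))).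

Definition series_of (Phi : nat -> mps C 2) (t : nat -> C) : mps C 1 :=
  xget (mps0 C 1) [set f | corresponds Phi t f]%classic.

Definition Katz (Phi : nat -> mps C 2) (u : mps C 1 -> C) (t : nat -> C) : C :=
  pairing u (series_of Phi t).

(* TpH carries the topology of an inverse limit of discrete sets. *)
Definition C0_Gal (f : (nat -> C) -> C) : Prop :=
  [/\ forall t, TpH t -> f t \in OC,
      forall t (e : R), TpH t -> 0 < e -> exists n, forall s, TpH s ->
        (forall i, (i <= n)%N -> s i = t i) -> nrm (f s - f t) < e &
      forall (s : {rmorphism C -> C}) t, galois_aut K s -> TpH t ->
        f (s \o t) = s (f t)].

Definition generated_field (t : nat -> C) : {pred C} :=
  [pred x | `[< forall L : {pred C}, divring_closed L -> {subset K <= L} ->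
                  (forall n, (1 <= n)%N -> t n \in L) -> x \in L >]].

Definition K_infty (t : nat -> C) : {pred C} := adherence (generated_field t).

End Duality.
End PadicFields.

(* Main.v *)
(** Power series over O_C are handled through their values on the open unit disc m, where a
    bounded series is determined by its values; formal identities thus become identities
    between points, and G and H become honest commutative groups on m.

    The homomorphism t(X) attached to t in T_p H is the limit of Phi_n (X, t_n), because two
    consecutive terms agree modulo [p^n]_G, which lies in the n-th power of (p, X).  A functional
    in U^(G) is a null sequence c in O_K, with c_i the value at X^i.  On the dual of
    O_K[[X]] / [p^n]_G, identified with O_K[[Y]] / [p^n]_H by Cartier duality, the Katz map is
    evaluation at t_n.

    Surjectivity: if t is primitive, then w_n = [p^(n+1)]_H / [p^n]_H vanishes at t_(n+1) and has
    constant term p, so p is a multiple of t_(n+1) in O_K[[t_(n+1)]].  Hence that ring is discretely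
    valued with uniformizer t_(n+1), the union over n generates K(t_1, t_2, ...), and an element
    of O_(K_infty) is expanded p-adically with digits in the image.

    Injectivity: let K(u) = 0 and suppose that u is not divisible by p.  Modulo p^e the
    functional u comes from some b in O_K[[Y]] / [p^N]_H whose values at all torsion points
    s_N, s_(N-1), ... of a primitive s are divisible by p^e.  Dividing b successively by
    w_(N-1), w_(N-2), ... (Eisenstein, so that a remainder is small as soon as its value is) shows
    that b vanishes modulo p up to the order p^(2N) - p^(2(N-e)).  But modulo p the functional u
    already comes from a fixed level n, whence the order of b modulo p is at most
    p^(2N) - p^(2(N-n)); this is absurd for e > n. *)

Require Import Defs.
From mathcomp Require Import all_boot all_order all_algebra.
From mathcomp Require Import boolp classical_sets reals.
From mathcomp Require Import mpoly.
From mathcomp Require Import zify ring lra.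

Set Implicit Arguments.
Unset Strict Implicit.
Unset Printing Implicit Defensive.

Import Order.TTheory GRing.Theory Num.Theory.
Local Open Scope ring_scope.

(** Unramifiedness gives a dichotomy: a series over O_K is either divisible by p, or its reduction
    has a finite order, which can be read off from the norm of a single value near the unit circle.
    Orders of composites are therefore found by evaluating, never by expanding.

    The obstacle to injectivity is that a functional u need not factor through any finite level; it
    does so only modulo a given power of p, and the level grows with that power. Hence two
    approximations: one modulo p at a level n fixed once for all, one modulo p^e at a large level N,
    compared modulo p at level N. The bound p^(2N) - p^(2(N-n)) arises as follows. Perfectness at
    level n makes the order j of the first one less than p^(2n), for otherwise u would be divisible
    by p; passing from n to N substitutes [p^(N-n)]_H and turns j into j p^(2(N-n)), at most (p^(2n)
    - 1) p^(2(N-n)). Then e = n + 1 suffices.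

    Primitive sequences have to exist, while only polynomials over the algebraic closure of Q_p come
    with roots; roots of power series over O_C are reached by Weierstrass division and
    approximation. *)

Record Cp_field (R : realType) (p : nat) := CpField {
  Cp_sort :> fieldType;
  Cp_norm : Cp_sort -> R;
  Cp_prime : prime p;
  Cp_axioms : is_Cp p Cp_norm }.

Notation nm := (@Cp_norm _ _ _).

(** * Ultrametric sums *)

Section Norm.
Variables (R : realType) (p : nat) (F : Cp_field R p).
Implicit Types (x y z : F) (s a b : nat -> F) (e r B : R).

Lemma Cp_abs : padic_abs_value p (@Cp_norm _ _ F).
Proof. by case: (Cp_axioms F). Qed.

Lemma nm_ge0 x : 0 <= nm x. Proof. by case: Cp_abs. Qed.
Lemma nm_eq0 x : nm x = 0 -> x = 0. Proof. by case: Cp_abs => _ h _ _ _ /h. Qed.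
Lemma nm0 : nm (0 : F) = 0. Proof. by case: Cp_abs => _ h _ _ _; apply/h. Qed.
Lemma nmM x y : nm (x * y) = nm x * nm y. Proof. by case: Cp_abs => _ _ h. Qed.

Lemma nm_gt0 x : x != 0 -> 0 < nm x.
Proof.
move=> x0; rewrite lt_neqAle nm_ge0 andbT eq_sym.
by apply: contra x0 => /eqP/nm_eq0 ->.
Qed.

Lemma nm1 : nm (1 : F) = 1.
Proof.
have h := nmM 1 1; rewrite mulr1 in h.
have n0 : nm (1 : F) != 0 by rewrite gt_eqF // nm_gt0 // oner_eq0.
by apply: (mulfI n0); rewrite -h mulr1.
Qed.

Lemma nmX x n : nm (x ^+ n) = nm x ^+ n.
Proof. by elim: n => [|n IH]; rewrite ?expr0 ?nm1 // !exprS nmM IH. Qed.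

Lemma nmN1 : nm (-1 : F) = 1.
Proof.
have : nm (-1 : F) ^+ 2 == 1 by rewrite -nmX sqrrN expr1n nm1.
by rewrite sqrf_eq1 => /orP[] /eqP // h; have := nm_ge0 (-1); rewrite h; lra.
Qed.

Lemma nmN x : nm (- x) = nm x.
Proof. by rewrite -mulN1r nmM nmN1 mul1r. Qed.

Lemma nmBC x y : nm (x - y) = nm (y - x).
Proof. by rewrite -nmN opprB. Qed.

Lemma nmD B x y : nm x <= B -> nm y <= B -> nm (x + y) <= B.
Proof.
move=> hx hy; case: Cp_abs => _ _ _ h _.
by apply: (le_trans (h x y)); rewrite ge_max hx.
Qed.

Lemma nmD_lt B x y : nm x < B -> nm y < B -> nm (x + y) < B.
Proof.
move=> hx hy; case: Cp_abs => _ _ _ h _.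
by apply: (le_lt_trans (h x y)); rewrite gt_max hx.
Qed.

Lemma nmB B x y : nm x <= B -> nm y <= B -> nm (x - y) <= B.
Proof. by move=> hx hy; apply: nmD => //; rewrite nmN. Qed.

Lemma nmB_lt B x y : nm x < B -> nm y < B -> nm (x - y) < B.
Proof. by move=> hx hy; apply: nmD_lt => //; rewrite nmN. Qed.

Lemma nmD_eq x y : nm y < nm x -> nm (x + y) = nm x.
Proof.
move=> h; apply/eqP; rewrite eq_le nmD ?(ltW h) //= leNgt; apply/negP => h2.
have : nm (x + y - y) < nm x by apply: nmB_lt.
by rewrite addrK ltxx.
Qed.

Lemma nmV x : nm x^-1 = (nm x)^-1.
Proof.
have [->|x0] := eqVneq x 0; first by rewrite invr0 nm0 invr0.
have n0 : nm x != 0 by rewrite gt_eqF // nm_gt0.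
by apply: (mulfI n0); rewrite -nmM !divff // nm1.
Qed.

Lemma nm_sum (I : Type) (r : seq I) (P : pred I) (f : I -> F) B :
  0 <= B -> (forall i, P i -> nm (f i) <= B) -> nm (\sum_(i <- r | P i) f i) <= B.
Proof.
move=> B0 h; elim/big_ind: _ => [|x y|i /h//]; first by rewrite nm0.
exact: nmD.
Qed.

Lemma nm_sum_lt (I : Type) (r : seq I) (P : pred I) (f : I -> F) B :
  0 < B -> (forall i, P i -> nm (f i) < B) -> nm (\sum_(i <- r | P i) f i) < B.
Proof.
move=> B0 h; elim/big_ind: _ => [|x y|i /h//]; first by rewrite nm0.
exact: nmD_lt.
Qed.

Lemma p_gt1 : (1 : R) < p%:R.
Proof. by rewrite ltr1n prime_gt1 // (Cp_prime F). Qed.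

Lemma nm_p : nm (p%:R : F) = p%:R^-1. Proof. by case: Cp_abs. Qed.

Lemma nm_p_gt0 : 0 < nm (p%:R : F).
Proof. by rewrite nm_p invr_gt0 (lt_trans ltr01) // p_gt1. Qed.

Lemma nm_p_lt1 : nm (p%:R : F) < 1.
Proof. by rewrite nm_p invf_lt1 ?p_gt1 // (lt_trans ltr01) // p_gt1. Qed.

Lemma p_neq0 : (p%:R : F) != 0.
Proof. by apply/negP => /eqP h; have := nm_p_gt0; rewrite h nm0 ltxx. Qed.

Lemma nm_natr n : nm (n%:R : F) <= 1.
Proof. by elim: n => [|n IH]; rewrite ?nm0 // -natr1 nmD // nm1. Qed.

Lemma nmM_le1 x y : nm x <= 1 -> nm y <= 1 -> nm (x * y) <= 1.
Proof. by move=> hx hy; rewrite nmM mulr_ile1 ?nm_ge0. Qed.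

Lemma nmM_le B x y : nm x <= 1 -> nm y <= B -> nm (x * y) <= B.
Proof.
move=> hx hy; rewrite nmM; apply: le_trans hy.
by rewrite ler_piMl ?nm_ge0.
Qed.

Lemma nmMr_le B x y : nm x <= B -> nm y <= 1 -> nm (x * y) <= B.
Proof. by move=> hx hy; rewrite mulrC nmM_le. Qed.

Lemma nmX_le1 x n : nm x <= 1 -> nm (x ^+ n) <= 1.
Proof. by move=> hx; rewrite nmX exprn_ile1 ?nm_ge0. Qed.

End Norm.

(** * Limits, null sequences and infinite sums *)

Lemma bernoulli (R : realFieldType) (h : R) n : 0 <= h -> 1 + h *+ n <= (1 + h) ^+ n.
Proof.
move=> h0; elim: n => [|n IH]; first by rewrite mulr0n addr0 expr0.
rewrite exprS mulrSr; have : 0 <= h * (h *+ n) by rewrite mulr_ge0 ?mulrn_wge0.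
by move: IH; set X := _ ^+ n; set Y := h *+ n; nra.
Qed.

Lemma expr_small (R : realType) (r e : R) : 0 <= r -> r < 1 -> 0 < e ->
  exists N, forall n, (N <= n)%N -> r ^+ n < e.
Proof.
move=> r0 r1 e0; have [->|rn0] := eqVneq r 0.
  by exists 1 => -[//|n] _; rewrite expr0n.
have rp : 0 < r by rewrite lt_neqAle eq_sym rn0.
pose h := r^-1 - 1.
have h0 : 0 < h by rewrite subr_gt0 invf_gt1.
have [N hN] : exists N : nat, e^-1 < h *+ N.
  exists (Num.trunc (e^-1 / h)).+1.
  by rewrite -mulr_natr mulrC -ltr_pdivrMr // truncnS_gt.
exists N => n Nn; rewrite -[r]invrK exprVn invf_plt ?posrE ?exprn_gt0 ?invr_gt0 //.
have -> : r^-1 = 1 + h by rewrite /h; ring.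
apply: lt_le_trans (bernoulli n (ltW h0)).
apply: (lt_le_trans hN); apply: (@le_trans _ _ (h *+ n)); last by lra.
by rewrite ler_pMn2l.
Qed.

Section Limits.
Variables (R : realType) (p : nat) (F : Cp_field R p).
Implicit Types (x y z l c : F) (s t a b : nat -> F) (e r B : R).

Notation cvg s l := (cvg_seq (@Cp_norm _ _ F) s l).
Definition null a := cvg a 0.
(** A total function: its value is 0 when the partial sums diverge, which is why the algebraic
    identities below ask for null sequences. *)
Definition tsum a : F := lim_seq (@Cp_norm _ _ F) (fun N => \sum_(i < N) a i).

Lemma nullE a : null a <->
  (forall e, 0 < e -> exists N, forall n, (N <= n)%N -> nm (a n) < e).
Proof. by split=> h e /h[N hN]; exists N => n /hN; rewrite subr0. Qed.

Lemma small_eq0 x : (forall e, 0 < e -> nm x < e) -> x = 0.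
Proof.
move=> h; apply/eqP; apply: contraT => x0.
by have := h _ (nm_gt0 x0); rewrite ltxx.
Qed.

Lemma cvg_uniq s l l' : cvg s l -> cvg s l' -> l = l'.
Proof.
move=> h h'; apply/eqP; rewrite -subr_eq0; apply/eqP/small_eq0 => e e0.
have [N hN] := h e e0; have [M hM] := h' e e0.
have -> : l - l' = (s (maxn N M) - l') - (s (maxn N M) - l) by ring.
by apply: nmB_lt; [apply: hM; rewrite leq_maxr | apply: hN; rewrite leq_maxl].
Qed.

Lemma cvg_lim s l : cvg s l -> lim_seq (@Cp_norm _ _ F) s = l.
Proof. by move=> h; apply: (@cvg_uniq s) => //;
  apply: (xgetPex 0 (P := [set l | cvg s l]%classic)); exists l. Qed.

Lemma cvg_cst c : cvg (fun=> c) c.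
Proof. by move=> e e0; exists 0 => n _; rewrite subrr nm0. Qed.

Lemma cvgD s t l l' : cvg s l -> cvg t l' -> cvg (fun n => s n + t n) (l + l').
Proof.
move=> h h' e e0; have [N hN] := h e e0; have [M hM] := h' e e0.
exists (maxn N M) => n; rewrite geq_max => /andP[Nn Mn].
have -> : s n + t n - (l + l') = (s n - l) + (t n - l') by ring.
by apply: nmD_lt; [apply: hN | apply: hM].
Qed.

Lemma cvgMl c s l : cvg s l -> cvg (fun n => c * s n) (c * l).
Proof.
move=> h; have [->|c0] := eqVneq c 0.
  by move=> e e0; exists 0 => n _; rewrite !mul0r subrr nm0.
move=> e e0; have [N hN] := h (e / nm c) (divr_gt0 e0 (nm_gt0 c0)).
exists N => n /hN; rewrite -mulrBr nmM [nm c * _]mulrC.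
by rewrite ltr_pdivlMr ?nm_gt0.
Qed.

Lemma cvgN s l : cvg s l -> cvg (fun n => - s n) (- l).
Proof. by move=> h e /h[N hN]; exists N => n /hN; rewrite -opprD nmN. Qed.

Lemma cvgB s t l l' : cvg s l -> cvg t l' -> cvg (fun n => s n - t n) (l - l').
Proof. by move=> h /cvgN; apply: cvgD. Qed.

Lemma cvg_bounded s l : cvg s l -> exists2 B, 0 < B & exists N, forall n, (N <= n)%N -> nm (s n)
  < B.
Proof.
move=> h; have [N hN] := h 1 ltr01.
exists (nm l + 1); first by rewrite ltr_wpDl ?nm_ge0.
exists N => n /hN h1; rewrite -(subrK l (s n)); apply: nmD_lt.
  by apply: (lt_le_trans h1); rewrite lerDr nm_ge0.
by rewrite ltrDl.
Qed.

Lemma cvgM s t l l' : cvg s l -> cvg t l' -> cvg (fun n => s n * t n) (l * l').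
Proof.
move=> h h'; have [B B0 [N1 hN1]] := cvg_bounded h.
move=> e e0; have [N2 hN2] := h' (e / B) (divr_gt0 e0 B0).
have [N3 hN3] := cvgMl l' h e0.
exists (maxn N1 (maxn N2 N3)) => n; rewrite !geq_max => /and3P[n1 n2 n3].
have -> : s n * t n - l * l' = s n * (t n - l') + (l' * s n - l' * l) by ring.
apply: nmD_lt; last exact: hN3.
rewrite nmM; have := hN2 _ n2; rewrite ltr_pdivlMr // mulrC => h2.
by apply: le_lt_trans h2; rewrite ler_wpM2r ?nm_ge0 // ltW // hN1.
Qed.

Lemma cvg_sum (I : Type) (r : seq I) (s : I -> nat -> F) (l : I -> F) :
  (forall i, cvg (s i) (l i)) -> cvg (fun n => \sum_(i <- r) s i n) (\sum_(i <- r) l i).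
Proof.
move=> h; elim: r => [|i r IH].
  by rewrite big_nil => e e0; exists 0 => n _; rewrite big_nil subrr nm0.
rewrite big_cons => e e0; have [N hN] := cvgD (h i) IH e0.
by exists N => n /hN; rewrite big_cons.
Qed.

Lemma cvg_eventually s t l N : (forall n, (N <= n)%N -> s n = t n) -> cvg s l -> cvg t l.
Proof.
move=> st h e /h[M hM]; exists (maxn M N) => n; rewrite geq_max => /andP[Mn Nn].
by rewrite -st // hM.
Qed.

Lemma cvg_close s t l : cvg s l -> null (fun n => s n - t n) -> cvg t l.
Proof.
move=> h h'; have := cvgB h h'; rewrite subr0.
by apply: (@cvg_eventually _ _ _ 0) => n _; ring.
Qed.

Lemma cvg_shift s l k : cvg s l -> cvg (fun n => s (n + k)%N) l.
Proof. by move=> h e /h[N hN]; exists N => n Nn; apply: hN; rewrite (leq_trans Nn) ?leq_addr. Qed.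

Lemma cvg_unshift s l k : cvg (fun n => s (n + k)%N) l -> cvg s l.
Proof.
move=> h e /h[N hN]; exists (N + k)%N => n Nn.
have kn : (k <= n)%N by rewrite (leq_trans _ Nn) ?leq_addl.
by rewrite -(subnK kn); apply: hN; rewrite leq_subRL // addnC.
Qed.

Lemma cvg_le s l B N : cvg s l -> (forall n, (N <= n)%N -> nm (s n) <= B) -> nm l <= B.
Proof.
move=> h hB; rewrite leNgt; apply/negP => Bl.
have B0 : 0 <= B by apply: le_trans (hB N (leqnn _)); apply: nm_ge0.
have l0 : 0 < nm l by apply: le_lt_trans Bl.
have [M hM] := h _ l0; set n := maxn N M.
have h1 : nm (l - s n) < nm l by rewrite nmBC hM // leq_maxr.
have : nm (l - s n + s n) < nm l.
  by apply: nmD_lt => //; apply: le_lt_trans Bl; apply: hB; rewrite leq_maxl.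
by rewrite subrK ltxx.
Qed.

Lemma null_le a (b : nat -> R) : (forall n, nm (a n) <= b n) ->
  (forall e, 0 < e -> exists N, forall n, (N <= n)%N -> b n < e) -> null a.
Proof.
move=> ab hb; apply/nullE => e /hb[N hN]; exists N => n /hN.
exact: le_lt_trans.
Qed.

Lemma null_nm_le a b : (forall n, nm (a n) <= nm (b n)) -> null b -> null a.
Proof. by move=> ab /nullE; apply: null_le. Qed.

Lemma null_mulr a b : (forall n, nm (a n) <= 1) -> null b -> null (fun n => a n * b n).
Proof. by move=> a1; apply: null_nm_le => n; apply: nmM_le. Qed.

Lemma null_pow x : nm x < 1 -> null (fun n => x ^+ n).
Proof.
move=> x1; apply/nullE => e e0.
have [N hN] := expr_small (nm_ge0 x) x1 e0.
by exists N => n /hN; rewrite nmX.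
Qed.

Lemma null_geom a r : 0 <= r -> r < 1 -> (forall n, nm (a n) <= r ^+ n) -> null a.
Proof. by move=> r0 r1 h; apply: null_le h _ => e e0; apply: expr_small. Qed.

(** The ultrametric inequality bounds the difference of two partial sums by the largest term between
    them, so null terms already make the partial sums Cauchy. *)
Lemma null_summable a : null a -> exists l, cvg (fun N => \sum_(i < N) a i) l.
Proof.
move=> /nullE h; case: (Cp_axioms F) => _ compl _ _; apply: compl => e e0.
have [N hN] := h e e0; exists N.
have key m n : (N <= m)%N -> (m <= n)%N -> nm (\sum_(i < n) a i - \sum_(i < m) a i) < e.
  move=> Nm mn; rewrite -!(big_mkord predT) (big_cat_nat (leq0n m) mn) /=.
  rewrite addrAC subrr add0r big_nat_cond; apply: nm_sum_lt => // i.
  by rewrite andbT => /andP[mi _]; apply: hN; apply: leq_trans mi.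
move=> m n Nm Nn; case: (leqP m n) => mn; first by rewrite nmBC key.
by rewrite key // ltnW.
Qed.

Lemma tsumP a : null a -> cvg (fun N => \sum_(i < N) a i) (tsum a).
Proof. by move=> /null_summable[l hl]; rewrite /tsum (cvg_lim hl). Qed.

Lemma tsum_uniq a l : cvg (fun N => \sum_(i < N) a i) l -> tsum a = l.
Proof. exact: cvg_lim. Qed.

Lemma eq_tsum a b : a =1 b -> tsum a = tsum b.
Proof. by move=> ab; congr tsum; apply: funext. Qed.

Lemma eq_null a b : a =1 b -> null a -> null b.
Proof. by move=> /funext ->. Qed.

Lemma tsum_le a B : 0 <= B -> null a -> (forall i, nm (a i) <= B) -> nm (tsum a) <= B.
Proof.
by move=> B0 /tsumP h hB; apply: (cvg_le (N := 0) h) => n _; apply: nm_sum.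
Qed.

Lemma nullD a b : null a -> null b -> null (fun i => a i + b i).
Proof. by move=> h h'; have := cvgD h h'; rewrite addr0. Qed.

Lemma nullMl c a : null a -> null (fun i => c * a i).
Proof. by move=> /(cvgMl c); rewrite mulr0. Qed.

Lemma tsumD a b : null a -> null b -> tsum (fun i => a i + b i) = tsum a + tsum b.
Proof.
move=> /tsumP ha /tsumP hb; apply: tsum_uniq.
by apply: (cvg_eventually (N := 0) _ (cvgD ha hb)) => n _; rewrite big_split.
Qed.

Lemma tsumMl c a : null a -> tsum (fun i => c * a i) = c * tsum a.
Proof.
move=> /tsumP ha; apply: tsum_uniq.
by apply: (cvg_eventually (N := 0) _ (cvgMl c ha)) => n _; rewrite mulr_sumr.
Qed.

Lemma nullN a : null a -> null (fun i => - a i).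
Proof. by move=> /cvgN; rewrite oppr0. Qed.

Lemma nullB a b : null a -> null b -> null (fun i => a i - b i).
Proof. by move=> h /nullN; apply: nullD. Qed.

Lemma tsumN a : null a -> tsum (fun i => - a i) = - tsum a.
Proof. by move=> h; rewrite -mulN1r -tsumMl //; apply: eq_tsum => i; rewrite mulN1r. Qed.

Lemma tsumB a b : null a -> null b -> tsum (fun i => a i - b i) = tsum a - tsum b.
Proof. by move=> h h'; rewrite tsumD ?tsumN //; apply: nullN. Qed.

Lemma tsum_fin a M : (forall i, (M <= i)%N -> a i = 0) -> tsum a = \sum_(i < M) a i.
Proof.
move=> h; apply: tsum_uniq; apply: (cvg_eventually (N := M) _ (cvg_cst _)) => n Mn.
rewrite -!(big_mkord predT) (big_cat_nat (leq0n M) Mn) /= [X in _ + X]big1_seq ?addr0 //.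
by move=> i /=; rewrite mem_index_iota => /andP[/h ->].
Qed.

Lemma tsum0 : tsum (fun=> 0) = 0.
Proof. by rewrite (@tsum_fin _ 0) // big_ord0. Qed.

Lemma tsum1 k a : (forall i, i != k -> a i = 0) -> tsum a = a k.
Proof.
move=> h; rewrite (@tsum_fin _ k.+1); last by move=> i ki; apply: h; rewrite gtn_eqF.
by rewrite big_ord_recr /= big1 ?add0r // => i _; apply: h; rewrite ltn_eqF.
Qed.

Lemma null_shift a k : null a -> null (fun i => a (i + k)%N).
Proof. exact: cvg_shift. Qed.

Lemma null_unshift a k : null (fun i => a (i + k)%N) -> null a.
Proof. exact: cvg_unshift. Qed.

Lemma tsum_split k a : null a -> tsum a = \sum_(i < k) a i + tsum (fun i => a (i + k)%N).
Proof.
move=> h; apply: cvg_lim; apply: (@cvg_unshift _ _ k).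
apply: (cvg_eventually (N := 0) _ (cvgD (cvg_cst _) (tsumP (null_shift k h)))) => n _.
rewrite -!(big_mkord predT) (big_cat_nat (leq0n k) (leq_addl n k)) /=.
by congr (_ + _); rewrite -{2}[k]add0n big_addn addnK big_mkord.
Qed.

Lemma tsum_tail a k B : 0 <= B -> null a -> (forall i, (k <= i)%N -> nm (a i) <= B) ->
  nm (tsum a - \sum_(i < k) a i) <= B.
Proof.
move=> B0 h hB; rewrite (tsum_split k h) addrAC subrr add0r.
by apply: tsum_le => // [|i]; [apply: null_shift | apply: hB; rewrite leq_addl].
Qed.

(** Decay jointly in both indices, outside a square. Decay along each row and each column would not
    justify exchanging two sums. *)
Definition null2 (a : nat -> nat -> F) := forall e, 0 < e -> exists N, forall i j,
  (N <= i)%N || (N <= j)%N -> nm (a i j) < e.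

Lemma null2_row (a : nat -> nat -> F) i : null2 a -> null (a i).
Proof. by move=> h; apply/nullE => e /h[N hN]; exists N => n Nn; apply: hN; rewrite Nn orbT. Qed.

Lemma null2_sym (a : nat -> nat -> F) : null2 a -> null2 (fun i j => a j i).
Proof. by move=> h e /h[N hN]; exists N => i j; rewrite orbC => /hN. Qed.

Lemma null2_tsum (a : nat -> nat -> F) : null2 a -> null (fun i => tsum (a i)).
Proof.
move=> h; apply/nullE => e e0; have [N hN] := h (e / 2) ltac:(lra).
exists N => n Nn; apply: (@le_lt_trans _ _ (e / 2)); last by lra.
apply: tsum_le; [by lra | exact: null2_row | move=> i].
by apply: ltW; apply: hN; rewrite Nn.
Qed.

Lemma tsum2_approx (a : nat -> nat -> F) N e : 0 <= e -> null2 a ->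
  (forall i j, (N <= i)%N || (N <= j)%N -> nm (a i j) <= e) ->
  nm (tsum (fun i => tsum (a i)) - \sum_(i < N) \sum_(j < N) a i j) <= e.
Proof.
move=> e0 ha aN; have -> : tsum (fun i => tsum (a i)) - \sum_(i < N) \sum_(j < N) a i j =
  (tsum (fun i => tsum (a i)) - \sum_(i < N) tsum (a i)) +
    \sum_(i < N) (tsum (a i) - \sum_(j < N) a i j).
  by rewrite sumrB; ring.
apply: nmD.
  apply: tsum_tail; [by [] | exact: null2_tsum | move=> i Ni].
  apply: tsum_le; [by [] | exact: null2_row | move=> j].
  by apply: aN; rewrite Ni.
apply: nm_sum => // i _.
apply: tsum_tail; [by [] | exact: null2_row | move=> j Nj].
by apply: aN; rewrite Nj orbT.
Qed.

Lemma cvg_tsum2 (a : nat -> nat -> F) : null2 a ->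
  cvg (fun N => \sum_(i < N) \sum_(j < N) a i j) (tsum (fun i => tsum (a i))).
Proof.
move=> ha e e0; have [N hN] := ha (e / 2) ltac:(lra).
exists N => n Nn; rewrite nmBC; apply: (@le_lt_trans _ _ (e / 2)); last by lra.
apply: tsum2_approx => // [|i j /orP ij]; first by lra.
by apply/ltW/hN/orP; case: ij => h; [left | right]; apply: leq_trans h.
Qed.

(** Both iterated sums are the limit of the same sums over squares. *)
Lemma exchange_tsum (a : nat -> nat -> F) : null2 a ->
  tsum (fun i => tsum (fun j => a i j)) = tsum (fun j => tsum (fun i => a i j)).
Proof.
move=> h; apply: cvg_uniq (cvg_tsum2 h) _.
apply: (cvg_eventually (N := 0) _ (cvg_tsum2 (null2_sym h))) => n _.
exact: exchange_big.
Qed.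

End Limits.
Arguments tsum {R p F} a.
Arguments null {R p F} a.

(** * Evaluation of multivariate power series *)

Section TruncatedPolynomials.
Variables (C : fieldType).

(** [mpsM] and [mps_comp] compute each coefficient from truncations at its own degree. Comparing
    them with a product or composite of truncations at one common degree is therefore possible only
    up to that degree. *)
Definition agree d n (P Q : {mpoly C[d]}) := forall m, (mdeg m <= n)%N -> P@_m = Q@_m.
Definition ordge d n (P : {mpoly C[d]}) := forall m, (mdeg m < n)%N -> P@_m = 0.

Lemma trunc_coef d n (f : mps C d) m : (trunc n f)@_m = if (mdeg m <= n)%N then f m else 0.
Proof.
case: ifP => h; first by rewrite /trunc mcoeff_mpoly.
rewrite /trunc raddf_sum /= big1 // => k _; rewrite mcoeffZ mcoeffX.
case: eqP => [e|_]; last by rewrite mulr0.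
by have := bmdeg k; rewrite e ltnS h.
Qed.

Lemma agree_trunc d n (f : mps C d) (P : {mpoly C[d]}) :
  (forall m, (mdeg m <= n)%N -> P@_m = f m) -> agree n P (trunc n f).
Proof. by move=> h m mn; rewrite h // trunc_coef mn. Qed.

Lemma agree_trans d n (P Q S : {mpoly C[d]}) : agree n P Q -> agree n Q S -> agree n P S.
Proof. by move=> h h' m mn; rewrite h // h'. Qed.

Lemma agreeM d n (P P' Q Q' : {mpoly C[d]}) :
  agree n P P' -> agree n Q Q' -> agree n (P * Q) (P' * Q').
Proof.
move=> h h' m mn; rewrite !mcoeffM; apply: eq_bigr => -[k1 k2] /= _.
have le (k : 'X_{1..d < (mdeg m).+1}) : (mdeg k <= n)%N.
  by apply: leq_trans mn; rewrite -ltnS bmdeg.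
by rewrite h ?h' ?le.
Qed.

Lemma agree_prodX d e n (l l' : 'I_e -> {mpoly C[d]}) (m : 'X_{1..e}) :
  (forall i, agree n (l i) (l' i)) ->
  agree n (\prod_(i < e) l i ^+ m i) (\prod_(i < e) l' i ^+ m i).
Proof.
move=> h; apply: (big_ind2 (@agree d n)) => // [P P' Q Q'|i _]; first exact: agreeM.
by elim: (m i) => [|k IH]; rewrite ?expr0 // !exprS; apply: agreeM.
Qed.

Lemma ordgeM d a b (P Q : {mpoly C[d]}) : ordge a P -> ordge b Q -> ordge (a + b) (P * Q).
Proof.
move=> h h' m mab; rewrite mcoeffM big1 // => -[k1 k2] /= /eqP e.
have : (mdeg k1 < a)%N || (mdeg k2 < b)%N.
  by have := congr1 mdeg e; rewrite mdegD; lia.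
by case/orP => [/h|/h'] ->; rewrite ?mul0r ?mulr0.
Qed.

Lemma ordge_prodX d e (l : 'I_e -> {mpoly C[d]}) (m : 'X_{1..e}) :
  (forall i, (l i)@_0%MM = 0) -> ordge (mdeg m) (\prod_(i < e) l i ^+ m i).
Proof.
move=> h; rewrite mdegE; apply: (big_ind2 (fun (P : {mpoly C[d]}) k => ordge k P)) => //.
  by move=> P a Q b; apply: ordgeM.
move=> i _; elim: (m i) => [|k IH]; first by [].
rewrite exprS -add1n; apply: ordgeM => // m'.
by rewrite ltnS leqn0 mdeg_eq0 => /eqP ->.
Qed.

(** Since the inner polynomials have no constant term, a monomial of degree above n in the outer one
    contributes nothing in degrees up to n. *)
Lemma agree_comp d e n (P P' : {mpoly C[e]}) (l l' : e.-tuple {mpoly C[d]}) :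
  agree n P P' -> (forall i, agree n (tnth l i) (tnth l' i)) ->
  (forall i, (tnth l' i)@_0%MM = 0) -> agree n (P \mPo l) (P' \mPo l').
Proof.
move=> hP hl h0; apply: (@agree_trans _ _ _ (P \mPo l')).
  move=> m mn; rewrite !comp_mpolyE !raddf_sum /=; apply: eq_bigr => k _.
  by rewrite !mcoeffZ (agree_prodX _ hl).
move=> m mn; apply/eqP; rewrite -subr_eq0 -mcoeffB -comp_mpolyB comp_mpolyE raddf_sum /=.
rewrite big1 // => k _; rewrite mcoeffZ; case: (leqP (mdeg k) n) => kn.
  by rewrite mcoeffB hP // subrr mul0r.
by rewrite (ordge_prodX h0) ?mulr0 // (leq_ltn_trans mn).
Qed.

Lemma mpsM_agree d n (f g : mps C d) :
  agree n (trunc n f * trunc n g) (trunc n (mpsM f g)).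
Proof.
apply: agree_trunc => m mn; rewrite /mpsM; apply: (agreeM (n := mdeg m)) => //.
all: by move=> k km; rewrite !trunc_coef km (leq_trans km).
Qed.

Lemma mps_comp_agree d e n (f : mps C e) (g : e.-tuple (mps C d)) :
  (forall i, tnth g i 0%MM = 0) ->
  agree n (trunc n f \mPo [tuple of map (trunc n) g]) (trunc n (mps_comp f g)).
Proof.
move=> g0; apply: agree_trunc => m mn; rewrite /mps_comp.
apply: (agree_comp (n := mdeg m)) => // [|i|i].
- by move=> k km; rewrite !trunc_coef km (leq_trans km).
- by rewrite !tnth_map => k km; rewrite !trunc_coef km (leq_trans km).
- by rewrite tnth_map trunc_coef; case: ifP.
Qed.

Lemma mps_comp_const d e (f : mps C e) (g : e.-tuple (mps C d)) :
  f 0%MM = 0 -> mps_comp f g 0%MM = 0.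
Proof.
move=> f0; rewrite /mps_comp mdeg0 comp_mpolyE raddf_sum /= big1 // => m _.
rewrite mcoeffZ trunc_coef; case: ifP; rewrite ?mul0r // leqn0 mdeg_eq0 => /eqP ->.
by rewrite f0 mul0r.
Qed.

End TruncatedPolynomials.

(* covers both O_K and O_C *)
Record closed_ring (R : realType) (p : nat) (F : Cp_field R p) := ClosedRing {
  cr : {pred F};
  cr_subring : subring_closed cr;
  cr_le1 : forall x, x \in cr -> nm x <= 1;
  cr_cvg : forall s l, (forall n, s n \in cr) -> cvg_seq (@Cp_norm _ _ F) s l -> l \in cr;
  cr_inv : forall x, x \in cr -> nm x = 1 -> x^-1 \in cr }.

Section ClosedRings.
Variables (R : realType) (p : nat) (F : Cp_field R p).

Section One.
Variable S : closed_ring F.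

Lemma cr1 : 1 \in cr S. Proof. by case: (cr_subring S). Qed.
Lemma crB x y : x \in cr S -> y \in cr S -> x - y \in cr S.
Proof. by case: (cr_subring S) => _ h _; apply: h. Qed.
Lemma crM x y : x \in cr S -> y \in cr S -> x * y \in cr S.
Proof. by case: (cr_subring S) => _ _ h; apply: h. Qed.
Lemma cr0 : 0 \in cr S. Proof. by rewrite -(subrr 1) crB ?cr1. Qed.
Lemma crN x : x \in cr S -> - x \in cr S. Proof. by rewrite -sub0r; apply: crB; apply: cr0. Qed.
Lemma crD x y : x \in cr S -> y \in cr S -> x + y \in cr S.
Proof. by move=> hx hy; rewrite -[y]opprK crB // crN. Qed.
Lemma crX x n : x \in cr S -> x ^+ n \in cr S.
Proof. by move=> h; elim: n => [|n IH]; rewrite ?cr1 // exprS crM. Qed.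
Lemma cr_nat n : n%:R \in cr S.
Proof. by elim: n => [|n IH]; rewrite ?cr0 // -natr1 crD ?cr1. Qed.
Lemma cr_sum (I : Type) (r : seq I) (P : pred I) (f : I -> F) :
  (forall i, P i -> f i \in cr S) -> \sum_(i <- r | P i) f i \in cr S.
Proof. by move=> h; elim/big_ind: _ => //; [apply: cr0 | apply: crD]. Qed.
Lemma cr_tsum a : null a -> (forall i, a i \in cr S) -> tsum a \in cr S.
Proof. by move=> /tsumP h ha; apply: cr_cvg h => n; apply: cr_sum. Qed.

Definition pin d (P : {mpoly F[d]}) := forall m, P@_m \in cr S.

Lemma pinM d (P Q : {mpoly F[d]}) : pin P -> pin Q -> pin (P * Q).
Proof. by move=> h h' m; rewrite mcoeffM cr_sum // => k _; apply: crM. Qed.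

Lemma pin1 d : pin (1 : {mpoly F[d]}).
Proof. by move=> m; rewrite mcoeff1; case: (m == _); rewrite ?cr0 ?cr1. Qed.

Lemma pinX d (P : {mpoly F[d]}) n : pin P -> pin (P ^+ n).
Proof. by move=> h; elim: n => [|n IH]; [apply: pin1 | rewrite exprS; apply: pinM]. Qed.

Lemma pin_comp d e (P : {mpoly F[e]}) (l : e.-tuple {mpoly F[d]}) :
  pin P -> (forall i, pin (tnth l i)) -> pin (P \mPo l).
Proof.
move=> hP hl m; rewrite comp_mpolyE raddf_sum /=; apply: cr_sum => k _.
rewrite mcoeffZ crM //; move: m; apply: (big_ind (@pin d)); first exact: pin1.
  by move=> *; apply: pinM.
by move=> i _; apply: pinX.
Qed.

Lemma pin_trunc d n (f : mps F d) : coefs_in (cr S) f -> pin (trunc n f).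
Proof. by move=> h m; rewrite trunc_coef; case: ifP => // _; apply: cr0. Qed.

Lemma mpsM_in d (f g : mps F d) :
  coefs_in (cr S) f -> coefs_in (cr S) g -> coefs_in (cr S) (mpsM f g).
Proof. by move=> h h' m; apply: pinM; apply: pin_trunc. Qed.

Lemma mps_comp_in d e (f : mps F e) (g : e.-tuple (mps F d)) :
  coefs_in (cr S) f -> (forall i, coefs_in (cr S) (tnth g i)) -> coefs_in (cr S) (mps_comp f g).
Proof.
by move=> h h' m; apply: pin_comp => [|i]; rewrite ?tnth_map; apply: pin_trunc.
Qed.

Lemma bool_in (b : bool) : (b%:R : F) \in cr S.
Proof. by case: b; rewrite ?cr0 ?cr1. Qed.

Lemma var_in d k : coefs_in (cr S) (var F d k). Proof. by move=> m; apply: bool_in. Qed.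
Lemma mps0_in d : coefs_in (cr S) (mps0 F d). Proof. by move=> m; apply: cr0. Qed.
Lemma Xn_in i : coefs_in (cr S) (Xn F i). Proof. by move=> m; apply: bool_in. Qed.

End One.

Lemma OC_subring : subring_closed (OC (@Cp_norm _ _ F)).
Proof.
split=> [|x y|x y]; rewrite !inE /= ?nm1 //; first exact: nmB.
exact: nmM_le1.
Qed.
Lemma OC_le1 x : x \in OC (@Cp_norm _ _ F) -> nm x <= 1. Proof. by rewrite inE. Qed.
Lemma OC_cvg s l : (forall n, s n \in OC (@Cp_norm _ _ F)) ->
  cvg_seq (@Cp_norm _ _ F) s l -> l \in OC (@Cp_norm _ _ F).
Proof. by move=> h hl; rewrite inE /=; apply: (cvg_le (N := 0) hl) => n _; apply: OC_le1. Qed.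
Lemma OC_inv x : x \in OC (@Cp_norm _ _ F) -> nm x = 1 -> x^-1 \in OC (@Cp_norm _ _ F).
Proof. by move=> _ h; rewrite inE /= nmV h invr1. Qed.
Definition OCr := ClosedRing OC_subring OC_le1 OC_cvg OC_inv.

Lemma in_OC (S : closed_ring F) d (f : mps F d) : coefs_in (cr S) f -> coefs_in (cr OCr) f.
Proof. by move=> h m; rewrite inE /= (cr_le1 (h m)). Qed.

Lemma OCrE x : (x \in cr OCr) = (nm x <= 1). Proof. by rewrite inE. Qed.

End ClosedRings.
Arguments OCr {R p F}.

(** * Values on the open unit polydisc *)

Section Evaluation.
Variables (R : realType) (p : nat) (F : Cp_field R p).
Notation cvg s l := (cvg_seq (@Cp_norm _ _ F) s l).
Notation bnd := (coefs_in (cr (@OCr R p F))).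
Implicit Types (d e n : nat).

Definition disc d (v : d.-tuple F) := forall i, nm (tnth v i) < 1.

Definition mev d (f : mps F d) (v : d.-tuple F) : F :=
  lim_seq (@Cp_norm _ _ F) (fun N => (trunc N f).@[tnth v]).

Lemma disc_radius d (v : d.-tuple F) : disc v ->
  exists r : R, [/\ 0 <= r, r < 1 & forall i, nm (tnth v i) <= r].
Proof.
move=> hv; exists (\big[Num.max/0]_(i < d) nm (tnth v i)); split.
- by elim/big_rec: _ => // i x _ x0; rewrite le_max x0 orbT.
- by elim/big_rec: _ => // i x _ x1; rewrite gt_max x1 hv.
- by move=> i; rewrite (bigD1 i) //= le_max lexx.
Qed.

Lemma mmonom_le d (v : d.-tuple F) (r : R) (m : 'X_{1..d}) : 0 <= r ->
  (forall i, nm (tnth v i) <= r) -> nm (\prod_(i < d) tnth v i ^+ m i) <= r ^+ mdeg m.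
Proof.
move=> r0 hv; rewrite mdegE.
apply: (big_ind2 (fun x k => nm x <= r ^+ k)) => [|x a y b hx hy|i _].
- by rewrite nm1 expr0.
- by rewrite nmM exprD ler_pM ?nm_ge0.
- by rewrite nmX lerXn2r ?nnegrE ?nm_ge0.
Qed.

Lemma meval_small d (P : {mpoly F[d]}) (v : d.-tuple F) (r : R) k : 0 <= r -> r <= 1 ->
  (forall i, nm (tnth v i) <= r) -> pin OCr P -> ordge k P -> nm P.@[tnth v] <= r ^+ k.
Proof.
move=> r0 r1 hv hP hk; rewrite mevalE; apply: nm_sum => [|m _]; first exact: exprn_ge0.
case: (ltnP (mdeg m) k) => mk; first by rewrite hk // mul0r nm0 exprn_ge0.
apply: nmM_le; first by have := hP m; rewrite OCrE.
apply: le_trans (mmonom_le _ r0 hv) _.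
by rewrite ler_wiXn2l.
Qed.

Lemma meval_agree d n (P Q : {mpoly F[d]}) (v : d.-tuple F) (r : R) : 0 <= r -> r <= 1 ->
  (forall i, nm (tnth v i) <= r) -> pin OCr P -> pin OCr Q -> agree n P Q ->
  nm (P.@[tnth v] - Q.@[tnth v]) <= r ^+ n.+1.
Proof.
move=> r0 r1 hv hP hQ h; rewrite -mevalB; apply: meval_small => // m.
  by rewrite mcoeffB crB.
by rewrite ltnS mcoeffB => /h ->; rewrite subrr.
Qed.

Lemma mev_cvg d (f : mps F d) v : disc v -> bnd f ->
  cvg (fun N => (trunc N f).@[tnth v]) (mev f v).
Proof.
move=> /disc_radius[r [r0 r1 hv]] hf.
suff [l hl] : exists l, cvg (fun N => (trunc N f).@[tnth v]) l by rewrite /mev (cvg_lim hl).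
case: (Cp_axioms F) => _ compl _ _; apply: compl => e e0.
have [N hN] := expr_small r0 r1 e0; exists N.
have key m n : (N <= m)%N -> (m <= n)%N ->
    nm ((trunc m f).@[tnth v] - (trunc n f).@[tnth v]) < e.
  move=> Nm mn; apply: (@le_lt_trans _ _ (r ^+ m.+1)); last by apply: hN; lia.
  apply: meval_agree; rewrite ?(ltW r1) //; try exact: pin_trunc.
  by move=> k km; rewrite !trunc_coef km (leq_trans km mn).
move=> m n Nm Nn; case: (leqP m n) => mn; first exact: key.
by rewrite nmBC key // ltnW.
Qed.

(** Any bounded polynomials that agree with f up to degree n compute its value. This is applied to
    products and composites of truncations, and to sums over squares. *)
Lemma mev_approx d (f : mps F d) v (P : nat -> {mpoly F[d]}) : disc v -> bnd f ->
  (forall n, pin OCr (P n)) -> (forall n, agree n (P n) (trunc n f)) ->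
  cvg (fun n => (P n).@[tnth v]) (mev f v).
Proof.
move=> dv hf hP Pf; apply: cvg_close (mev_cvg dv hf) _.
have [r [r0 r1 hv]] := disc_radius dv; apply: (null_geom r0 r1) => n.
rewrite nmBC; apply: (@le_trans _ _ (r ^+ n.+1)); last by rewrite ler_wiXn2l // ltW.
by apply: meval_agree; rewrite ?(ltW r1) //; apply: pin_trunc.
Qed.

Lemma mevM d (f g : mps F d) v : disc v -> bnd f -> bnd g ->
  mev (mpsM f g) v = mev f v * mev g v.
Proof.
move=> dv hf hg; apply: (cvg_uniq _ (cvgM (mev_cvg dv hf) (mev_cvg dv hg))).
have := mev_approx dv (mpsM_in hf hg) (fun n => pinM (pin_trunc n hf) (pin_trunc n hg))
  (fun n => @mpsM_agree _ _ n f g).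
by apply: (cvg_eventually (N := 0)) => n _; rewrite mevalM.
Qed.

Lemma mev_lin d (f g : mps F d) c v : disc v -> bnd f -> bnd g -> nm c <= 1 ->
  mev (fun m => c * f m + g m) v = c * mev f v + mev g v.
Proof.
move=> dv hf hg hc.
apply: (cvg_uniq _ (cvgD (cvgMl c (mev_cvg dv hf)) (mev_cvg dv hg))).
have hb : bnd (fun m => c * f m + g m) by move=> m; rewrite crD // crM // OCrE.
apply: (cvg_eventually (N := 0) _ (mev_cvg dv hb)) => n _.
rewrite -mevalZ -mevalD; congr (_.@[_]); apply/mpolyP => m.
by rewrite mcoeffD mcoeffZ !trunc_coef; case: ifP => //; rewrite mulr0 addr0.
Qed.

Lemma mev_in (S : closed_ring F) d (f : mps F d) v : disc v -> coefs_in (cr S) f ->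
  (forall i, tnth v i \in cr S) -> mev f v \in cr S.
Proof.
move=> dv hf hv; apply: cr_cvg (mev_cvg dv (in_OC hf)) => n.
rewrite mevalE; apply: cr_sum => m _; apply: crM; first exact: pin_trunc.
apply: (big_ind (fun x => x \in cr S)) => [||i _]; first exact: cr1.
  by move=> x y; apply: crM.
exact: crX.
Qed.

Lemma mev_le1 d (f : mps F d) v : disc v -> bnd f -> nm (mev f v) <= 1.
Proof.
move=> dv hf; rewrite -OCrE; apply: mev_in => // i.
by rewrite OCrE ltW // dv.
Qed.

Lemma mev_le d (f : mps F d) v (r : R) : 0 <= r -> r < 1 -> (forall i, nm (tnth v i) <= r) ->
  bnd f -> f 0%MM = 0 -> nm (mev f v) <= r.
Proof.
move=> r0 r1 hv hf f0.
have dv : disc v by move=> i; apply: le_lt_trans r1.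
apply: (cvg_le (N := 0) (mev_cvg dv hf)) => n _; rewrite -[r]expr1.
apply: meval_small; rewrite ?(ltW r1) //; first exact: pin_trunc.
by move=> m; rewrite ltnS leqn0 mdeg_eq0 => /eqP ->; rewrite trunc_coef f0 if_same.
Qed.

Lemma mev_lt1 d (f : mps F d) v : disc v -> bnd f -> f 0%MM = 0 -> nm (mev f v) < 1.
Proof.
by move=> /disc_radius[r [r0 r1 hv]] hf f0; apply: (le_lt_trans _ r1); apply: mev_le.
Qed.

Lemma meval_lipschitz d (P : {mpoly F[d]}) (v w : d.-tuple F) (e : R) : 0 <= e ->
  pin OCr P -> (forall i, nm (tnth v i) <= 1) -> (forall i, nm (tnth w i) <= 1) ->
  (forall i, nm (tnth v i - tnth w i) <= e) -> nm (P.@[tnth v] - P.@[tnth w]) <= e.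
Proof.
move=> e0 hP hv hw hvw; rewrite !mevalE -sumrB; apply: nm_sum => // m _.
rewrite -mulrBr; apply: nmM_le; first by have := hP m; rewrite OCrE.
pose rel (x y : F) := [/\ nm x <= 1, nm y <= 1 & nm (x - y) <= e].
have relM x y x' y' : rel x y -> rel x' y' -> rel (x * x') (y * y').
  move=> [a b c] [a' b' c']; split; try exact: nmM_le1.
  have -> : x * x' - y * y' = x * (x' - y') + (x - y) * y' by ring.
  by apply: nmD; [apply: nmM_le | apply: nmMr_le].
have rel1 : rel 1 1 by split; rewrite ?nm1 // subrr nm0.
suff [] : rel (\prod_(i < d) tnth v i ^+ m i) (\prod_(i < d) tnth w i ^+ m i) by [].
apply: (big_ind2 rel) => // i _.
by elim: (m i) => [|k IH]; rewrite ?expr0 // !exprS; apply: relM.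
Qed.

(** The truncations of f are 1-Lipschitz on the closed unit polydisc ([meval_lipschitz]), so
    replacing the values of the inner series by those of their truncations costs at most r^n, where
    r < 1 bounds the coordinates of v. *)
Lemma mev_comp d e (f : mps F e) (g : e.-tuple (mps F d)) v : disc v -> bnd f ->
  (forall i, bnd (tnth g i)) -> (forall i, tnth g i 0%MM = 0) ->
  mev (mps_comp f g) v = mev f [tuple of map (fun h => mev h v) g].
Proof.
move=> dv hf hg g0; set w := [tuple of map _ g].
have dw : disc w by move=> i; rewrite tnth_map mev_lt1.
have h1 := mev_approx dv (mps_comp_in hf hg)
  (fun n => pin_comp (S := OCr) (l := [tuple of map (trunc n) g]) (pin_trunc n hf)
     (fun i => ltac:(by rewrite tnth_map; apply: pin_trunc)))
  (fun n => @mps_comp_agree _ _ _ n f g g0).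
apply: (cvg_uniq h1); apply: cvg_close (mev_cvg dw hf) _.
have [r [r0 r1 hv]] := disc_radius dv; apply: (null_geom r0 r1) => n.
rewrite comp_mpoly_meval.
pose w' := [tuple of map (fun h => (trunc n h).@[tnth v]) g].
have -> : (trunc n f).@[fun i => (tnth [tuple of map (trunc n) g] i).@[tnth v]] =
   (trunc n f).@[tnth w'].
  by apply: meval_eq => i; rewrite !tnth_map.
have v1 i : nm (tnth v i) <= 1 by apply: (le_trans (hv i)); apply: ltW.
have ev1 i : nm (trunc n (tnth g i)).@[tnth v] <= 1.
  rewrite -(expr1n _ 0); apply: meval_small => //; first exact: pin_trunc.
apply: meval_lipschitz; rewrite ?exprn_ge0 //; first exact: pin_trunc.
- by move=> i; apply: ltW.
- by move=> i; rewrite tnth_map.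
move=> i; rewrite !tnth_map; apply: (cvg_le (N := n)
   (cvgB (mev_cvg dv (hg i)) (cvg_cst _))) => m nm_.
apply: (@le_trans _ _ (r ^+ n.+1)); last by rewrite ler_wiXn2l // ltW.
apply: meval_agree; rewrite ?(ltW r1) //; try exact: pin_trunc.
by move=> k km; rewrite !trunc_coef km (leq_trans km).
Qed.

Lemma mev_var d (k : 'I_d) v : disc v -> mev (var F d k) v = tnth v k.
Proof.
move=> dv; apply: (cvg_uniq (mev_cvg dv (@var_in _ _ _ OCr d k))).
apply: (cvg_eventually (N := 1) _ (cvg_cst _)) => n n1.
rewrite -(mevalXU (tnth v) k); congr (_.@[_]); apply/mpolyP => m.
have e : [multinom (val i == k : nat) | i < d] = U_(k)%MM.
  by apply/mnmP => i; rewrite mnmE mnm1E eq_sym.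
rewrite mcoeffX trunc_coef /var e [m == _]eq_sym; case: eqP => [<-|_].
  by rewrite mdeg1 n1.
by rewrite if_same.
Qed.

Lemma mev0 d v : mev (mps0 F d) v = 0.
Proof.
apply: cvg_lim; apply: (cvg_eventually (N := 0) _ (cvg_cst _)) => n _.
rewrite -(meval0 (tnth v)); congr (_.@[_]); apply/mpolyP => m.
by rewrite mcoeff0 trunc_coef if_same.
Qed.

Lemma mev1 d v : mev (mps1 F d) v = 1.
Proof.
apply: cvg_lim; apply: (cvg_eventually (N := 0) _ (cvg_cst _)) => n _.
rewrite -(meval1 (tnth v)); congr (_.@[_]); apply/mpolyP => m.
rewrite mcoeff1 trunc_coef /mps1; case: eqP => [->|_]; first by rewrite mdeg0.
by rewrite if_same.
Qed.

End Evaluation.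

#[global] Opaque mev mps_comp.

(** * Series in one variable and Weierstrass division *)

Section OneVariable.
Variable C : fieldType.

Definition ser (f : mps C 1) : nat -> C := fun i => f (exp1 i).
Definition mk (a : nat -> C) : mps C 1 := fun m => a (mdeg m).

Lemma mdeg_exp1 i : mdeg (exp1 i) = i.
Proof. by rewrite mdegE big_ord1 /exp1 multinomE. Qed.

Lemma exp1_mdeg (m : 'X_{1..1}) : exp1 (mdeg m) = m.
Proof. by apply/mnmP => i; rewrite (ord1 i) mdegE big_ord1 /exp1 multinomE. Qed.

Lemma exp1_inj : injective exp1.
Proof. by move=> i j /(congr1 mdeg); rewrite !mdeg_exp1. Qed.

Lemma mkK f : mk (ser f) = f.
Proof. by apply: funext => m; rewrite /mk /ser exp1_mdeg. Qed.

Lemma serK a : ser (mk a) = a.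
Proof. by apply: funext => i; rewrite /mk /ser mdeg_exp1. Qed.

Lemma exp10 : exp1 0 = 0%MM.
Proof. by apply/eqP; rewrite -mdeg_eq0 mdeg_exp1. Qed.

Lemma exp2_nth (m : 'X_{1..2}) : exp2 (m ord0) (m ord_max) = m.
Proof.
apply/mnmP => i; rewrite /exp2 multinomE (tnth_nth 0%N) /=.
by case: i => -[|[|//]] hi /=; congr (fun_of_multinom m _); apply: val_inj.
Qed.

Lemma exp2_fst i j : exp2 i j ord0 = i. Proof. by []. Qed.
Lemma exp2_snd i j : exp2 i j ord_max = j. Proof. by []. Qed.

Lemma mdeg_exp2 i j : mdeg (exp2 i j) = (i + j)%N.
Proof. by rewrite mdegE big_ord_recl big_ord1 /exp2 !multinomE. Qed.

Lemma trunc1E n (f : mps C 1) :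
  trunc n f = \sum_(i < n.+1) f (exp1 i) *: 'X_[exp1 i].
Proof.
apply/mpolyP => m; rewrite trunc_coef raddf_sum /=.
case: ifP => mn.
  rewrite (bigD1 (Ordinal (mn : (mdeg m < n.+1)%N))) //= exp1_mdeg mcoeffZ mcoeffX eqxx mulr1.
  rewrite big1 ?addr0 // => i /eqP ni; rewrite mcoeffZ mcoeffX; case: eqP; rewrite ?mulr0 //.
  by move=> e; case: ni; apply: val_inj; rewrite /= -e mdeg_exp1.
rewrite big1 // => i _; rewrite mcoeffZ mcoeffX; case: eqP; rewrite ?mulr0 // => e.
by move: mn; rewrite -e mdeg_exp1 -ltnS ltn_ord.
Qed.

Definition smul (a b : nat -> C) : nat -> C := fun n => \sum_(i < n.+1) a i * b (n - i)%N.

Lemma exp1D i j : (exp1 i + exp1 j)%MM = exp1 (i + j).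
Proof. by rewrite -[LHS]exp1_mdeg mdegD !mdeg_exp1. Qed.

Lemma ser_mpsM f g : ser (mpsM f g) = smul (ser f) (ser g).
Proof.
apply: funext => n; rewrite /ser /mpsM mdeg_exp1 !trunc1E mulr_suml raddf_sum /=.
apply: eq_bigr => i _; rewrite mulr_sumr raddf_sum /=.
have hi : (n - i < n.+1)%N by rewrite ltnS leq_subr.
rewrite (bigD1 (Ordinal hi)) //= -scalerAl -scalerAr -mpolyXD exp1D !mcoeffZ mcoeffX.
rewrite subnKC ?eqxx ?mulr1; last by rewrite -ltnS.
rewrite big1 ?addr0 // => j /eqP nj; rewrite -scalerAl -scalerAr -mpolyXD exp1D !mcoeffZ mcoeffX.
case: eqP => [/exp1_inj e|_]; last by rewrite !mulr0.
by case: nj; apply: val_inj => /=; lia.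
Qed.

Lemma smulC a b : smul a b = smul b a.
Proof.
apply: funext => n; rewrite /smul (reindex_inj rev_ord_inj) /=.
by apply: eq_bigr => i _; rewrite subSS mulrC subKn // -ltnS.
Qed.

Lemma smulDl a b c n : smul (fun i => a i + b i) c n = smul a c n + smul b c n.
Proof. by rewrite /smul -big_split; apply: eq_bigr => i _; rewrite mulrDl. Qed.

Lemma smulZl k a b n : smul (fun i => k * a i) b n = k * smul a b n.
Proof. by rewrite /smul mulr_sumr; apply: eq_bigr => i _; rewrite mulrA. Qed.

Lemma smulDr a b c n : smul a (fun i => b i + c i) n = smul a b n + smul a c n.
Proof. by rewrite smulC smulDl !(smulC a). Qed.

Lemma smulZr k a b n : smul a (fun i => k * b i) n = k * smul a b n.
Proof. by rewrite smulC smulZl (smulC a). Qed.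

(** Multiplication by X^q. *)
Definition xshift q (a : nat -> C) : nat -> C := fun i => if (i < q)%N then 0 else a (i - q)%N.

Lemma smul_xshift q a b n : smul (xshift q a) b n = xshift q (smul a b) n.
Proof.
rewrite /smul /xshift -(big_mkord predT (fun i => (if (i < q)%N then 0 else a (i - q)%N) * b (n -
  i)%N)).
case: ltnP => nq.
  by rewrite big1_seq // => i; rewrite mem_index_iota => /andP[_ /andP[_ hi]];
    rewrite (leq_trans hi) ?mul0r.
rewrite (big_cat_nat (leq0n q)) /=; last by lia.
rewrite big1_seq ?add0r => [|i]; last first.
  by rewrite mem_index_iota => /andP[_ /andP[_ hi]]; rewrite hi mul0r.
rewrite -{1}[q]add0n big_addn (_ : (n.+1 - q = (n - q).+1)%N) ?big_mkord; last by lia.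
apply: eq_bigr => i _.
have -> : (i + q < q)%N = false by lia.
by rewrite addnK; congr (_ * b _); lia.
Qed.

(** Course-of-values recursion for the quotient b / a, with a(0) invertible: the list holds the
    coefficients already found. *)
Fixpoint sdiv_seq (b a : nat -> C) n : seq C :=
  if n is n'.+1 then let l := sdiv_seq b a n' in
    rcons l ((a 0%N)^-1 * (b n' - \sum_(i < n') l`_i * a (n' - i)%N))
  else [::].

Definition sdiv (b a : nat -> C) n := (sdiv_seq b a n.+1)`_n.

Lemma size_sdiv_seq b a n : size (sdiv_seq b a n) = n.
Proof. by elim: n => //= n IH; rewrite size_rcons IH. Qed.

Lemma nth_sdiv_seq b a n i : (i < n)%N -> (sdiv_seq b a n)`_i = sdiv b a i.
Proof.
elim: n => // n IH; rewrite ltnS leq_eqVlt => /orP[/eqP -> //|h].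
by rewrite /= nth_rcons size_sdiv_seq h IH.
Qed.

Lemma sdivE b a n :
  sdiv b a n = (a 0%N)^-1 * (b n - \sum_(i < n) sdiv b a i * a (n - i)%N).
Proof.
rewrite /sdiv /= nth_rcons size_sdiv_seq ltnn eqxx; congr (_ * (_ - _)).
by apply: eq_bigr => i _; rewrite nth_sdiv_seq.
Qed.

Lemma smul_sdiv b a : a 0%N != 0 -> smul a (sdiv b a) = b.
Proof.
move=> a0; rewrite smulC; apply: funext => n; rewrite /smul big_ord_recr /= subnn.
by rewrite [sdiv b a n]sdivE mulrAC mulVf // mul1r addrC subrK.
Qed.

Lemma tnth1_in d (A : {pred C}) (a : mps C d) :
  coefs_in A a -> forall i, coefs_in A (tnth [tuple a] i).
Proof. by move=> ha i; rewrite (ord1 i). Qed.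

Lemma tnth2_in d (A : {pred C}) (a b : mps C d) :
  coefs_in A a -> coefs_in A b -> forall i, coefs_in A (tnth [tuple a; b] i).
Proof. by move=> ha hb i; rewrite (tnth_nth a); case: i => -[|[|//]]. Qed.

Lemma tnth3_in d (A : {pred C}) (a b c : mps C d) :
  coefs_in A a -> coefs_in A b -> coefs_in A c -> forall i, coefs_in A (tnth [tuple a; b; c] i).
Proof. by move=> ha hb hc i; rewrite (tnth_nth a); case: i => -[|[|[|//]]]. Qed.

End OneVariable.
Arguments exp1_mdeg m : clear implicits.

Section Series.
Variables (R : realType) (p : nat) (F : Cp_field R p).
Notation cvg s l := (cvg_seq (@Cp_norm _ _ F) s l).
Notation bnd := (coefs_in (cr (@OCr R p F))).
Implicit Types (a b g h : nat -> F) (x y : F).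

Definition ser_over (S : closed_ring F) a := forall i, a i \in cr S.
Notation sbnd := (ser_over OCr).

Lemma mk_in S a : ser_over S a -> coefs_in (cr S) (mk a).
Proof. by move=> h m; apply: h. Qed.

Lemma ser_in S f : coefs_in (cr S) f -> ser_over S (ser f).
Proof. by move=> h i; apply: h. Qed.

Lemma sin_OC S a : ser_over S a -> sbnd a.
Proof. by move=> h i; rewrite OCrE (cr_le1 (h i)). Qed.

Lemma sbndE a i : sbnd a -> nm (a i) <= 1.
Proof. by move=> /(_ i); rewrite OCrE. Qed.

Lemma smul_in S a b : ser_over S a -> ser_over S b -> ser_over S (smul a b).
Proof. by move=> ha hb n; apply: cr_sum => i _; apply: crM. Qed.

Lemma disc1 x : nm x < 1 -> disc [tuple x].
Proof. by move=> h i; rewrite (ord1 i). Qed.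

Lemma disc2 x y : nm x < 1 -> nm y < 1 -> disc [tuple x; y].
Proof. by move=> hx hy i; rewrite (tnth_nth 0); case: i => -[|[|//]]. Qed.

Lemma disc3 x y z : nm x < 1 -> nm y < 1 -> nm z < 1 -> disc [tuple x; y; z].
Proof. by move=> hx hy hz i; rewrite (tnth_nth 0); case: i => -[|[|[|//]]]. Qed.

Definition ev a x : F := tsum (fun i => a i * x ^+ i).

Lemma null_ev a x : nm x < 1 -> sbnd a -> null (fun i => a i * x ^+ i).
Proof. by move=> x1 ha; apply: null_mulr (null_pow x1) => i; apply: sbndE. Qed.

Lemma mev1E f x : nm x < 1 -> bnd f -> mev f [tuple x] = ev (ser f) x.
Proof.
move=> x1 hf; have h := mev_cvg (disc1 x1) hf; apply: (cvg_uniq h).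
have := cvg_shift 1 (tsumP (null_ev x1 (ser_in hf))).
apply: (cvg_eventually (N := 0)) => n _.
rewrite trunc1E raddf_sum /= addn1; apply: eq_bigr => i _.
by rewrite mevalZ mevalX big_ord1 /exp1 multinomE.
Qed.

Lemma mps_evalE f x : mps_eval (@Cp_norm _ _ F) f x = ev (ser f) x.
Proof. by []. Qed.

Lemma ev_in S a x : nm x < 1 -> ser_over S a -> x \in cr S -> ev a x \in cr S.
Proof.
move=> x1 ha hx; apply: cr_tsum; first exact: null_ev x1 (sin_OC ha).
by move=> i; rewrite crM // crX.
Qed.

Lemma ev_le1 a x : nm x < 1 -> sbnd a -> nm (ev a x) <= 1.
Proof. by move=> x1 ha; rewrite -OCrE ev_in // OCrE ltW. Qed.

Lemma ev_bound a x B : 0 <= B -> nm x < 1 -> sbnd a -> (forall i, nm (a i) <= B) -> nm (ev a x)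
  <= B.
Proof.
move=> B0 x1 ha hB; apply: tsum_le => //; first exact: null_ev.
by move=> i; apply: nmMr_le => //; apply: nmX_le1; apply: ltW.
Qed.

Lemma ev_split k a x : nm x < 1 -> sbnd a ->
  ev a x = \sum_(i < k) a i * x ^+ i + x ^+ k * ev (fun i => a (i + k)%N) x.
Proof.
move=> x1 ha; rewrite /ev (tsum_split k (null_ev x1 ha)) -tsumMl; last first.
  by apply: null_ev => // i; apply: ha.
by congr (_ + _); apply: eq_tsum => i; rewrite exprD; ring.
Qed.

Lemma ev_recl a x : nm x < 1 -> sbnd a -> ev a x = a 0%N + x * ev (fun i => a i.+1) x.
Proof.
move=> x1 ha; rewrite (ev_split 1 x1 ha) big_ord1 expr0 mulr1 expr1.
by congr (_ + _ * ev _ _); apply: funext => i; rewrite addn1.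
Qed.

Lemma ev_smul a b x : nm x < 1 -> sbnd a -> sbnd b -> ev (smul a b) x = ev a x * ev b x.
Proof.
move=> x1 /mk_in ha /mk_in hb.
by have := mevM (disc1 x1) ha hb; rewrite !mev1E ?ser_mpsM ?serK //; apply: mpsM_in.
Qed.

Lemma evD a b x : nm x < 1 -> sbnd a -> sbnd b ->
  ev (fun i => a i + b i) x = ev a x + ev b x.
Proof.
move=> x1 ha hb; rewrite /ev -tsumD; try exact: null_ev.
by apply: eq_tsum => i; rewrite mulrDl.
Qed.

Lemma evZ c a x : nm x < 1 -> sbnd a -> ev (fun i => c * a i) x = c * ev a x.
Proof.
move=> x1 ha; rewrite /ev -tsumMl; last exact: null_ev.
by apply: eq_tsum => i; rewrite mulrA.
Qed.

Lemma evB a b x : nm x < 1 -> sbnd a -> sbnd b ->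
  ev (fun i => a i - b i) x = ev a x - ev b x.
Proof.
move=> x1 ha hb; rewrite /ev -tsumB; try exact: null_ev.
by apply: eq_tsum => i; rewrite mulrBl.
Qed.

Lemma ev_poly a x q : (forall i, (q <= i)%N -> a i = 0) -> ev a x = \sum_(i < q) a i * x ^+ i.
Proof. by move=> h; apply: tsum_fin => i /h ->; rewrite mul0r. Qed.

Lemma ev_const c x : ev (fun i => if i == 0%N then c else 0) x = c.
Proof. by rewrite /ev (@tsum1 _ _ _ 0) => [|[|i]] //=; rewrite ?mulr1 ?mul0r. Qed.

Lemma ev0 a : ev a 0 = a 0%N.
Proof. by rewrite /ev (@tsum1 _ _ _ 0) => [|[|i]] //=; rewrite ?mulr1 // expr0n mulr0. Qed.

(** If the coefficients below j vanish, then a zero at x = p^(N+1) expresses a_j as -x times an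
    integral element, so a_j is arbitrarily small. *)
Lemma ev_inj0 a : sbnd a -> (forall x, nm x < 1 -> ev a x = 0) -> forall i, a i = 0.
Proof.
move=> ha h j; elim/ltn_ind: j => j IH.
apply: small_eq0 => e e0.
have [N hN] := expr_small (nm_ge0 (p%:R : F)) (nm_p_lt1 F) e0.
pose x : F := p%:R ^+ N.+1.
have x1 : nm x < 1 by rewrite nmX exprn_ilt1 ?nm_ge0 ?nm_p_lt1.
have x0 : x != 0 by rewrite expf_neq0 // p_neq0.
have aj : sbnd (fun i => a (i + j)%N) by move=> i; apply: ha.
have := h x x1; rewrite (ev_split j x1 ha) big1 => [|i _]; last by rewrite IH ?mul0r.
rewrite add0r => /eqP; rewrite mulf_eq0 expf_eq0 (negbTE x0) andbF /=.
rewrite ev_recl // add0n addr_eq0 => /eqP ->.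
rewrite nmN nmM; apply: (@le_lt_trans _ _ (nm x)); last by rewrite nmX hN.
by rewrite ler_piMr ?nm_ge0 //; apply: ev_le1 => // i; apply: ha.
Qed.

Lemma ev_inj a b : sbnd a -> sbnd b -> (forall x, nm x < 1 -> ev a x = ev b x) -> a = b.
Proof.
move=> ha hb h; apply: funext => i; apply/eqP; rewrite -subr_eq0; apply/eqP.
apply: (ev_inj0 (a := fun i => a i - b i)) => [j|x x1]; first exact: crB.
by rewrite evB // h // subrr.
Qed.

Lemma null2_ev (f : nat -> nat -> F) x y : nm x < 1 -> nm y < 1 ->
  (forall i j, nm (f i j) <= 1) -> null2 (fun i j => f i j * (x ^+ i * y ^+ j)).
Proof.
move=> x1 y1 hf e e0.
have [N hN] := expr_small (nm_ge0 x) x1 e0; have [M hM] := expr_small (nm_ge0 y) y1 e0.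
exists (maxn N M) => i j ij.
apply: (@le_lt_trans _ _ (nm (x ^+ i * y ^+ j))); first by apply: nmM_le.
rewrite nmM !nmX; case/orP: ij; rewrite geq_max => /andP[hi hj].
  apply: le_lt_trans (hN _ hi); rewrite ler_piMr ?exprn_ge0 ?nm_ge0 //.
  by rewrite exprn_ile1 ?nm_ge0 // ltW.
apply: le_lt_trans (hM _ hj); rewrite ler_piMl ?exprn_ge0 ?nm_ge0 //.
by rewrite exprn_ile1 ?nm_ge0 // ltW.
Qed.

Lemma mev2E (f : mps F 2) x y : nm x < 1 -> nm y < 1 -> bnd f ->
  mev f [tuple x; y] = ev (fun i => ev (fun j => f (exp2 i j)) y) x.
Proof.
move=> x1 y1 hf.
(* [mev] truncates by total degree and the iterated sum by squares; the square polynomial agrees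
   with the truncation up to degree n. *)
pose P n : {mpoly F[2]} := \sum_(i < n.+1) \sum_(j < n.+1) f (exp2 i j) *: 'X_[exp2 i j].
have coefP n m : (P n)@_m = if (m ord0 <= n)%N && (m ord_max <= n)%N then f m else 0.
  rewrite raddf_sum /= (eq_bigr (fun i : 'I_n.+1 => \sum_(j < n.+1)
     if (i == m ord0 :> nat) && (j == m ord_max :> nat) then f m else 0)); last first.
    move=> i _; rewrite raddf_sum /=; apply: eq_bigr => j _; rewrite mcoeffZ mcoeffX.
    case: eqP => [<-|ne]; first by rewrite exp2_fst exp2_snd !eqxx mulr1.
    rewrite mulr0; case: andP => // -[/eqP e1 /eqP e2].
    by case: ne; rewrite e1 e2 exp2_nth.
  case: ifP => [/andP[h1 h2]|h].
    rewrite (bigD1 (Ordinal (h1 : (m ord0 < n.+1)%N))) //= eqxx /=.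
    rewrite (bigD1 (Ordinal (h2 : (m ord_max < n.+1)%N))) //= eqxx /=.
    rewrite big1 => [|j /eqP nj]; last by case: eqP => // e; case: nj; apply: val_inj.
    rewrite big1 ?addr0 // => i /eqP ni; rewrite big1 // => j _.
    by case: eqP => // e; case: ni; apply: val_inj.
  rewrite big1 // => i _; rewrite big1 // => j _; case: andP => // -[/eqP e1 /eqP e2].
  by have := ltn_ord i; have := ltn_ord j; lia.
have hP n : pin OCr (P n) by move=> m; rewrite coefP; case: ifP => // _; apply: cr0.
have Pf n : agree n (P n) (trunc n f).
  move=> m mn; rewrite coefP trunc_coef mn ifT //.
  by move: mn; rewrite mdegE big_ord_recl big_ord1 /= -(_ : lift ord0 ord0 = ord_max);
    [lia | apply: val_inj].
apply: (cvg_uniq (mev_approx (disc2 x1 y1) hf hP Pf)).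
have hb i j : nm (f (exp2 i j)) <= 1 by have := hf (exp2 i j); rewrite OCrE.
have n2 := null2_ev x1 y1 hb.
have -> : ev (fun i => ev (fun j => f (exp2 i j)) y) x =
    tsum (fun i => tsum (fun j => f (exp2 i j) * (x ^+ i * y ^+ j))).
  apply: eq_tsum => i; rewrite /ev mulrC -tsumMl; last by apply: null_ev => // j; apply: hf.
  by apply: eq_tsum => j; ring.
have := cvg_shift 1 (cvg_tsum2 n2); apply: (cvg_eventually (N := 0)) => n _.
rewrite addn1 raddf_sum; apply: eq_bigr => i _; rewrite raddf_sum; apply: eq_bigr => j _ /=.
rewrite mevalZ mevalX big_ord_recl big_ord1 /exp2 !multinomE.
by rewrite (tnth_nth 0) (tnth_nth 0%N) (tnth_nth 0) (tnth_nth 0%N).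
Qed.

(** One variable at a time: for each y the coefficients of X^i are equal, and each of these is a
    series in y to which [ev_inj] applies again. *)
Lemma mev2_inj (f g : mps F 2) : bnd f -> bnd g ->
  (forall x y, nm x < 1 -> nm y < 1 -> mev f [tuple x; y] = mev g [tuple x; y]) -> f = g.
Proof.
move=> hf hg h; apply: funext => m; rewrite -(exp2_nth m).
have key y : nm y < 1 -> (fun i => ev (fun j => f (exp2 i j)) y) = (fun i => ev (fun j => g (exp2
  i j)) y).
  move=> y1; apply: ev_inj.
  - by move=> i; rewrite OCrE ev_le1 // => j; apply: hf.
  - by move=> i; rewrite OCrE ev_le1 // => j; apply: hg.
  - by move=> x x1; rewrite -!mev2E ?h.
have : (fun j => f (exp2 (m ord0) j)) = (fun j => g (exp2 (m ord0) j)).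
  apply: ev_inj => [j|j|y y1]; [exact: hf | exact: hg |].
  by have := congr1 (fun k => k (m ord0)) (key y y1).
by move/(congr1 (fun k => k (m ord_max))).
Qed.

Lemma mev_comp1 d (f : mps F 1) (g : mps F d) v : disc v -> bnd f -> bnd g -> g 0%MM = 0 ->
  mev (mps_comp f [tuple g]) v = ev (ser f) (mev g v).
Proof.
move=> dv hf hg g0; rewrite mev_comp // => [|i|i]; rewrite ?(ord1 i) //.
by rewrite -mev1E ?mev_lt1 //; congr mev; apply: val_inj.
Qed.

Lemma mev_comp2 d (f : mps F 2) (g h : mps F d) v : disc v -> bnd f ->
  bnd g -> bnd h -> g 0%MM = 0 -> h 0%MM = 0 ->
  mev (mps_comp f [tuple g; h]) v = mev f [tuple mev g v; mev h v].
Proof.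
move=> dv hf hg hh g0 h0; rewrite mev_comp //.
- by congr mev; apply: val_inj.
- by move=> i m; rewrite (tnth_nth g); case: i => -[|[|//]] /= _.
- by move=> i; rewrite (tnth_nth g); case: i => -[|[|//]] /= _.
Qed.

Lemma mevB d (f g : mps F d) v : disc v -> bnd f -> bnd g ->
  mev (mpsB f g) v = mev f v - mev g v.
Proof.
move=> dv hf hg; have := mev_lin dv hg hf (_ : nm (-1) <= 1).
rewrite nmN1 mulN1r addrC => <- //; congr mev; apply: funext => m.
by rewrite /mpsB mulN1r addrC.
Qed.

Lemma mev_sum d k (f : 'I_k -> mps F d) v : disc v -> (forall i, bnd (f i)) ->
  mev (fun m => \sum_(i < k) f i m) v = \sum_(i < k) mev (f i) v.
Proof.
move=> dv hf; have hb : bnd (fun m => \sum_(i < k) f i m).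
  by move=> m; apply: cr_sum => i _; apply: hf.
apply: (cvg_uniq (mev_cvg dv hb)).
have := cvg_sum (index_enum 'I_k) (fun i => mev_cvg dv (hf i)).
apply: (cvg_eventually (N := 0)) => n _; rewrite -raddf_sum; congr (_.@[_]).
apply/mpolyP => m; rewrite raddf_sum /= trunc_coef.
under eq_bigr do rewrite trunc_coef.
by case: ifP => // _; rewrite big1.
Qed.

(** A congruence becomes an identity between values with bounded cofactors; at torsion points some
    of the generators vanish, and elsewhere their norms measure the error. *)
Lemma in_ideal_ev S d k (gs : k.-tuple (mps F d)) (f : mps F d) :
  in_ideal (cr S) gs f -> (forall i, bnd (tnth gs i)) ->
  exists2 h : 'I_k -> mps F d, (forall i, coefs_in (cr S) (h i)) &
    forall v, disc v -> mev f v = \sum_(i < k) mev (tnth gs i) v * mev (h i) v.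
Proof.
case=> h hh fE hgs; exists h => // v dv.
have -> : f = fun m => \sum_(i < k) mpsM (tnth gs i) (h i) m by apply: funext.
rewrite mev_sum // => [|i]; last by apply: mpsM_in => //; apply: in_OC (hh i).
by apply: eq_bigr => i _; rewrite mevM //; apply: in_OC (hh i).
Qed.

Lemma in_ideal_ev1 S d (g f : mps F d) : in_ideal (cr S) [tuple g] f -> bnd g ->
  exists2 h : mps F d, coefs_in (cr S) h & forall v, disc v -> mev f v = mev g v * mev h v.
Proof.
move=> hi hg; have [h hh he] := in_ideal_ev hi (tnth1_in hg).
by exists (h ord0) => // v dv; rewrite he // big_ord1.
Qed.

Lemma in_ideal_ev2 S d (g1 g2 f : mps F d) :
  in_ideal (cr S) [tuple g1; g2] f -> bnd g1 -> bnd g2 ->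
  exists h1 h2 : mps F d, [/\ coefs_in (cr S) h1, coefs_in (cr S) h2 & forall v, disc v ->
    mev f v = mev g1 v * mev h1 v + mev g2 v * mev h2 v].
Proof.
move=> hi hg1 hg2; have [h hh he] := in_ideal_ev hi (tnth2_in hg1 hg2).
by exists (h ord0), (h (lift ord0 ord0)); split=> // v dv; rewrite he // big_ord_recl big_ord1.
Qed.

Lemma in_ideal_ev3 S d (g1 g2 g3 f : mps F d) :
  in_ideal (cr S) [tuple g1; g2; g3] f -> bnd g1 -> bnd g2 -> bnd g3 ->
  exists h1 h2 h3 : mps F d, [/\ coefs_in (cr S) h1, coefs_in (cr S) h2, coefs_in (cr S) h3 &
    forall v, disc v -> mev f v = mev g1 v * mev h1 v + mev g2 v * mev h2 v + mev g3 v * mev h3 v].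
Proof.
move=> hi hg1 hg2 hg3; have [h hh he] := in_ideal_ev hi (tnth3_in hg1 hg2 hg3).
exists (h ord0), (h (lift ord0 ord0)), (h (lift ord0 (lift ord0 ord0))); split=> // v dv.
by rewrite he // !big_ord_recl big_ord0 addr0 addrA.
Qed.

(** * Weierstrass division and its uniqueness *)

Section Weierstrass.
Variable S : closed_ring F.

Lemma sdiv_in b a : nm (a 0%N) = 1 -> ser_over S a -> ser_over S b -> ser_over S (sdiv b a).
Proof.
move=> a0 ha hb; elim/ltn_ind => n IH; rewrite sdivE; apply: crM; first exact: cr_inv.
by apply: crB => //; apply: cr_sum => i _; apply: crM => //; apply: IH.
Qed.

Lemma smul_unit_le a h B : nm (a 0%N) = 1 -> sbnd a -> 0 <= B ->
  (forall i, nm (smul a h i) <= B) -> forall i, nm (h i) <= B.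
Proof.
move=> a0 ha B0 hB; elim/ltn_ind => n IH.
have e : a 0%N * h n = smul a h n - \sum_(i < n) h i * a (n - i)%N.
  by rewrite smulC /smul big_ord_recr /= subnn; ring.
have -> : nm (h n) = nm (a 0%N * h n) by rewrite nmM a0 mul1r.
rewrite e; apply: nmB => //; apply: nm_sum => // i _; apply: nmMr_le; first exact: IH.
exact: sbndE.
Qed.

(** The coefficients below q share a divisor c of norm < 1. Over O_K it will be p; over O_C it will
    be a low coefficient of largest norm, or 0. *)
Variables (g : nat -> F) (q : nat) (c : F).
Hypotheses (g_in : ser_over S g) (gq : nm (g q) = 1) (c_in : c \in cr S) (c1 : nm c < 1).
Hypothesis g_low : forall i, (i < q)%N -> exists2 x, x \in cr S & g i = c * x.

Let al_ex : exists2 al, ser_over S al & forall i, (i < q)%N -> g i = c * al i.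
Proof.
have h i : exists x, x \in cr S /\ ((i < q)%N -> g i = c * x).
  case: (ltnP i q) => iq; last by exists 0; rewrite cr0.
  by have [x hx e] := g_low iq; exists x.
have [al hal] := choice h.
by exists al => i; have [] := hal i.
Qed.

Let al0 := sval (cid2 al_ex).
Let al i := if (i < q)%N then al0 i else 0.
Let be i := g (i + q)%N.

Let al_in : ser_over S al.
Proof. by move=> i; rewrite /al /al0; case: cid2 => a /= h _; case: ifP => // _; apply: cr0. Qed.

Let gE i : g i = c * al i + xshift q be i.
Proof.
rewrite /al /al0 /xshift /be; case: cid2 => a /= _ h; case: ltnP => iq.
  by rewrite addr0 h.
by rewrite mulr0 add0r subnK.
Qed.

Let be0 : nm (be 0) = 1. Proof. by []. Qed.
Let be_in : ser_over S be. Proof. by move=> i; apply: g_in. Qed.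

Let smulg h n : smul g h n = c * smul al h n + xshift q (smul be h) n.
Proof.
rewrite -smul_xshift -smulZl -smulDl /smul.
by apply: eq_bigr => i _; rewrite -gE.
Qed.

(** One step of the division, with g = c al + X^q be and be invertible. Dividing the part of f of
    degree at least q by be leaves the low part of f as remainder and the error -c al (quo f), which
    is c times [next f]. *)
Let quo f := sdiv (fun i => f (i + q)%N) be.
Let next f : nat -> F := fun i => - smul al (quo f) i.
Let low (f : nat -> F) i := if (i < q)%N then f i else 0.

Let quo_in f : ser_over S f -> ser_over S (quo f).
Proof. by move=> hf; apply: sdiv_in => // i; apply: hf. Qed.
Let next_in f : ser_over S f -> ser_over S (next f).
Proof. by move=> hf i; apply: crN; apply: smul_in => //; apply: quo_in. Qed.

Let stepE f n : f n = smul g (quo f) n + low f n + c * next f n.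
Proof.
rewrite smulg /low /next /xshift smul_sdiv; last first.
  by apply/negP => /eqP h; have := be0; rewrite h nm0 => /eqP; rewrite eq_sym oner_eq0.
by case: ltnP => nq; [ring | rewrite subnK //; ring].
Qed.

(** After n iterations of [stepE] the error is c^n times an integral series; quotient and remainder
    are the resulting sums in powers of c. *)
Lemma weierstrass_division f : ser_over S f -> exists h r : nat -> F,
  [/\ ser_over S h, ser_over S r, forall i, (q <= i)%N -> r i = 0 & forall i, f i = smul g h i +
    r i].
Proof.
move=> hf; pose Fk k := iter k next f.
have hF k : ser_over S (Fk k) by elim: k => //= k IH; apply: next_in.
pose hk k i := c ^+ k * quo (Fk k) i; pose rk k i := c ^+ k * low (Fk k) i.
have hkS k : ser_over S (hk k) by move=> i; rewrite crM ?crX //; apply: quo_in.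
have rkS k : ser_over S (rk k).
  by move=> i; rewrite crM ?crX // /low; case: ifP => // _; [apply: hF | apply: cr0].
have hkn i : null (fun k => hk k i).
  have := null_pow c1; apply: null_nm_le => k; rewrite /hk; apply: nmMr_le => //.
  by apply: (cr_le1 (c := S)); apply: quo_in.
have rkn i : null (fun k => rk k i).
  have := null_pow c1; apply: null_nm_le => k; rewrite /rk; apply: nmMr_le => //.
  by apply: (cr_le1 (c := S)); rewrite /low; case: ifP => // _; [apply: hF | apply: cr0].
exists (fun i => tsum (fun k => hk k i)), (fun i => tsum (fun k => rk k i)); split.
- by move=> i; apply: cr_tsum => // k; apply: hkS.
- by move=> i; apply: cr_tsum => // k; apply: rkS.
- move=> i qi; rewrite -[RHS](@tsum0 _ _ F); apply: eq_tsum => k.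
  by rewrite /rk /low ltnNge qi mulr0.
move=> i.
have part n : f i = smul g (fun j => \sum_(k < n) hk k j) i + \sum_(k < n) rk k i + c ^+ n * Fk n i.
  elim: n => [|n ->].
    rewrite big_ord0 mul1r addr0 /smul big1 ?add0r // => j _.
    by rewrite big_ord0 mulr0.
  have -> : (fun j => \sum_(k < n.+1) hk k j) = (fun j => \sum_(k < n) hk k j + hk n j).
    by apply: funext => j; rewrite big_ord_recr.
  rewrite smulDr /hk smulZr big_ord_recr (stepE (Fk n) i) /rk exprSr -[Fk n.+1]/(next (Fk n)) /=.
  by ring.
apply: (cvg_uniq (cvg_cst _)).
have h1 : cvg (fun n => smul g (fun j => \sum_(k < n) hk k j) i)
              (smul g (fun j => tsum (fun k => hk k j)) i).
  by apply: cvg_sum => j; apply: cvgMl; apply: tsumP.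
have h2 : null (fun n => c ^+ n * Fk n i).
  have := null_pow c1; apply: null_nm_le => k; apply: nmMr_le => //.
  by apply: (cr_le1 (c := S)); apply: hF.
have := cvgD (cvgD h1 (tsumP (rkn i))) h2; rewrite addr0.
by apply: (cvg_eventually (N := 0)) => n _; rewrite -part.
Qed.

(** In degrees at least q the relation reads be h = -c al h. Since be is invertible, every bound on
    h improves by a factor |c|, and h = 0. *)
Lemma weierstrass_unique h r : sbnd h -> (forall i, (q <= i)%N -> r i = 0) ->
  (forall i, smul g h i + r i = 0) -> (forall i, h i = 0) /\ (forall i, r i = 0).
Proof.
move=> hh hr e.
have hk k : forall i, nm (h i) <= nm c ^+ k.
  elim: k => [|k IH]; first by move=> i; rewrite expr0 sbndE.
  apply: (smul_unit_le be0 (sin_OC be_in)); first by rewrite exprn_ge0 ?nm_ge0.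
  move=> i; have := e (i + q)%N; rewrite hr ?leq_addl // addr0 smulg /xshift.
  rewrite ltnNge leq_addl /= addnK addrC => /eqP; rewrite addr_eq0 => /eqP ->.
  rewrite nmN nmM exprS ler_wpM2l ?nm_ge0 //.
  apply: nm_sum => [|j _]; first by rewrite exprn_ge0 ?nm_ge0.
  by apply: nmM_le => //; apply: (cr_le1 (c := S)); apply: al_in.
have h0 i : h i = 0.
  apply: small_eq0 => eps eps0; have [N hN] := expr_small (nm_ge0 c) c1 eps0.
  by apply: le_lt_trans (hk N i) (hN _ (leqnn _)).
split=> // i; have := e i; rewrite /smul big1 ?add0r // => j _; by rewrite h0 mulr0.
Qed.

End Weierstrass.

End Series.

#[global] Opaque mpsM.

(** * The base field *)

Section Adherence.
Variables (R : realType) (p : nat) (F : Cp_field R p).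
Notation cvg s l := (cvg_seq (@Cp_norm _ _ F) s l).
Notation adh := (adherence (@Cp_norm _ _ F)).
Implicit Types (A : {pred F}) (x y : F).

Lemma adhP A x : reflect (forall e : R, 0 < e -> exists2 y, y \in A & nm (x - y) < e)
  (x \in adh A).
Proof. by rewrite inE; apply: (iffP idP) => /asboolP. Qed.

Lemma sub_adh A : {subset A <= adh A}.
Proof. by move=> x xA; apply/adhP => e e0; exists x => //; rewrite subrr nm0. Qed.

Lemma adh_cvg A s l : (forall n, s n \in adh A) -> cvg s l -> l \in adh A.
Proof.
move=> hs hl; apply/adhP => e e0; have [N hN] := hl e e0.
have [y yA hy] := elimT (adhP _ _) (hs N) e e0; exists y => //.
by rewrite -(subrK (s N) l) -addrA; apply: nmD_lt => //; rewrite nmBC hN.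
Qed.

Lemma adh_seq A x : x \in adh A -> exists2 s, (forall n, s n \in A) & cvg s x.
Proof.
move=> /adhP h; have hk k : exists y, y \in A /\ nm (x - y) < nm (p%:R : F) ^+ k.
  by have [y yA hy] := h _ (exprn_gt0 k (nm_p_gt0 F)); exists y.
have [s hs] := choice hk; exists s => [n|e e0]; first by case: (hs n).
have [N hN] := expr_small (nm_ge0 (p%:R : F)) (nm_p_lt1 F) e0.
exists N => n /hN; apply: lt_trans; rewrite nmBC; by case: (hs n).
Qed.

Lemma adh_seqP A s x : (forall n, s n \in A) -> cvg s x -> x \in adh A.
Proof. by move=> h; apply: adh_cvg => n; apply: sub_adh. Qed.

Lemma adh_divring A : divring_closed A -> divring_closed (adh A).
Proof.
move=> [A1 AB AV]; have A0 : 0 \in A by rewrite -(subrr 1) AB.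
split; first exact: sub_adh.
  move=> x y /adh_seq[s hs sx] /adh_seq[t ht ty].
  by apply: adh_seqP (cvgB sx ty) => n; apply: AB.
move=> x y /adh_seq[s hs sx] hy.
have [->|y0] := eqVneq y 0; first by rewrite invr0 mulr0; apply: sub_adh.
have hV : y^-1 \in adh A.
  apply/adhP => e e0; have ny := nm_gt0 y0.
  (* The first bound forces |z| = |y|, and then |y^-1 - z^-1| = |z - y| / |y|^2, which the second
     bound makes less than e. *)
  have m0 : 0 < Num.min (nm y) (e * (nm y * nm y)) by rewrite lt_min ny !mulr_gt0.
  have [z zA] := elimT (adhP _ _) hy _ m0; rewrite lt_min => /andP[h1 h2].
  have nz : nm z = nm y.
    have -> : z = y + (z - y) by ring.
    by rewrite nmD_eq // nmBC.
  have z0 : z != 0 by apply/negP => /eqP z0; move: nz ny; rewrite z0 nm0 => <-; rewrite ltxx.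
  exists z^-1; first by rewrite -[z^-1]mul1r AV.
  have -> : y^-1 - z^-1 = (z - y) / (y * z) by field; rewrite y0 z0.
  by rewrite nmM nmV nmM nz ltr_pdivrMr ?mulr_gt0 // nmBC.
have [t ht ty] := adh_seq hV.
apply: adh_seqP (cvgM sx ty) => n.
have [->|tn0] := eqVneq (t n) 0; first by rewrite mulr0.
by rewrite -[t n]invrK AV // -[_^-1]mul1r AV.
Qed.

End Adherence.

(** * The closure of the rational numbers and its finite extensions *)

Section Qp.
Variables (R : realType) (p : nat) (F : Cp_field R p).
Notation cvg s l := (cvg_seq (@Cp_norm _ _ F) s l).
Notation nQp := (Qp (@Cp_norm _ _ F)).
Implicit Types (x y : F).

(** By Bezout 1 is a combination of m and p with integer coefficients; if |m| < 1 its norm would be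
    less than 1. *)
Lemma nm_coprime m : coprime p m -> (0 < m)%N -> nm (m%:R : F) = 1.
Proof.
move=> cp m0; apply/eqP; rewrite eq_le nm_natr /= leNgt; apply/negP => h.
have [[u v] /= e] := elimT (coprimeP p m0) ltac:(by rewrite coprime_sym).
have : nm ((u * m)%:R - (v * p)%:R : F) < 1.
  apply: nmB_lt; rewrite natrM nmM.
    by apply: le_lt_trans h; rewrite ler_piMl ?nm_ge0 ?nm_natr.
  by apply: le_lt_trans (nm_p_lt1 F); rewrite ler_piMl ?nm_ge0 ?nm_natr.
by rewrite -natrB ?e ?nm1 ?ltxx //; lia.
Qed.

Lemma nm_nat_pow m : (0 < m)%N -> exists k, nm (m%:R : F) = nm (p%:R : F) ^+ k.
Proof.
move=> m0; have [m' cm e] := pfactor_coprime (Cp_prime F) m0.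
exists (logn p m); rewrite {1}e natrM nmM natrX nmX nm_coprime ?mul1r //.
by move: m0; rewrite e muln_gt0 => /andP[].
Qed.

Lemma nm_rat (q : rat) : ratr q != 0 :> F ->
  exists a b, nm (ratr q : F) = nm (p%:R : F) ^+ a / nm (p%:R : F) ^+ b.
Proof.
rewrite /ratr => q0.
have key (z : int) : (z%:~R : F) != 0 -> exists a, nm (z%:~R : F) = nm (p%:R : F) ^+ a.
  case: z => n z0.
    by apply: nm_nat_pow; rewrite lt0n; apply: contra z0 => /eqP ->.
  by rewrite NegzE mulrNz nmN; apply: nm_nat_pow.
have [|a ha] := key (numq q); first by apply: contraNneq q0 => ->; rewrite mul0r.
have [|b hb] := key (denq q); first by apply: contraNneq q0 => ->; rewrite invr0 mulr0.
by exists a, b; rewrite nmM nmV ha hb.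
Qed.

(** [C] is a bare field whose characteristic 0 is deduced from the norm, so closure is checked on
    fractions of integers. *)
Lemma rat_divring : divring_closed [pred x : F | `[< exists q : rat, x = ratr q >]].
Proof.
have inj n : (n.+1%:R : F) != 0.
  apply/negP => /eqP h; have [k] := nm_nat_pow (ltn0Sn n); rewrite h nm0 => /esym/eqP.
  by rewrite expf_eq0 gt_eqF ?nm_p_gt0 ?andbF.
have inj' (z : int) : z != 0 -> (z%:~R : F) != 0.
  by case: z => [[//|n]|n] _; rewrite ?NegzE ?mulrNz ?oppr_eq0; apply: inj.
have dq (q : rat) : ((denq q)%:~R : F) != 0 by apply: inj'; rewrite denq_neq0.
have ratE (a b : int) : b != 0 -> ratr (a%:~R / b%:~R) = a%:~R / b%:~R :> F.
  move=> b0; set q : rat := a%:~R / b%:~R.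
  have e : numq q * b = a * denq q.
    apply: (@intr_inj rat); rewrite !rmorphM /=.
    apply/eqP; rewrite -eqr_div ?intr_eq0 ?denq_neq0 //; apply/eqP; exact: divq_num_den.
  by apply/eqP; rewrite /ratr eqr_div ?inj' ?dq // -!intrM e.
have ratP x : reflect (exists a b : int, b != 0 /\ x = a%:~R / b%:~R)
    (x \in [pred x : F | `[< exists q : rat, x = ratr q >]]).
  rewrite inE; apply: (iffP idP) => [/asboolP[q ->]|[a [b [b0 ->]]]].
    by exists (numq q), (denq q); rewrite denq_neq0.
  by apply/asboolP; exists (a%:~R / b%:~R); rewrite ratE.
split.
- by apply/ratP; exists 1, 1; rewrite divr1.
- move=> x y /ratP[a [b [b0 ->]]] /ratP[c [d [d0 ->]]]; apply/ratP.
  exists (a * d - c * b), (b * d); rewrite mulf_neq0 //; split=> //.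
  by rewrite rmorphB !rmorphM /=; field; rewrite !inj'.
- move=> x y /ratP[a [b [b0 ->]]] /ratP[c [d [d0 ->]]]; apply/ratP.
  have [->|c0] := eqVneq c 0; first by exists 0, 1; rewrite mulr0z mul0r invr0 mulr0 mul0r.
  exists (a * d), (b * c); rewrite mulf_neq0 //; split=> //.
  by rewrite !rmorphM /=; field; rewrite !inj'.
Qed.

Lemma Qp_divring : divring_closed nQp.
Proof. exact: adh_divring rat_divring. Qed.

Lemma Qp_cvg s l : (forall n, s n \in nQp) -> cvg s l -> l \in nQp.
Proof. exact: adh_cvg. Qed.

Lemma Qp_rat q : ratr q \in nQp.
Proof. by apply: (@sub_adh _ _ _ [pred x : F | `[< exists q : rat, x = ratr q >]]);
  apply/asboolP; exists q. Qed.

(** A close enough rational has the same norm as x, and norms of nonzero rationals are integral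
    powers of |p|. *)
Lemma nm_Qp_lt1 x : x \in nQp -> nm x < 1 -> nm x <= nm (p%:R : F).
Proof.
move=> xQ x1; have [->|x0] := eqVneq x 0; first by rewrite nm0 nm_ge0.
have /adhP/(_ _ (nm_gt0 x0))[y yQ hy] := xQ.
have nxy : nm y = nm x.
  have -> : y = x + (y - x) by ring.
  by rewrite nmD_eq // nmBC.
move: yQ => /asboolP[q yq].
have y0 : y != 0.
  by apply/negP => /eqP yz; move: nxy (nm_gt0 x0); rewrite yz nm0 => <-; rewrite ltxx.
have [a [b e]] : exists a b, nm y = nm (p%:R : F) ^+ a / nm (p%:R : F) ^+ b.
  by rewrite yq; apply: nm_rat; rewrite -yq.
rewrite -nxy e in x1 *; have P0 := nm_p_gt0 F; have P1 := nm_p_lt1 F.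
case: (ltnP b a) => ab.
  rewrite -(subnK ab) addnS -addSn exprD mulfK ?expf_neq0 ?gt_eqF //.
  by rewrite exprS ler_piMr ?exprn_ile1 ?ltW.
move: x1; rewrite ltr_pdivrMr ?exprn_gt0 // mul1r ltNge.
by rewrite ler_wiXn2l // ltW.
Qed.

(** The span of s over Q_p, in a recursive form suited to adding one generator at a time. *)
Fixpoint Qspan (s : seq F) : F -> Prop :=
  if s is a :: s' then fun x => exists2 c, c \in nQp & Qspan s' (x - c * a)
  else fun x => x = 0.

Lemma Qspan_lin s c x y : c \in nQp -> Qspan s x -> Qspan s y -> Qspan s (x - c * y).
Proof.
have [Q1 QB QV] := Qp_divring.
elim: s x y => [|a s IH] x y hc /=; first by move=> -> ->; rewrite mulr0 subr0.
move=> [b hb hx] [d hd hy]; exists (b - c * d).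
  by rewrite QB // -[d]invrK QV // -[d^-1]mul1r QV.
have -> : x - c * y - (b - c * d) * a = (x - b * a) - c * (y - d * a) by ring.
exact: IH.
Qed.

(** Induction on the generators. Either a already lies in the span of the others, or, that span
    being closed, a is at a distance d > 0 from it. In the latter case |c_m - c_n| d <= |u_m - u_n|,
    so the coefficients of a form a Cauchy sequence. *)
Lemma Qspan_closed s u l : (forall n, Qspan s (u n)) -> cvg u l -> Qspan s l.
Proof.
have [Q1 QB QV] := Qp_divring.
have Q0 : 0 \in nQp by rewrite -(subrr 1) QB.
elim: s u l => [|a s IH] u l /= hu ul.
  by apply: (cvg_uniq ul); apply: (cvg_eventually (N := 0) _ (cvg_cst 0)) => n _; rewrite hu.
have s0 : Qspan s 0 by elim: (s) => //= b t IHt; exists 0; rewrite ?mul0r ?subr0.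
have [sa|nsa] := EM (Qspan s a).
  exists 0 => //; rewrite mul0r subr0; apply: IH ul => n.
  have [c hc h] := hu n; have -> : u n = u n - c * a - (- c) * a by ring.
  by apply: Qspan_lin => //; rewrite -sub0r QB.
have [d d0 hd] : exists2 d : R, 0 < d & forall y, Qspan s y -> d <= nm (a - y).
  apply: contrapT => hn; apply: nsa.
  have hk k : exists y, Qspan s y /\ nm (a - y) < nm (p%:R : F) ^+ k.
    apply: contrapT => hy; apply: hn; exists (nm (p%:R : F) ^+ k).
      by rewrite exprn_gt0 // nm_p_gt0.
    by move=> y sy; rewrite leNgt; apply/negP => h; apply: hy; exists y.
  have [y hy] := choice hk; apply: (IH y); first by move=> n; case: (hy n).
  move=> e e0; have [N hN] := expr_small (nm_ge0 (p%:R : F)) (nm_p_lt1 F) e0.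
  by exists N => n /hN; apply: lt_trans; rewrite nmBC; case: (hy n).
have hc n : exists c, c \in nQp /\ Qspan s (u n - c * a) by have [c ? ?] := hu n; exists c.
have [c hcu] := choice hc.
have key m n : nm (c m - c n) * d <= nm (u m - u n).
  have [->|cmn] := eqVneq (c m - c n) 0; first by rewrite nm0 mul0r nm_ge0.
  have -> : u m - u n = (c m - c n) *
     (a - (0 - (c m - c n)^-1 * ((u m - c m * a) - 1 * (u n - c n * a)))) by field.
  rewrite nmM ler_wpM2l ?nm_ge0 //; apply: hd; apply: Qspan_lin => //.
    by rewrite -[_^-1]mul1r QV // QB //; [case: (hcu m) | case: (hcu n)].
  by apply: Qspan_lin; [|case: (hcu m) | case: (hcu n)].
have [c0 hc0] : exists c0, cvg c c0.
  case: (Cp_axioms F) => _ compl _ _; apply: compl => e e0.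
  have [N hN] := ul (e * d) (mulr_gt0 e0 d0); exists N => m n Nm Nn.
  rewrite -(ltr_pM2r d0); apply: le_lt_trans (key m n) _.
  have -> : u m - u n = (u m - l) - (u n - l) by ring.
  by apply: nmB_lt; apply: hN.
exists c0; first by apply: Qp_cvg hc0 => n; case: (hcu n).
apply: (IH (fun n => u n - a * c n)) => [n|]; first by rewrite mulrC; case: (hcu n).
by rewrite [c0 * a]mulrC; apply: cvgB => //; apply: cvgMl.
Qed.

Lemma QspanP s x : Qspan s x <-> exists2 c : nat -> F, (forall i, c i \in nQp) &
  x = \sum_(i < size s) c i * s`_i.
Proof.
have [Q1 QB QV] := Qp_divring.
have Q0 : 0 \in nQp by rewrite -(subrr 1) QB.
elim: s x => [|a s IH] x /=.
  split=> [->|[c _]]; last by rewrite big_ord0.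
  by exists (fun=> 0) => //; rewrite big_ord0.
split=> [[c hc /IH[d hd e]]|[c hc ->]].
  exists (fun i => if i is i'.+1 then d i' else c); first by case.
  by rewrite big_ord_recl /= -e addrC subrK.
exists (c 0%N) => //; apply/IH; exists (fun i => c i.+1) => //.
by rewrite big_ord_recl /= addrAC subrr add0r.
Qed.

End Qp.

(** * Rings of integers of closed subfields, in particular O_K *)

Section IntegerRing.
Variables (R : realType) (p : nat) (F : Cp_field R p) (A : {pred F}).
Notation cvg s l := (cvg_seq (@Cp_norm _ _ F) s l).
Notation OA := (integers (@Cp_norm _ _ F) A).
Hypothesis A_div : divring_closed A.
Hypothesis A_cvg : forall s l, (forall n, s n \in A) -> cvg s l -> l \in A.

Lemma int_subring : subring_closed OA.
Proof.
have [A1 AB AV] := A_div.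
split=> [|x y|x y]; rewrite !inE /=.
- by rewrite nm1 A1 lexx.
- by move=> /andP[h1 h2] /andP[h3 h4]; rewrite AB // nmB.
move=> /andP[h1 h2] /andP[h3 h4]; rewrite nmM_le1 // andbT.
by rewrite -[y]invrK AV // -[y^-1]mul1r AV.
Qed.

Lemma int_le1 x : x \in OA -> nm x <= 1. Proof. by rewrite inE => /andP[]. Qed.

Lemma int_cvg s l : (forall n, s n \in OA) -> cvg s l -> l \in OA.
Proof.
move=> hs sl; rewrite inE /=; apply/andP; split.
  by apply: A_cvg sl => n; have := hs n; rewrite inE => /andP[].
by apply: (cvg_le (N := 0) sl) => n _; apply: int_le1.
Qed.

Lemma int_inv x : x \in OA -> nm x = 1 -> x^-1 \in OA.
Proof.
have [A1 AB AV] := A_div.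
by rewrite !inE => /andP[h _] n1; rewrite nmV n1 invr1 lexx -[x^-1]mul1r AV.
Qed.

Definition int_ring := ClosedRing int_subring int_le1 int_cvg int_inv.

Lemma int_ringE x : (x \in cr int_ring) = (x \in A) && (nm x <= 1). Proof. by rewrite inE. Qed.

End IntegerRing.

Record unram_field (R : realType) (p : nat) (F : Cp_field R p) := UnramField {
  uK : {pred F};
  uK_finite : finite_over_Qp (@Cp_norm _ _ F) uK;
  uK_unram : unramified (@Cp_norm _ _ F) uK }.

Section UnramifiedField.
Variables (R : realType) (p : nat) (F : Cp_field R p) (k : unram_field F).
Notation cvg s l := (cvg_seq (@Cp_norm _ _ F) s l).

Lemma uK_divring : divring_closed (uK k). Proof. by case: (uK_finite k). Qed.

(** K is the span of finitely many elements over Q_p, hence closed by [Qspan_closed]. *)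
Lemma uK_cvg s l : (forall n, s n \in uK k) -> cvg s l -> l \in uK k.
Proof.
case: (uK_finite k) => [[K1 KB KV] QK [b [bK hb]]] hs sl.
have K0 : 0 \in uK k by rewrite -(subrr 1) KB.
have [c hc ->] : exists2 c : nat -> F, (forall i, c i \in Qp (@Cp_norm _ _ F)) &
    l = \sum_(i < size b) c i * b`_i.
  by apply/QspanP; apply: (Qspan_closed _ sl) => n; apply/QspanP; apply: hb.
have KD x y : x \in uK k -> y \in uK k -> x + y \in uK k.
  by move=> hx hy; rewrite -[y]opprK KB // -sub0r KB.
have KM x y : x \in uK k -> y \in uK k -> x * y \in uK k.
  by move=> hx hy; rewrite -[y]invrK KV // -[y^-1]mul1r KV.
apply: (big_ind (fun x => x \in uK k)) => // i _.
by apply: KM; [apply: QK | apply: bK; rewrite mem_nth].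
Qed.

Definition OKr := int_ring uK_divring uK_cvg.

Lemma OKrE x : (x \in cr OKr) = (x \in uK k) && (nm x <= 1). Proof. by rewrite inE. Qed.

(** This is where unramifiedness enters: p generates the maximal ideal of O_K. *)
Lemma OK_lt1 x : x \in cr OKr -> nm x < 1 -> nm x <= nm (p%:R : F).
Proof.
rewrite OKrE => /andP[xK _]; have [y yQ e] := uK_unram xK.
by rewrite e; apply: nm_Qp_lt1.
Qed.

Lemma OK_nmP x : x \in cr OKr -> nm x < 1 \/ nm x = 1.
Proof.
move=> /cr_le1; rewrite le_eqVlt => /orP[/eqP|]; [by right | by left].
Qed.

Lemma OK_divp x n : x \in cr OKr -> nm x <= nm (p%:R : F) ^+ n -> x / p%:R ^+ n \in cr OKr.
Proof.
have [K1 KB KV] := uK_divring.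
rewrite !OKrE => /andP[xK _] h; rewrite KV //=.
  by rewrite nmM nmV nmX ler_pdivrMr ?mul1r // exprn_gt0 // nm_p_gt0.
elim: n {h} => [|n IH]; first by rewrite expr0.
have pK : p%:R \in uK k by have := cr_nat OKr p; rewrite OKrE => /andP[].
by rewrite exprS -[_ ^+ n]invrK KV // -[_^-1]mul1r KV.
Qed.

End UnramifiedField.

(** * Roots of power series *)

Section Roots.
Variables (R : realType) (p : nat) (F : Cp_field R p).
Notation cvg s l := (cvg_seq (@Cp_norm _ _ F) s l).
Notation sbnd := (ser_over (@OCr R p F)).
Implicit Types (P Q : {poly F}) (x y a : F) (d e : R).

Definition polybnd P := forall i, nm P`_i <= 1.

Lemma horner_le P x e : 0 <= e -> nm x <= 1 -> (forall i, nm P`_i <= e) -> nm P.[x] <= e.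
Proof.
move=> e0 x1 hP; rewrite horner_coef; apply: nm_sum => // i _.
by apply: nmMr_le => //; apply: nmX_le1.
Qed.

Lemma horner_lipschitz P x y : polybnd P -> nm x <= 1 -> nm y <= 1 ->
  nm (P.[x] - P.[y]) <= nm (x - y).
Proof.
move=> hP x1 y1; rewrite !horner_coef -sumrB; apply: nm_sum => [|i _]; first exact: nm_ge0.
rewrite -mulrBr; apply: nmM_le => //; rewrite subrXX; apply: nmMr_le => //.
by apply: nm_sum => // j _; apply: nmM_le1; apply: nmX_le1.
Qed.

Lemma root_le1 P x : P \is monic -> polybnd P -> root P x -> nm x <= 1.
Proof.
move=> mP hP /rootP e; rewrite leNgt; apply/negP => x1.
have x0 : x != 0 by apply/negP => /eqP x0; move: x1; rewrite x0 nm0; lra.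
have : size P != 0%N by rewrite size_poly_eq0 monic_neq0.
case sP : (size P) => [//|n] _.
move: e; rewrite horner_coef sP big_ord_recr /= => /eqP.
have -> : P`_n = 1 by have := monicP mP; rewrite lead_coefE sP.
rewrite mul1r addr_eq0 => /eqP e.
have := congr1 nm e; rewrite nmN nmX; apply/eqP; rewrite lt_eqF //.
apply: nm_sum_lt => [|i _]; first by rewrite exprn_gt0 // nm_gt0.
rewrite nmM nmX; apply: (@le_lt_trans _ _ (nm x ^+ i)); last by rewrite ltr_eXn2l.
by rewrite ler_piMl ?exprn_ge0 ?nm_ge0.
Qed.

(** Synthetic division from the top: the coefficient of index i is that of index i+1 in the product
    plus x times the next coefficient of P. *)
Lemma deflate_bnd P x : nm x <= 1 -> polybnd (P * ('X - x%:P)) -> polybnd P.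
Proof.
move=> x1 h; suff key k i : (size P <= i + k)%N -> nm P`_i <= 1.
  by move=> i; apply: (key (size P)); rewrite leq_addl.
elim: k i => [|k IH] i; first by rewrite addn0 => hi; rewrite nth_default // nm0.
move=> hi; have := h i.+1; rewrite mulrBr coefB coefMX coefMC /= => h1.
have -> : P`_i = (P`_i - P`_i.+1 * x) + P`_i.+1 * x by ring.
by apply: nmD => //; apply: nmMr_le => //; apply: IH; rewrite addSn -addnS.
Qed.

Lemma Qpbar_rat q : ratr q \in Qpbar (@Cp_norm _ _ F).
Proof.
apply/asboolP; exists ('X - (ratr q)%:P); split; rewrite ?polyXsubC_eq0 ?root_XsubC //.
rewrite qualifE /=; apply/(all_nthP 0) => i _; rewrite coefB coefX coefC.
have [Q1 QB QV] := Qp_divring F.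
have Q0 : 0 \in Qp (@Cp_norm _ _ F) by rewrite -(subrr 1) QB.
by apply: QB; [case: (i == _) | case: ifP => // _; apply: Qp_rat].
Qed.

(* Only a root of an approximation of Q with coefficients in Qpbar is available; if it is
   far from a, it is divided out and the quotient is approximated again. *)
Lemma near_root n Q a d e : Q \is monic -> size Q = n.+1 -> polybnd Q -> nm a <= 1 ->
  0 < d -> d <= 1 -> 0 < e -> nm Q.[a] < d ^+ n ->
  exists2 r, nm (r - a) < d & nm Q.[r] <= e.
Proof.
elim: n Q => [|n IH] Q mQ sQ hQ a1 d0 d1 e0 Qa.
  have /eqP := monicP mQ; rewrite lead_coefE sQ /= => /eqP Q0.
  by move: Qa; rewrite horner_coef sQ big_ord1 Q0 expr0 mulr1 nm1 ltxx.
case: (Cp_axioms F) => _ _ roots dense.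
(* Of the three bounds on the perturbation, e keeps the value at the root found small, 1 keeps the
   coefficients integral, and d^(n+1) keeps the hypothesis at a. *)
pose mi := Num.min e (Num.min 1 (d ^+ n.+1)); pose ep := mi / 2.
have mi0 : 0 < mi by rewrite !lt_min e0 ltr01 exprn_gt0.
have ep0 : 0 < ep by rewrite /ep; lra.
have epmi : ep < mi by rewrite /ep; lra.
have hz i : exists z, z \in Qpbar (@Cp_norm _ _ F) /\ nm (Q`_i - z) < ep.
  by have /adhP/(_ _ ep0)[z ? ?] := dense Q`_i; exists z.
have [z hz'] := choice hz.
pose Q' := 'X^(n.+1) + \poly_(i < n.+1) z i.
have szp : (size (\poly_(i < n.+1) z i) < size ('X^(n.+1) : {poly F}))%N.
  by rewrite size_polyXn ltnS size_poly.
have sQ' : size Q' = n.+2 by rewrite size_polyDl // size_polyXn.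
have mQ' : Q' \is monic by rewrite monicE lead_coefDl // lead_coefXn.
have cQ' i : Q'`_i = if (i < n.+1)%N then z i else (i == n.+1)%:R.
  rewrite coefD coefXn coef_poly; case: ltnP => h; last by rewrite addr0.
  by rewrite ltn_eqF ?add0r.
have QQ' i : nm ((Q - Q')`_i) <= ep.
  rewrite coefB cQ'; case: ltnP => h; first by apply: ltW; case: (hz' i).
  case: (ltngtP i n.+1) => [|hi|->]; first by lia.
    by rewrite nth_default ?subr0 ?nm0 1?ltW // sQ.
  have := monicP mQ; rewrite lead_coefE sQ /= => ->.
  by rewrite subrr nm0 ltW.
have hQ' : polybnd Q'.
  move=> i; have -> : Q'`_i = Q`_i - (Q - Q')`_i by rewrite coefB; ring.
  apply: nmB => //; apply: (le_trans (QQ' i)); apply: (le_trans (ltW epmi)).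
  by rewrite /mi !ge_min lexx orbT.
have Q0 q : ratr q \in Qpbar (@Cp_norm _ _ F) by apply: Qpbar_rat.
have Q'over : Q' \is a polyOver (Qpbar (@Cp_norm _ _ F)).
  rewrite qualifE /=; apply/(all_nthP 0) => i _; rewrite cQ'; case: ifP => _;
    first by case: (hz' i).
  by have := Q0 (i == n.+1)%:R; rewrite ratr_nat.
have [r _ rr] := roots Q' Q'over ltac:(by rewrite sQ').
have r1 := root_le1 mQ' hQ' rr.
have close x : nm x <= 1 -> nm (Q.[x] - Q'.[x]) <= ep.
  by move=> x1; rewrite -hornerN -hornerD; apply: horner_le => //; apply: ltW.
have epe : ep <= e by apply: (le_trans (ltW epmi)); rewrite /mi !ge_min lexx.
case: (ltP (nm (r - a)) d) => hr.
  exists r => //; have := close r r1; rewrite (rootP rr) subr0.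
  by move=> h; apply: le_trans epe.
have [Q1 Q1E] := factor_theorem _ _ rr.
have hQ1 : polybnd Q1 by apply: (deflate_bnd r1); rewrite -Q1E.
have mQ1 : Q1 \is monic by move: mQ'; rewrite Q1E monicMr // monicXsubC.
have sQ1 : size Q1 = n.+1.
  have := sQ'; rewrite Q1E size_Mmonic ?monicXsubC ?monic_neq0 // size_XsubC.
  by rewrite addn2 => -[].
have Q'a : nm Q'.[a] < d ^+ n.+1.
  have -> : Q'.[a] = Q.[a] - (Q.[a] - Q'.[a]) by ring.
  apply: nmB_lt => //.
  apply: (le_lt_trans (close a a1)); apply: (lt_le_trans epmi).
  by rewrite /mi !ge_min lexx !orbT.
(* Here |a - r| is at least d, so d |Q1(a)| <= |Q'(a)| < d^(n+1). *)
have Q1a : nm Q1.[a] < d ^+ n.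
  move: Q'a; rewrite Q1E hornerM hornerXsubC nmM [nm (a - r)]nmBC exprS => h.
  rewrite -(ltr_pM2l d0); apply: le_lt_trans h.
  by rewrite mulrC ler_wpM2l ?nm_ge0.
have [r2 hr2 Q1r2] := IH Q1 mQ1 sQ1 hQ1 a1 d0 d1 e0 Q1a.
exists r2 => //.
have r21 : nm r2 <= 1.
  by rewrite -(subrK a r2); apply: nmD => //; apply: ltW; apply: lt_le_trans d1.
have -> : Q.[r2] = Q'.[r2] + (Q.[r2] - Q'.[r2]) by ring.
apply: nmD; last exact: le_trans (close _ r21) epe.
by rewrite Q1E hornerM hornerXsubC; apply: nmMr_le => //; apply: nmB.
Qed.

(** [near_root] is iterated with radius 2^-k, each time making the value at the new point small
    enough for radius 2^-(k+1); the hypothesis on Q(0) starts the iteration at k = 0. The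
    approximate roots converge geometrically. *)
Lemma poly_root n Q : Q \is monic -> size Q = n.+2 -> polybnd Q -> nm Q.[0] < 1 ->
  exists2 y, nm y < 1 & Q.[y] = 0.
Proof.
move=> mQ sQ hQ Q0.
have half : 0 < (2^-1 : R) by lra.
have step k y : exists z, nm y <= 1 -> nm Q.[y] < ((2^-1 : R) ^+ k) ^+ n.+1 ->
   [/\ nm (z - y) < 2^-1 ^+ k, nm z <= 1 & nm Q.[z] < ((2^-1 : R) ^+ k.+1) ^+ n.+1].
  have [y1|] := EM (nm y <= 1); last by exists y.
  have [hy|] := EM (nm Q.[y] < ((2^-1 : R) ^+ k) ^+ n.+1); last by exists y.
  set B := (_ ^+ k.+1) ^+ _; have B0 : 0 < B by rewrite !exprn_gt0.
  have d1 : (2^-1 : R) ^+ k <= 1 by rewrite exprn_ile1 //; lra.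
  have B2 : 0 < B / 2 by lra.
  have [r hr Qr] := near_root mQ sQ hQ y1 (exprn_gt0 k half) d1 B2 hy.
  exists r => _ _; split=> //; last by apply: (le_lt_trans Qr); lra.
  by rewrite -(subrK y r); apply: nmD => //; apply: ltW; apply: lt_le_trans d1.
have step' (ky : nat * F) := step ky.1 ky.2.
have [nxt hnxt] := choice step'.
pose Y := fix Y k := if k is k'.+1 then nxt (k', Y k') else 0.
have hY k : nm (Y k) <= 1 /\ nm Q.[Y k] < ((2^-1 : R) ^+ k) ^+ n.+1.
  elim: k => [|k [IH1 IH2]] /=; first by rewrite nm0 expr0 expr1n.
  by have [] := hnxt (k, Y k) IH1 IH2.
have dY k : nm (Y k.+1 - Y k) < 2^-1 ^+ k.
  by have [h1 h2] := hY k; have [] := hnxt (k, Y k) h1 h2.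
have hn : null (fun k => Y k.+1 - Y k).
  by apply: (@null_geom _ _ _ _ (2^-1)) => [||k]; try lra; apply: ltW.
pose y := tsum (fun k => Y k.+1 - Y k).
have cY : cvg Y y.
  have := tsumP hn; apply: (cvg_eventually (N := 0)) => k _.
  by rewrite -(big_mkord predT (fun i => Y i.+1 - Y i)) telescope_sumr // subr0.
have y1 : nm y <= 1 by apply: (cvg_le (N := 0) cY) => k _; case: (hY k).
exists y.
  (* The first increment only has norm < 1; the later ones have norm at most 1/2. Bounding the whole
     sum at once would not give a strict inequality. *)
  have -> : y = (y - \sum_(i < 1) (Y i.+1 - Y i)) + (Y 1%N - Y 0%N) by rewrite big_ord1 subrK.
  apply: nmD_lt; last by have := dY 0%N; rewrite expr0.
  apply: (@le_lt_trans _ _ (2^-1)); last by lra.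
  apply: tsum_tail => // [|i i1]; first by lra.
  apply: ltW; apply: lt_le_trans (dY i) _.
  by rewrite -[X in _ <= X]expr1 ler_wiXn2l //; lra.
apply: (@cvg_uniq _ _ _ (fun k => Q.[Y k])).
  move=> e e0; have [N hN] := cY e e0; exists N => k /hN; apply: le_lt_trans.
  by apply: horner_lipschitz => //; case: (hY k).
apply: (@null_geom _ _ F (fun k => Q.[Y k]) (2^-1)); [by lra | by lra | move=> k; apply: ltW].
have [_ h] := hY k; apply: lt_le_trans h _; rewrite -exprM.
by apply: ler_wiXn2l; [lra | lra | rewrite leq_pmulr].
Qed.

(** Dividing X^q by g gives X^q - r = g h with r of degree < q and h invertible. The left side is a
    monic polynomial with constant term of norm < 1, and its root given by [poly_root] is a zero of
    g. *)
Lemma ser_root g q : (0 < q)%N -> sbnd g -> (forall i, (i < q)%N -> nm (g i) < 1) ->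
  nm (g q) = 1 -> exists2 y, nm y < 1 & ev g y = 0.
Proof.
move=> q0 hg glow gq.
have [c c1 hc] : exists2 c : F, nm c < 1 & forall i, (i < q)%N -> nm (g i) <= nm c.
  move: glow; elim: (q) => [|n IH] h; first by exists 0; rewrite ?nm0.
  have [c c1 hc] := IH (fun i hi => h i (ltnW hi)).
  case: (leP (nm (g n)) (nm c)) => gn; [exists c => // i | exists (g n) => [|i]].
  - by rewrite ltnS leq_eqVlt => /orP[/eqP ->|/hc].
  - exact: h.
  - by rewrite ltnS leq_eqVlt => /orP[/eqP ->|/hc h1] //; apply: le_trans h1 (ltW gn).
have c_in : c \in cr (@OCr R p F) by rewrite OCrE ltW.
have glow' i : (i < q)%N -> exists2 x, x \in cr (@OCr R p F) & g i = c * x.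
  move=> hi; have [c0|c0] := eqVneq c 0.
    exists 0; first exact: cr0.
    rewrite mulr0; apply: nm_eq0; apply/eqP; rewrite eq_le nm_ge0 andbT.
    by have := hc i hi; rewrite c0 nm0.
  exists (g i / c); last by rewrite mulrC divfK.
  by rewrite OCrE nmM nmV ler_pdivrMr ?mul1r ?nm_gt0 // hc.
pose f i : F := (i == q)%:R.
have hf : sbnd f by move=> i; apply: bool_in.
have [h [r [hh hr r0 e]]] := weierstrass_division hg gq c_in c1 glow' hf.
pose P := 'X^q - \poly_(i < q) r i.
have szp : (size (- \poly_(i < q) r i) < size ('X^q : {poly F}))%N.
  by rewrite size_polyN size_polyXn ltnS size_poly.
have sP : size P = q.+1 by rewrite size_polyDl // size_polyXn.
have mP : P \is monic by rewrite monicE lead_coefDl // lead_coefXn.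
have hP : polybnd P.
  move=> i; rewrite coefB coefXn coef_poly; apply: nmB; first by have := hf i; rewrite OCrE.
  by case: ifP => _; rewrite ?nm0 // -OCrE.
have P0 : nm P.[0] < 1.
  rewrite horner_coef0 coefB coefXn coef_poly q0 ltn_eqF // sub0r nmN.
  have -> : r 0%N = - (g 0%N * h 0%N).
    by have := e 0%N; rewrite /f /smul big_ord1 ltn_eqF // addrC => /esym/eqP;
      rewrite addr_eq0 => /eqP.
  by rewrite nmN nmM; apply: le_lt_trans (glow _ q0); rewrite ler_piMr ?nm_ge0 // -OCrE.
have [y y1 Py] : exists2 y, nm y < 1 & P.[y] = 0.
  by apply: (@poly_root q.-1) => //; rewrite prednK.
exists y => //.
have h0 : nm (h 0%N) = 1.
  have := e q; rewrite r0 // addr0 /f eqxx /smul big_ord_recr /= subnn addrC => e1.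
  have : nm (g q * h 0%N) = 1.
    rewrite -[g q * _](addrK (\sum_(i < q) g i * h (q - i)%N)) -e1.
    rewrite nmD_eq ?nm1 // nmN; apply: nm_sum_lt => // i _; rewrite nmM.
    by apply: le_lt_trans (glow _ (ltn_ord i)); rewrite ler_piMr ?nm_ge0 // -OCrE.
  by rewrite nmM gq mul1r.
have hy0 : ev h y != 0.
  rewrite ev_recl //; apply/negP => /eqP /(congr1 nm); rewrite nmD_eq ?h0 ?nm0; first by lra.
  by rewrite nmM; apply: (le_lt_trans _ y1); rewrite ler_piMr ?nm_ge0 // ev_le1 // => i; apply: hh.
have : ev g y * ev h y = 0.
  rewrite -ev_smul //; have -> : smul g h = fun i => f i - r i.
    by apply: funext => i; rewrite e addrK.
  rewrite evB // (ev_poly _ r0) /ev (@tsum1 _ _ _ q) => [|i iq]; last first.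
    by rewrite /f (negbTE iq) mul0r.
  move: Py; rewrite /f eqxx mul1r hornerD hornerXn hornerN horner_poly.
  by [].
by move/eqP; rewrite mulf_eq0 (negbTE hy0) orbF => /eqP.
Qed.

End Roots.

(** * Formal groups on the open unit disc *)

Section WeierstrassDegree.
Variables (R : realType) (p : nat) (F : Cp_field R p) (k : unram_field F).
Notation sOK := (ser_over (OKr k)).
Notation sbnd := (ser_over (@OCr R p F)).
Notation np := (nm (p%:R : F)).
Implicit Types (a b c : nat -> F) (x y : F).

(** q is the Weierstrass degree of a, i.e. the order of its reduction at X = 0. *)
Definition wdeg a q := [/\ sOK a, forall i, (i < q)%N -> nm (a i) < 1 & nm (a q) = 1].

Lemma wdeg_dichotomy a : sOK a -> (forall i, nm (a i) <= np) \/ exists q, wdeg a q.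
Proof.
move=> ha; have [[q hq]|h] := EM (exists q, nm (a q) == 1).
  right; have := ex_minnP (ex_intro (fun q => nm (a q) == 1) q hq) => -[m /eqP hm mmin].
  exists m; split=> // i im; case: (OK_nmP (ha i)) => // e.
  by have := mmin i; rewrite e eqxx => /(_ isT); rewrite leqNgt im.
left=> i; apply: OK_lt1; first exact: ha.
by case: (OK_nmP (ha i)) => // e; case: h; exists i; rewrite e.
Qed.

Lemma ev_low_bound a q x : sOK a -> nm x < 1 -> (forall i, (i < q)%N -> nm (a i) < 1) ->
  nm (ev a x - x ^+ q * ev (fun i => a (i + q)%N) x) <= np.
Proof.
move=> ha x1 hq; rewrite (ev_split q x1 (sin_OC ha)) addrK.
apply: nm_sum => [|i _]; first exact: nm_ge0.
apply: nmMr_le; last by apply: nmX_le1; apply: ltW.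
by apply: OK_lt1 => //; apply: hq.
Qed.

Lemma unit_ev a x : sbnd a -> nm x < 1 -> nm (a 0%N) = 1 -> nm (ev a x) = 1.
Proof.
move=> ha x1 a0; rewrite ev_recl // nmD_eq a0 //.
rewrite nmM; apply: (le_lt_trans _ x1); rewrite ler_piMr ?nm_ge0 // ev_le1 // => i; exact: ha.
Qed.

(** The terms below q are divisible by p, and the remaining ones sum to x^q times a unit, which
    dominates as soon as |x|^q > |p|. *)
Lemma wdeg_ev a q x : wdeg a q -> nm x < 1 -> np < nm x ^+ q -> nm (ev a x) = nm x ^+ q.
Proof.
move=> [ha hq aq] x1 px.
have e : nm (x ^+ q * ev (fun i => a (i + q)%N) x) = nm x ^+ q.
  by rewrite nmM nmX unit_ev ?mulr1 // => i; apply: (sin_OC ha).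
rewrite -[ev a x](subrK (x ^+ q * ev (fun i => a (i + q)%N) x)) addrC nmD_eq e //.
exact: le_lt_trans (ev_low_bound ha x1 hq) px.
Qed.

(* The value group of K is discrete, so one point close to the unit circle detects the degree. *)
Lemma wdeg_conv a q x : sOK a -> x != 0 -> nm x < 1 -> np < nm x ^+ q ->
  nm (ev a x) = nm x ^+ q -> wdeg a q.
Proof.
move=> ha x0 x1 px e; have xp := nm_gt0 x0.
have [h|[q' hq']] := wdeg_dichotomy ha.
  have : nm (ev a x) <= np by apply: ev_bound; rewrite ?nm_ge0 //; apply: sin_OC ha.
  by rewrite e leNgt px.
have [ha' low unit] := hq'.
case: (leqP q' q) => qq'.
  have px' : np < nm x ^+ q' by apply: (lt_le_trans px); rewrite ler_wiXn2l ?ltW.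
  have := wdeg_ev hq' x1 px'; rewrite e => e2.
  suff -> : q = q' by [].
  apply/eqP; rewrite eqn_leq qq' andbT leqNgt; apply/negP => lt.
  have : nm x ^+ q < nm x ^+ q' by rewrite ltr_iXn2l.
  by rewrite e2 ltxx.
have : nm (ev a x) < nm x ^+ q.
  rewrite -[ev a x](subrK (x ^+ q' * ev (fun i => a (i + q')%N) x)); apply: nmD_lt.
    exact: le_lt_trans (ev_low_bound ha x1 low) px.
  rewrite nmM nmX; apply: (@le_lt_trans _ _ (nm x ^+ q')); last by rewrite ltr_iXn2l.
  by rewrite ler_piMr ?exprn_ge0 ?nm_ge0 // ev_le1 // => i; apply: (sin_OC ha).
by rewrite e ltxx.
Qed.

(** x is a root of X^(q+1) = p. *)
Lemma near_one q : exists x : F, [/\ x != 0, nm x < 1 & np < nm x ^+ q].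
Proof.
pose P : {poly F} := 'X^(q.+1) - (p%:R)%:P.
have szp : (size (- (p%:R : F)%:P) < size ('X^(q.+1) : {poly F}))%N.
  by rewrite size_polyN size_polyXn ltnS (leq_trans (size_polyC_leq1 _)).
have [||||x x1 /eqP] := @poly_root _ _ F q P.
- by rewrite monicE lead_coefDl // lead_coefXn.
- by rewrite size_polyDl // size_polyXn.
- move=> i; rewrite coefB coefXn coefC; apply: nmB; first by case: (i == _); rewrite ?nm1 ?nm0.
  by case: ifP; rewrite ?nm0 // ltW // nm_p_lt1.
- by rewrite horner_coef0 coefB coefXn coefC eqxx ltn_eqF // sub0r nmN nm_p_lt1.
rewrite hornerD hornerXn hornerN hornerC subr_eq0 => /eqP e.
have x0 : x != 0.
  by apply/negP => /eqP x0; move: e; rewrite x0 expr0n => /esym/eqP; rewrite (negbTE (p_neq0 F)).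
exists x; split=> //; by rewrite -e nmX exprS gtr_pMl // exprn_gt0 // nm_gt0.
Qed.

Lemma wdeg_comp a b c q1 q2 : (0 < q2)%N -> wdeg a q1 -> wdeg b q2 -> sOK c ->
  (forall x, nm x < 1 -> ev c x = ev a (ev b x)) -> wdeg c (q1 * q2).
Proof.
(* The exponent q1 q2 + q2 is at least both q2 and q1 q2, so the same x serves for b, for a at b(x),
   and for the composite. *)
move=> q20 ha hb hc e; have [x [x0 x1 px]] := near_one (q1 * q2 + q2).
have xp := nm_gt0 x0.
have le n : (n <= q1 * q2 + q2)%N -> np < nm x ^+ n.
  by move=> hn; apply: (lt_le_trans px); rewrite ler_wiXn2l ?ltW.
have bx := wdeg_ev hb x1 (le q2 (leq_addl _ _)).
have bx1 : nm (ev b x) < 1 by rewrite bx exprn_ilt1 ?nm_ge0 // -lt0n.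
have pab : np < nm (ev b x) ^+ q1 by rewrite bx -exprM mulnC le // leq_addr.
apply: (wdeg_conv hc x0 x1); first by rewrite le // leq_addr.
by rewrite e // (wdeg_ev ha bx1 pab) bx -exprM mulnC.
Qed.

Lemma wdeg_X : wdeg (fun i => (i == 1%N)%:R) 1.
Proof.
split; first by move=> i; apply: bool_in.
  by case=> // _; rewrite nm0.
by rewrite eqxx nm1.
Qed.

Lemma ev_X x : ev (fun i => (i == 1%N)%:R) x = x.
Proof. by rewrite /ev (@tsum1 _ _ _ 1) => [|i /negbTE ->]; rewrite ?mul1r // mul0r. Qed.

(* a lies in the n-th power of the ideal (p, X) *)
Definition flt n a := forall i, nm (a i) <= np ^+ (n - i).

Lemma flt_smul m n a b : flt m a -> flt n b -> flt (m + n) (smul a b).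
Proof.
move=> ha hb j; apply: nm_sum => [|[i /= hi] _]; first by rewrite exprn_ge0 ?nm_ge0.
rewrite nmM; apply: (@le_trans _ _ (np ^+ (m - i) * np ^+ (n - (j - i)))).
  by rewrite ler_pM ?nm_ge0.
rewrite -exprD ler_wiXn2l ?nm_ge0 ?(ltW (nm_p_lt1 F)) //; lia.
Qed.

Lemma flt0 a : sbnd a -> flt 0 a.
Proof. by move=> h i; rewrite sub0n expr0 sbndE. Qed.

End WeierstrassDegree.

(** * The maps [n], the quotients [p^(n+1)] / [p^n], and the Tate module *)

Record fgroup (R : realType) (p : nat) (F : Cp_field R p) (k : unram_field F) := FGroup {
  fg :> mps F 2;
  fg_law : formal_group_law (cr (OKr k)) fg;
  fg_height : has_height p (@Cp_norm _ _ F) fg 2 }.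

Section FormalGroup.
Variables (R : realType) (p : nat) (F : Cp_field R p) (k : unram_field F) (G : fgroup k).
Notation sOK := (ser_over (OKr k)).
Notation sbnd := (ser_over (@OCr R p F)).
Notation bnd := (coefs_in (cr (@OCr R p F))).
Notation np := (nm (p%:R : F)).
Implicit Types (x y z : F).

Lemma fg_in : coefs_in (cr (OKr k)) G. Proof. by case: (fg_law G). Qed.
Lemma fg_bnd : bnd G. Proof. exact: in_OC fg_in. Qed.

Lemma var0 d i : (i < d)%N -> var F d i 0%MM = 0.
Proof.
move=> id; rewrite /var; case: eqP => // /(congr1 (fun m : 'X_{1..d} => m (Ordinal id))).
by rewrite mnm0E mnmE /= eqxx.
Qed.

Lemma var_bnd d i : bnd (var F d i). Proof. exact: var_in. Qed.
Lemma mps0_bnd d : bnd (mps0 F d). Proof. exact: mps0_in. Qed.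

Definition gadd x y := mev G [tuple x; y].

Lemma mev_var1 x : nm x < 1 -> mev (var F 1 0) [tuple x] = x.
Proof. by move=> x1; rewrite (mev_var (ord0 : 'I_1)) //; apply: disc1. Qed.

Lemma gadd_r0 x : nm x < 1 -> gadd x 0 = x.
Proof.
move=> x1; case: (fg_law G) => _ h _ _ _; rewrite -[RHS](mev_var1 x1).
have <- : mps_comp G [tuple var F 1 0; mps0 F 1] = var F 1 0 by apply: funext.
rewrite mev_comp2 ?mev0 ?mev_var1 //; [exact: disc1 | exact: fg_bnd | | | exact: var0].
- exact: var_bnd.
- exact: mps0_bnd.
Qed.

Lemma gadd_0r x : nm x < 1 -> gadd 0 x = x.
Proof.
move=> x1; case: (fg_law G) => _ _ h _ _; rewrite -[RHS](mev_var1 x1).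
have <- : mps_comp G [tuple mps0 F 1; var F 1 0] = var F 1 0 by apply: funext.
rewrite mev_comp2 ?mev0 ?mev_var1 //; [exact: disc1 | exact: fg_bnd | | | exact: var0].
- exact: mps0_bnd.
- exact: var_bnd.
Qed.

Lemma nm0_lt1 : nm (0 : F) < 1. Proof. by rewrite nm0. Qed.
Hint Resolve nm0_lt1 : core.

Lemma fg_const : fg G 0%MM = 0.
Proof.
have := gadd_r0 nm0_lt1; rewrite /gadd mev2E // ?ev0 => [<-|]; last exact: fg_bnd.
by congr (fg G); apply/eqP; rewrite eq_sym -mdeg_eq0 mdeg_exp2.
Qed.

Lemma gadd_lt1 x y : nm x < 1 -> nm y < 1 -> nm (gadd x y) < 1.
Proof. by move=> x1 y1; apply: mev_lt1; [apply: disc2 | exact: fg_bnd | exact: fg_const]. Qed.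

Lemma gaddA x y z : nm x < 1 -> nm y < 1 -> nm z < 1 ->
  gadd (gadd x y) z = gadd x (gadd y z).
Proof.
move=> x1 y1 z1; case: (fg_law G) => _ _ _ _ /funext h.
have dv := disc3 x1 y1 z1.
have := congr1 (fun f => mev f [tuple x; y; z]) h.
have i0 : mev (var F 3 0) [tuple x; y; z] = x by rewrite (mev_var (ord0 : 'I_3)).
have i1 : mev (var F 3 1) [tuple x; y; z] = y.
  by rewrite (mev_var (Ordinal (erefl : (1 < 3)%N))) // (tnth_nth 0).
have i2 : mev (var F 3 2) [tuple x; y; z] = z.
  by rewrite (mev_var (Ordinal (erefl : (2 < 3)%N))) // (tnth_nth 0).
have cb a b : bnd (mps_comp G [tuple var F 3 a; var F 3 b]).
  by apply: mps_comp_in; [apply: fg_bnd | apply: tnth2_in; apply: var_bnd].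
have c0 a b : (a < 3)%N -> (b < 3)%N -> mps_comp G [tuple var F 3 a; var F 3 b] 0%MM = 0.
  by move=> *; apply: mps_comp_const; apply: fg_const.
have v0 a : (a < 3)%N -> var F 3 a 0%MM = 0 by exact: var0.
have vb a : bnd (var F 3 a) by exact: var_bnd.
have e a b : (a < 3)%N -> (b < 3)%N -> mev (mps_comp G [tuple var F 3 a; var F 3 b]) [tuple x; y;
  z] =
    gadd (mev (var F 3 a) [tuple x; y; z]) (mev (var F 3 b) [tuple x; y; z]).
  by move=> ha hb; rewrite (mev_comp2 dv fg_bnd (vb a) (vb b) (v0 _ ha) (v0 _ hb)).
have L := mev_comp2 dv fg_bnd (cb 0 1)%N (vb 2%N) (c0 0%N 1%N erefl erefl) (v0 2%N erefl).
have L' := mev_comp2 dv fg_bnd (vb 0%N) (cb 1 2)%N (v0 0%N erefl) (c0 1%N 2%N erefl erefl).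
have e01 := etrans (e 0%N 1%N erefl erefl) (congr2 gadd i0 i1).
have e12 := etrans (e 1%N 2%N erefl erefl) (congr2 gadd i1 i2).
move=> hv; apply: (etrans (esym (congr2 gadd e01 i2))).
by apply: (etrans (etrans (esym L) (etrans hv L'))); apply: (congr2 gadd i0 e12).
Qed.

Lemma fg_mul_in n : coefs_in (cr (OKr k)) (fg_mul G n).
Proof.
elim: n => [|n IH]; first by move=> m; apply: cr0.
apply: mps_comp_in; first exact: fg_in.
exact: tnth2_in (var_in _ _) IH.
Qed.

Lemma fg_mul_bnd n : bnd (fg_mul G n). Proof. exact: in_OC (fg_mul_in n). Qed.

Lemma fg_mul_const n : fg_mul G n 0%MM = 0.
Proof.
by case: n => [//|n]; apply: mps_comp_const; apply: fg_const.
Qed.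

(* [gs n] is the series [n]_G and [gm n] the map it defines on the open unit disc. *)
Definition gs n : nat -> F := ser (fg_mul G n).
Definition gm n x := ev (gs n) x.

Lemma gs_in n : sOK (gs n). Proof. exact: ser_in (fg_mul_in n). Qed.
Lemma gs_bnd n : sbnd (gs n). Proof. exact: sin_OC (gs_in n). Qed.
Lemma gs0 n : gs n 0%N = 0. Proof. by rewrite /gs /ser exp10 fg_mul_const. Qed.

Lemma mev_fg_mul n x : nm x < 1 -> mev (fg_mul G n) [tuple x] = gm n x.
Proof. by move=> x1; rewrite mev1E //; apply: fg_mul_bnd. Qed.

Lemma gm0 x : gm 0 x = 0.
Proof. by rewrite /gm /ev -[RHS](@tsum0 _ _ F); apply: eq_tsum => i; rewrite mul0r. Qed.

Lemma gm_le n x : nm x < 1 -> nm (gm n x) <= nm x.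
Proof.
move=> x1; rewrite /gm ev_recl ?gs0 ?add0r //; last exact: gs_bnd.
by apply: nmMr_le => //; apply: ev_le1 => // i; apply: gs_bnd.
Qed.

Lemma gm_lt1 n x : nm x < 1 -> nm (gm n x) < 1.
Proof. by move=> x1; apply: le_lt_trans (gm_le n x1) x1. Qed.

Lemma gmS n x : nm x < 1 -> gm n.+1 x = gadd x (gm n x).
Proof.
move=> x1; rewrite -mev_fg_mul //= mev_comp2 ?mev_var1 ?mev_fg_mul ?fg_mul_const ?var0 //.
- exact: disc1.
- exact: fg_bnd.
- exact: var_bnd.
- exact: fg_mul_bnd.
Qed.

Lemma gm1 x : nm x < 1 -> gm 1 x = x.
Proof. by move=> x1; rewrite gmS // gm0 gadd_r0. Qed.

Lemma gmD m n x : nm x < 1 -> gm (m + n) x = gadd (gm m x) (gm n x).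
Proof.
move=> x1; elim: m => [|m IH]; first by rewrite gm0 gadd_0r // gm_lt1.
by rewrite addSn !gmS // IH gaddA // gm_lt1.
Qed.

Lemma gmM m n x : nm x < 1 -> gm (m * n) x = gm m (gm n x).
Proof.
move=> x1; elim: m => [|m IH]; first by rewrite !gm0.
by rewrite mulSn gmD // IH gmS // gm_lt1.
Qed.

Lemma gm_at0 n : gm n 0 = 0. Proof. by rewrite /gm ev0 gs0. Qed.

Lemma gs1 i : gs 1 i = (i == 1%N)%:R.
Proof.
have -> // : gs 1 = fun i => (i == 1%N)%:R.
apply: ev_inj; [exact: gs_bnd | by move=> j; apply: bool_in |].
by move=> x x1; rewrite ev_X -/(gm 1 x) gm1.
Qed.

(** G(X, 0) = X and G(0, Y) = Y leave only terms divisible by XY beyond X + Y. *)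
Lemma gadd_approx x y : nm x < 1 -> nm y < 1 -> nm (gadd x y - (x + y)) <= nm x * nm y.
Proof.
move=> x1 y1; have hb := fg_bnd.
have rowb i : sbnd (fun j => fg G (exp2 i j)) by move=> j; apply: hb.
have col0 : (fun i => fg G (exp2 i 0)) = fun i => (i == 1%N)%:R.
  apply: ev_inj; [by move=> i; apply: hb | by move=> i; apply: bool_in |].
  move=> z z1; rewrite ev_X -[RHS](gadd_r0 z1) /gadd mev2E //.
  by congr ev; apply: funext => i; rewrite ev0.
have row0 : (fun j => fg G (exp2 0 j)) = fun j => (j == 1%N)%:R.
  apply: ev_inj => //; [by move=> i; apply: bool_in |].
  by move=> z z1; rewrite ev_X -[RHS](gadd_0r z1) /gadd mev2E // ev0.
pose b i := ev (fun j => fg G (exp2 i j.+1)) y.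
have bb : sbnd b by move=> i; rewrite OCrE; apply: ev_le1 => // j; apply: hb.
have -> : gadd x y = x + y * ev b x.
  have h1 : sbnd (fun i => fg G (exp2 i 0)) by move=> i; apply: hb.
  have h2 : sbnd (fun i => y * b i) by move=> i; rewrite crM // OCrE ltW.
  rewrite /gadd mev2E // -{2}[x]ev_X -col0 -(evZ _ x1 bb) -(evD x1 h1 h2).
  by congr (ev _ x); apply: funext => i; rewrite ev_recl.
have b0 : b 0%N = 1.
  rewrite /b (_ : (fun j => fg G (exp2 0 j.+1)) = fun j => if j == 0%N then 1 else 0) ?ev_const //.
  by apply: funext => j; have := congr1 (fun f => f j.+1) row0; rewrite /= => ->; case: j.
rewrite ev_recl // b0; set w := ev _ x.
have -> : x + y * (1 + x * w) - (x + y) = x * y * w by ring.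
by rewrite !nmM ler_piMr ?mulr_ge0 ?nm_ge0 // ev_le1 // => i; apply: bb.
Qed.

Lemma gm_approx n x : nm x < 1 -> nm (gm n x - n%:R * x) <= nm x ^+ 2.
Proof.
move=> x1; elim: n => [|n IH]; first by rewrite gm0 mul0r subrr nm0 exprn_ge0 ?nm_ge0.
rewrite gmS // -natr1.
have -> : gadd x (gm n x) - (n%:R + 1) * x =
  (gadd x (gm n x) - (x + gm n x)) + (gm n x - n%:R * x) by ring.
apply: nmD => //; apply: (le_trans (gadd_approx x1 (gm_lt1 n x1))).
by rewrite expr2 ler_wpM2l ?nm_ge0 // gm_le.
Qed.

(** [gm_approx] gives [n](x) = n x up to x^2; letting x = p^(N+1) tend to 0 isolates the linear
    coefficient. *)
Lemma gs_lin n : gs n 1%N = n%:R.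
Proof.
apply/eqP; rewrite -subr_eq0; apply/eqP/small_eq0 => e e0.
have [N hN] := expr_small (nm_ge0 (p%:R : F)) (nm_p_lt1 F) e0.
pose x : F := p%:R ^+ N.+1.
have x1 : nm x < 1 by rewrite nmX exprn_ilt1 ?nm_ge0 ?nm_p_lt1.
have x0 : 0 < nm x by rewrite nm_gt0 // expf_neq0 // p_neq0.
apply: (@le_lt_trans _ _ (nm x)); last by rewrite nmX hN.
rewrite -(ler_pM2r x0) -nmM mulrBl -expr2.
have hb : sbnd (fun i => gs n (i + 2)%N) by move=> i; apply: gs_bnd.
have := gm_approx n x1; rewrite /gm (ev_split 2 x1 (gs_bnd n)) big_ord_recl big_ord1 /= gs0 mul0r
  add0r.
rewrite expr1 => h.
have -> : gs n 1%N * x - n%:R * x = (gs n 1%N * x + x ^+ 2 * ev (fun i => gs n (i + 2)%N) x -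
  n%:R * x)
   - x ^+ 2 * ev (fun i => gs n (i + 2)%N) x by ring.
by apply: nmB => //; rewrite nmM nmX ler_piMr ?exprn_ge0 ?nm_ge0 // ev_le1.
Qed.

(* the series [p]_G (X) / X *)
Definition rr i := gs p i.+1.

Lemma rr_in : sOK rr. Proof. by move=> i; apply: gs_in. Qed.
Lemma rr_bnd : sbnd rr. Proof. exact: sin_OC rr_in. Qed.
Lemma rr0 : rr 0%N = p%:R. Proof. exact: gs_lin. Qed.

Lemma gmp_rr x : nm x < 1 -> gm p x = x * ev rr x.
Proof. by move=> x1; rewrite /gm ev_recl ?gs0 ?add0r //; apply: gs_bnd. Qed.

Lemma p_gt0 : (0 < p)%N. Proof. exact: prime_gt0 (Cp_prime F). Qed.
Lemma p2_gt1 : (1 < p ^ 2)%N. Proof. by rewrite -(exp1n 2) ltn_exp2r // prime_gt1 // (Cp_prime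
  F). Qed.

(** The height hypothesis: no exponent strictly between 0 and p^2 is a multiple of p^2, and the
    coefficient of index 0 is zero. *)
Lemma wdeg_gsp : wdeg k (gs p) (p ^ 2).
Proof.
have [h1 h2] := fg_height G; split=> //; first exact: gs_in.
move=> [|i] hi; first by rewrite gs0 nm0.
by apply: h1; rewrite gtnNdvd.
Qed.

Lemma wdeg_rr : wdeg k rr (p ^ 2).-1.
Proof.
have [_ h1 h2] := wdeg_gsp; have p2 := ltnW p2_gt1; split; first exact: rr_in.
  by move=> i hi; apply: h1; lia.
by rewrite /rr prednK.
Qed.

Definition scomp (a : nat -> F) n : nat -> F := ser (mps_comp (mk a) [tuple fg_mul G n]).

Lemma scomp_in a n : sOK a -> sOK (scomp a n).
Proof.
move=> ha; apply: ser_in; apply: mps_comp_in; first exact: mk_in.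
exact: tnth1_in (fg_mul_in _).
Qed.

Lemma ev_scomp a n x : sbnd a -> nm x < 1 -> ev (scomp a n) x = ev a (gm n x).
Proof.
move=> ha x1; rewrite /scomp -mev1E //; last first.
  apply: mps_comp_in; first exact: mk_in.
  exact: tnth1_in (fg_mul_bnd _).
rewrite (mev_comp1 (disc1 x1) (mk_in ha) (fg_mul_bnd n) (fg_mul_const n)).
by rewrite serK mev_fg_mul.
Qed.

(* the series [p^(n+1)]_G / [p^n]_G, the analogue of a cyclotomic polynomial *)
Definition om n : nat -> F := scomp rr (p ^ n).

Lemma om_in n : sOK (om n). Proof. exact: scomp_in rr_in. Qed.
Lemma om_bnd n : sbnd (om n). Proof. exact: sin_OC (om_in n). Qed.

Lemma ev_om n x : nm x < 1 -> ev (om n) x = ev rr (gm (p ^ n) x).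
Proof. exact: ev_scomp rr_bnd. Qed.

Lemma gm_pS n x : nm x < 1 -> gm (p ^ n.+1) x = gm p (gm (p ^ n) x).
Proof. by move=> x1; rewrite expnS gmM. Qed.

Lemma gm_pSr n x : nm x < 1 -> gm (p ^ n.+1) x = gm (p ^ n) (gm p x).
Proof. by move=> x1; rewrite expnSr gmM. Qed.

Lemma gm_om n x : nm x < 1 -> gm (p ^ n.+1) x = gm (p ^ n) x * ev (om n) x.
Proof. by move=> x1; rewrite gm_pS // gmp_rr ?gm_lt1 // ev_om. Qed.

Lemma gs_om n : gs (p ^ n.+1) = smul (gs (p ^ n)) (om n).
Proof.
have h1 := gs_bnd (p ^ n); have h2 := om_bnd n.
apply: ev_inj; [exact: gs_bnd | exact: smul_in |] => x x1.
by rewrite ev_smul // -/(gm _ _) gm_om.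
Qed.

Lemma om0 n : om n 0%N = p%:R.
Proof. by rewrite -ev0 ev_om // gm_at0 ev0 rr0. Qed.

(** Each factor [om n] has constant term p and so lies in (p, X). Consequently congruences modulo
    all [p^n]_G determine a series. *)
Lemma flt_gs n : flt n (gs (p ^ n)).
Proof.
elim: n => [|n IH]; first exact: flt0 (gs_bnd _).
rewrite gs_om -addn1; apply: flt_smul => // -[|i]; first by rewrite om0.
by rewrite subSS sub0n expr0 sbndE //; apply: om_bnd.
Qed.

Lemma flt_gsM n h : sbnd h -> flt n (smul (gs (p ^ n)) h).
Proof. by move=> hh; have := flt_smul (flt_gs n) (flt0 hh); rewrite addn0. Qed.

Lemma wdeg_gs n : wdeg k (gs (p ^ n)) ((p ^ 2) ^ n).
Proof.
elim: n => [|n IH].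
  have -> : gs (p ^ 0) = fun i => (i == 1%N)%:R by apply: funext => i; rewrite expn0 gs1.
  exact: wdeg_X.
rewrite [X in wdeg k _ X]expnS; apply: (wdeg_comp _ wdeg_gsp IH);
  [by rewrite !expn_gt0 p_gt0 | exact: gs_in |].
by move=> x x1; rewrite -/(gm _ _) gm_pS.
Qed.

(** With [om0] this is the Eisenstein property: constant term p, lower coefficients divisible by p,
    then a unit in degree (p^2 - 1) p^(2n). *)
Lemma wdeg_om n : wdeg k (om n) ((p ^ 2).-1 * (p ^ 2) ^ n).
Proof.
apply: (wdeg_comp _ wdeg_rr (wdeg_gs n)); [by rewrite !expn_gt0 p_gt0 | exact: om_in |].
by move=> x x1; rewrite ev_om.
Qed.

Notation T := (TpH p (@Cp_norm _ _ F) G).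

(** The torsion condition at level n follows from compatibility and t_0 = 0. *)
Lemma TpHP (t : nat -> F) : T t <->
  [/\ forall n, nm (t n) < 1, t 0%N = 0 & forall n, gm p (t n.+1) = t n].
Proof.
split=> [h|[h1 h0 h2]].
  have t1 n : nm (t n) < 1 by have [[]] := h n.
  split=> //; last by move=> n; have [_] := h n.
  by have [[_ +] _] := h 0%N; rewrite expn0 mps_evalE -/(gs 1) -/(gm _ _) gm1.
move=> n; split; last exact: h2.
split; first exact: h1.
rewrite mps_evalE -/(gs _) -/(gm _ _); elim: n => [|n IH]; first by rewrite expn0 gm1 ?h1 ?h0.
by rewrite gm_pSr ?h1 // h2.
Qed.

Lemma TpH_gm (t : nat -> F) m n : T t -> gm (p ^ m) (t (m + n)%N) = t n.
Proof.
move=> /TpHP[h1 _ h2]; elim: m => [|m IH]; first by rewrite expn0 gm1.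
by rewrite gm_pSr // addSn h2.
Qed.

(** [p^n] sends t_(n+1) to t_1, a nonzero zero of [p](X), hence a zero of [p](X) / X. *)
Lemma TpH_om (t : nat -> F) n : T t -> t 1%N != 0 -> ev (om n) (t n.+1) = 0.
Proof.
move=> Tt t10; have /TpHP[h1 h0 h2] := Tt.
rewrite ev_om // -[n.+1]addn1 TpH_gm //.
have := h2 0%N; rewrite h0 gmp_rr // => /eqP; rewrite mulf_eq0 (negbTE t10).
by move/eqP.
Qed.

(** If t_1 = 0, the shifted sequence n -> t_(n+1) lies in the Tate module and p times it is t. *)
Lemma TpHx_neq0 (t : nat -> F) : TpHx p (@Cp_norm _ _ F) G t -> t 1%N != 0.
Proof.
move=> [Tt nt]; apply/negP => /eqP t1; apply: nt; have /TpHP[h1 h0 h2] := Tt.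
exists (fun n => t n.+1); last by move=> n; rewrite mps_evalE -/(gs p) -/(gm _ _) h2.
by apply/TpHP; split=> // n; rewrite h2.
Qed.

(** This sequence is p^i t; truncated subtraction makes its coordinates of index below i equal to
    t_0 = 0. *)
Lemma TpH_mul (t : nat -> F) i : T t -> T (fun j => t (j - i)%N).
Proof.
move=> /TpHP[h1 h0 h2]; apply/TpHP; split=> // n.
case: (leqP i n) => hi; first by rewrite subSn.
have -> : (n - i = 0)%N by lia.
have -> : (n.+1 - i = 0)%N by lia.
by rewrite h0 gm_at0.
Qed.

(** s_1 is a zero of [p](X) / X, nonzero because the constant term is p. The later coordinates solve
    [p](y) = x, where [p](X) - x again satisfies the hypotheses of [ser_root] with q = p^2. *)
Lemma TpH_primitive : exists2 s : nat -> F, T s & s 1%N != 0.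
Proof.
have [_ rl rq] := wdeg_rr; have [_ gl gq] := wdeg_gsp.
have q0 : (0 < (p ^ 2).-1)%N by have := p2_gt1; lia.
have [y1 hy1 ey1] := ser_root q0 rr_bnd rl rq.
have hx x : exists y, nm x < 1 -> nm y < 1 /\ gm p y = x.
  have [x1|] := EM (nm x < 1); last by exists 0.
  pose g i := if i == 0%N then - x else gs p i.
  have hg : sbnd g by move=> i; rewrite /g; case: ifP => _; [rewrite OCrE nmN ltW | apply: gs_bnd].
  have [||||y y1' ey] := @ser_root _ _ _ g (p ^ 2).
  - by have := p2_gt1; lia.
  - exact: hg.
  - by move=> i hi; rewrite /g; case: eqP => [_|_]; [rewrite nmN | apply: gl].
  - by rewrite /g gtn_eqF //; have := p2_gt1; lia.
  exists y => _; split=> //; move: ey; rewrite (ev_recl y1' hg) /gm (ev_recl y1' (gs_bnd p)).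
  by rewrite gs0 /g /= => /eqP; rewrite addrC subr_eq0 add0r => /eqP.
have [nx hnx] := choice hx.
pose s := fix s n := if n is n'.+1 then (if n' is _.+1 then nx (s n') else y1) else 0.
have sS n : s n.+2 = nx (s n.+1) by [].
have s1 n : nm (s n) < 1.
  elim: n => [//|[|n] IH //]; rewrite sS.
  by have [] := hnx _ IH.
exists s.
  apply/TpHP; split=> // -[|n]; last by rewrite sS; have [] := hnx _ (s1 n.+1).
  by rewrite /= gmp_rr // ey1 mulr0.
by apply/negP => /= /eqP y0; move: ey1; rewrite y0 ev0 rr0 => /eqP; rewrite (negbTE (p_neq0 F)).
Qed.

End FormalGroup.

(** * Homomorphisms to G_m *)

Record dual_pair (R : realType) (p : nat) (F : Cp_field R p) (k : unram_field F) := DualPair {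
  dG : fgroup k;
  dH : fgroup k;
  dPhi : nat -> mps F 2;
  dP : cartier_dual p (@Cp_norm _ _ F) (uK k) dG dH dPhi }.

Section Characters.
Variables (R : realType) (p : nat) (F : Cp_field R p) (k : unram_field F) (D : dual_pair k).
Notation cvg s l := (cvg_seq (@Cp_norm _ _ F) s l).
Notation sOK := (ser_over (OKr k)).
Notation sbnd := (ser_over (@OCr R p F)).
Notation bnd := (coefs_in (cr (@OCr R p F))).
Notation np := (nm (p%:R : F)).
Notation G := (dG D).
Notation H := (dH D).
Notation Phi := (dPhi D).
Notation T := (TpH p (@Cp_norm _ _ F) H).
Implicit Types (x y z : F) (t : nat -> F) (a b f h : nat -> F).

Definition pev (f : mps F 2) y : nat -> F := fun i => ev (fun j => f (exp2 i j)) y.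

Lemma ser_eval2 (f : mps F 2) y : ser (mps_eval2 (@Cp_norm _ _ F) f y) = pev f y.
Proof. by apply: funext => i; rewrite /ser /mps_eval2 mdeg_exp1. Qed.

Lemma pev_bnd (f : mps F 2) y : bnd f -> nm y < 1 -> sbnd (pev f y).
Proof. by move=> hf y1 i; rewrite OCrE; apply: ev_le1 => // j; apply: hf. Qed.

Lemma ev_pev (f : mps F 2) x y : bnd f -> nm x < 1 -> nm y < 1 ->
  ev (pev f y) x = mev f [tuple x; y].
Proof. by move=> hf x1 y1; rewrite mev2E. Qed.

Lemma smulA a b h : sbnd a -> sbnd b -> sbnd h -> smul a (smul b h) = smul (smul a b) h.
Proof.
move=> ha hb hh; have bh := smul_in hb hh; have ab := smul_in ha hb.
apply: ev_inj => [||x x1]; try exact: smul_in.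
by rewrite !ev_smul // mulrA.
Qed.

Lemma Phi_in n : coefs_in (cr (OKr k)) (Phi n).
Proof. by case: (dP D) => /(_ n) []. Qed.

Lemma Phi_bnd n : bnd (Phi n). Proof. exact: in_OC (Phi_in n). Qed.

Lemma fg_mul_var_bnd (L : fgroup k) d n i : bnd (fg_mul_var d L n i).
Proof. by apply: mps_comp_in; [apply: fg_mul_bnd | apply: tnth1_in; apply: var_bnd]. Qed.

Lemma fg_mul_var0 (L : fgroup k) d n i : (i < d)%N -> fg_mul_var d L n i 0%MM = 0.
Proof.
by move=> id; apply: mps_comp_const; apply: fg_mul_const.
Qed.

Lemma mev_fg_mul_var (L : fgroup k) d n (i : 'I_d) v : disc v ->
  mev (fg_mul_var d L n i) v = gm L n (tnth v i).
Proof.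
move=> dv; rewrite /fg_mul_var mev_comp1 ?mev_var ?var0 //; first exact: fg_mul_bnd.
exact: var_bnd.
Qed.

Lemma Phi_unit n y : nm y < 1 -> gm H (p ^ n) y = 0 -> pev (Phi n) y 0%N = 1.
Proof.
move=> y1 Hy; case: (dP D) => /(_ n) [_ [hi _] _ _ _] _ _.
have vb := var_bnd F (d := 1) 0%N; have zb : bnd (mps0 F 1) by exact: mps0_in.
have Pb := Phi_bnd n; have dv := disc1 y1.
have cb := mps_comp_in Pb (tnth2_in zb vb).
have ob : bnd (mps1 F 1) by move=> m; apply: bool_in.
have [h hh he] := in_ideal_ev1 (S := OKr k) hi (fg_mul_bnd H _).
have := he _ dv; rewrite (mev_fg_mul H _ y1) Hy mul0r (mevB dv cb ob) mev1.
rewrite (mev_comp2 dv Pb zb vb erefl (var0 F (ltnSn 0))) mev0 (mev_var1 y1) => /eqP.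
rewrite subr_eq0 => /eqP <-; have z1 := nm0_lt1 F.
by rewrite -(ev_pev Pb z1 y1) ev0.
Qed.

(** The pairing is bilinear only modulo the three generators. The one in z vanishes at a torsion
    point; the other two leave an error that tends to 0 with n. *)
Lemma Phi_mul n x y z : nm x < 1 -> nm y < 1 -> nm z < 1 -> gm H (p ^ n) z = 0 ->
  nm (mev (Phi n) [tuple gadd G x y; z] - mev (Phi n) [tuple x; z] * mev (Phi n) [tuple y; z])
   <= Num.max (nm (gm G (p ^ n) x)) (nm (gm G (p ^ n) y)).
Proof.
move=> x1 y1 z1 Hz; case: (dP D) => /(_ n) [_ _ hi _ _] _ _.
have dv := disc3 x1 y1 z1; have Pb := Phi_bnd n.
have vb i := var_bnd F (d := 3) i.
have v0 := var0 F (d := 3).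
have cG := mps_comp_in (fg_bnd G) (tnth2_in (vb 0%N) (vb 1%N)).
have cG0 := mps_comp_const [tuple var F 3 0; var F 3 1] (fg_const G).
have b1 := mps_comp_in Pb (tnth2_in cG (vb 2%N)).
have b2 i j := mps_comp_in Pb (tnth2_in (vb i) (vb j)).
pose i1 : 'I_3 := Ordinal (erefl : (1 < 3)%N); pose i2 : 'I_3 := Ordinal (erefl : (2 < 3)%N).
have e0 : mev (var F 3 0) [tuple x; y; z] = x := mev_var (ord0 : 'I_3) dv.
have e1 : mev (var F 3 1) [tuple x; y; z] = y := mev_var i1 dv.
have e2 : mev (var F 3 2) [tuple x; y; z] = z := mev_var i2 dv.
have [h1 [h2 [h3 [hh1 hh2 _ he]]]] := in_ideal_ev3 (S := OKr k) hi
  (fg_mul_var_bnd G _ _) (fg_mul_var_bnd G _ _) (fg_mul_var_bnd H _ _).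
have g0 : mev (fg_mul_var 3 G (p ^ n) 0) [tuple x; y; z] = gm G (p ^ n) x :=
  mev_fg_mul_var G _ (ord0 : 'I_3) dv.
have g1 : mev (fg_mul_var 3 G (p ^ n) 1) [tuple x; y; z] = gm G (p ^ n) y :=
  mev_fg_mul_var G _ i1 dv.
have g2 : mev (fg_mul_var 3 H (p ^ n) 2) [tuple x; y; z] = 0 :=
  etrans (mev_fg_mul_var H _ i2 dv) Hz.
have eG := etrans (mev_comp2 dv (fg_bnd G) (vb 0%N) (vb 1%N) (v0 0%N erefl) (v0 1%N erefl))
  (congr2 (gadd G) e0 e1).
pose ph (a b : F) := mev (Phi n) [tuple a; b].
have eA := etrans (mev_comp2 dv Pb cG (vb 2%N) cG0 (v0 2%N erefl)) (congr2 ph eG e2).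
have eB := etrans (mev_comp2 dv Pb (vb 0%N) (vb 2%N) (v0 0%N erefl) (v0 2%N erefl)) (congr2 ph e0
  e2).
have eC := etrans (mev_comp2 dv Pb (vb 1%N) (vb 2%N) (v0 1%N erefl) (v0 2%N erefl)) (congr2 ph e1
  e2).
have L := etrans (mevB dv b1 (mpsM_in (b2 0 2)%N (b2 1 2)%N))
  (congr2 (fun a b : F => a - b) eA (etrans (mevM dv (b2 0 2)%N (b2 1 2)%N) (congr2 *%R eB eC))).
have Er := congr2 +%R (congr2 +%R (congr1 ( *%R^~ (mev h1 [tuple x; y; z])) g0)
  (congr1 ( *%R^~ (mev h2 [tuple x; y; z])) g1)) (congr1 ( *%R^~ (mev h3 [tuple x; y; z])) g2).
rewrite [nm (_ - _)](congr1 nm (etrans (esym L) (etrans (he _ dv) Er))) /= mul0r addr0.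
have m1 := mev_le1 dv (in_OC hh1); have m2 := mev_le1 dv (in_OC hh2).
by apply: nmD; apply: nmMr_le => //; rewrite le_max lexx ?orbT.
Qed.

Lemma Phi_step n : exists h1 h2 : mps F 2,
  [/\ coefs_in (cr (OKr k)) h1, coefs_in (cr (OKr k)) h2 &
   forall x y, nm x < 1 -> nm y < 1 -> mev (Phi n.+1) [tuple x; y] =
     mev (Phi n) [tuple x; gm H p y] + gm G (p ^ n) x * mev h1 [tuple x; y]
       + gm H (p ^ n.+1) y * mev h2 [tuple x; y]].
Proof.
case: (dP D) => _ _ /(_ n) hi.
have [h1 [h2 [hh1 hh2 he]]] := in_ideal_ev2 (S := OKr k) hi
  (fg_mul_var_bnd G _ _) (fg_mul_var_bnd H _ _).
exists h1, h2; split=> // x y x1 y1.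
have dv := disc2 x1 y1; have Pb := Phi_bnd n; have Pb' := Phi_bnd n.+1.
have vb := var_bnd F (d := 2) 0%N.
have gb := fg_mul_var_bnd H (d := 2) p 1%N.
have e0 : mev (var F 2 0) [tuple x; y] = x := mev_var (ord0 : 'I_2) dv.
have e1 : mev (fg_mul_var 2 H p 1) [tuple x;
  y] = gm H p y := mev_fg_mul_var H p (ord_max : 'I_2) dv.
pose ph (a b : F) := mev (Phi n) [tuple a; b].
have eA := etrans (mev_comp2 dv Pb vb gb (var0 F (ltn0Sn 1)) (fg_mul_var0 H p (ltnSn 1)))
   (congr2 ph e0 e1).
have L := etrans (mevB dv Pb' (mps_comp_in Pb (tnth2_in vb gb)))
  (congr1 (fun b : F => mev (Phi n.+1) [tuple x; y] - b) eA).
have g0 : mev (fg_mul_var 2 G (p ^ n) 0) [tuple x; y] = gm G (p ^ n) x :=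
  mev_fg_mul_var G _ (ord0 : 'I_2) dv.
have g1 : mev (fg_mul_var 2 H (p ^ n.+1) 1) [tuple x; y] = gm H (p ^ n.+1) y :=
  mev_fg_mul_var H _ (ord_max : 'I_2) dv.
have Er := congr2 +%R (congr1 ( *%R^~ (mev h1 [tuple x; y])) g0)
  (congr1 ( *%R^~ (mev h2 [tuple x; y])) g1).
have /eqP := etrans (esym L) (etrans (he _ dv) Er); rewrite /= subr_eq => /eqP ->.
by rewrite /ph; ring.
Qed.

(** The identity of [Phi_step] as one between series in X for fixed y, so that a functional of level
    n can be applied to it and kills the multiple of [p^n]_G. *)
Lemma pev_step n : exists h1 h2 : mps F 2,
  [/\ coefs_in (cr (OKr k)) h1, coefs_in (cr (OKr k)) h2 &
   forall y, nm y < 1 -> forall i, pev (Phi n.+1) y i = pev (Phi n) (gm H p y) i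
      + smul (gs G (p ^ n)) (pev h1 y) i + gm H (p ^ n.+1) y * pev h2 y i].
Proof.
have [h1 [h2 [hh1 hh2 he]]] := Phi_step n; exists h1, h2; split=> // y y1 i.
have Pb := Phi_bnd; have Hy1 := gm_lt1 H p y1; have Hy1' := gm_lt1 H (p ^ n.+1) y1.
have b1 := pev_bnd (in_OC hh1) y1; have b2 := pev_bnd (in_OC hh2) y1.
have bG := gs_bnd G (p ^ n); have b3 := smul_in bG b1.
have b4 := pev_bnd (Pb n) Hy1.
have b5 : sbnd (fun i => gm H (p ^ n.+1) y * pev h2 y i).
  by move=> j; rewrite crM // OCrE ltW.
have b6 : sbnd (fun i => pev (Phi n) (gm H p y) i + smul (gs G (p ^ n)) (pev h1 y) i).
  by move=> j; apply: crD.
suff -> : pev (Phi n.+1) y = fun i => pev (Phi n) (gm H p y) i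
      + smul (gs G (p ^ n)) (pev h1 y) i + gm H (p ^ n.+1) y * pev h2 y i by [].
apply: ev_inj; [exact: pev_bnd | by move=> j; apply: crD |] => x x1.
rewrite (evD x1 b6 b5) (evD x1 b4 b3) (evZ _ x1 b2) (ev_smul x1 bG b1) (ev_pev (Pb n.+1) x1 y1).
by rewrite (ev_pev (Pb n) x1 Hy1) (ev_pev (in_OC hh1) x1 y1) (ev_pev (in_OC hh2) x1 y1) he.
Qed.

(* f is the series attached to t; the congruences modulo all [p^n]_G already determine it. *)
Definition fsp t f := sbnd f /\ forall n, exists2 h, sbnd h &
  forall i, f i = pev (Phi n) (t n) i + smul (gs G (p ^ n)) h i.

Lemma flt_small a : (forall n, flt n a) -> forall i, a i = 0.
Proof.
move=> h i; apply: small_eq0 => e e0.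
have [N hN] := expr_small (nm_ge0 (p%:R : F)) (nm_p_lt1 F) e0.
by apply: (le_lt_trans (h (N + i)%N i)); rewrite addnK hN.
Qed.

Lemma fsp_uniq t f f' : fsp t f -> fsp t f' -> f = f'.
Proof.
move=> [_ h] [_ h']; apply: funext => i; apply/eqP; rewrite -subr_eq0; apply/eqP.
move: i; apply: flt_small => n i.
have [g hg ->] := h n; have [g' hg' ->] := h' n.
rewrite [X in nm X](_ : _ = smul (gs G (p ^ n)) g i - smul (gs G (p ^ n)) g' i); last by ring.
by apply: nmB; apply: flt_gsM.
Qed.

Lemma null_flt (a : nat -> nat -> F) i : (forall n, flt n (a n)) -> null (fun n => a n i).
Proof.
move=> h; apply: (@null_unshift _ _ _ _ i).
apply: (null_geom (nm_ge0 (p%:R : F)) (nm_p_lt1 F)) => n.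
by have := h (n + i)%N i; rewrite addnK.
Qed.

(** The cofactors tend to 0 coefficientwise as m grows, which allows [p^n]_G to be factored out of
    an infinite sum of multiples of the [p^(n+m)]_G. *)
Lemma gs_quot n m : exists Q, [/\ sbnd Q, flt m Q & gs G (p ^ (n + m)) = smul (gs G (p ^ n)) Q].
Proof.
elim: m => [|m [Q [Qb Qf e]]].
  exists (fun i => (i == 0%N)%:R); split; first by move=> i; apply: bool_in.
    by apply: flt0 => i; apply: bool_in.
  rewrite addn0; apply: funext => i; rewrite smulC /smul big_ord_recl eqxx mul1r subn0.
  by rewrite big1 ?addr0 // => j _; rewrite mul0r.
have ob := om_bnd G (n + m); exists (smul Q (om G (n + m))); split.
- exact: smul_in.
- rewrite -addn1; apply: flt_smul => // -[|i]; first by rewrite om0.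
  by rewrite subSS sub0n expr0 sbndE.
- by rewrite addnS gs_om e smulA //; apply: gs_bnd.
Qed.

Lemma fsp_exists t : T t -> exists f, fsp t f.
Proof.
move=> Tt; have /TpHP[t1 t0 tS] := Tt.
have Pb := Phi_bnd.
have hn n : exists h, sbnd h /\ forall i,
    pev (Phi n.+1) (t n.+1) i = pev (Phi n) (t n) i + smul (gs G (p ^ n)) h i.
  have [h1 [h2 [hh1 hh2 he]]] := pev_step n; exists (pev h1 (t n.+1)); split.
    by apply: pev_bnd => //; apply: in_OC hh1.
  move=> i; rewrite he // tS; have := TpH_gm n.+1 0 Tt; rewrite addn0 t0 => ->.
  by rewrite mul0r addr0.
have [h hP] := choice hn.
have hb n : sbnd (h n) by case: (hP n).
have hE n i : pev (Phi n.+1) (t n.+1) i = pev (Phi n) (t n) i + smul (gs G (p ^ n)) (h n) i.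
  by case: (hP n).
have hnull i : null (fun n => smul (gs G (p ^ n)) (h n) i).
  by apply: (@null_flt (fun n => smul (gs G (p ^ n)) (h n)) i) => n; apply: flt_gsM.
have A0b : sbnd (pev (Phi 0) (t 0%N)) by apply: pev_bnd.
pose f i := pev (Phi 0) (t 0%N) i + tsum (fun n => smul (gs G (p ^ n)) (h n) i).
have part n i : pev (Phi n) (t n) i = pev (Phi 0) (t 0%N) i + \sum_(l < n) smul (gs G (p ^ l)) (h
  l) i.
  elim: n => [|n IH]; first by rewrite big_ord0 addr0.
  by rewrite hE IH big_ord_recr /= addrA.
exists f; split.
  move=> i; apply: crD => //; apply: cr_tsum => // n.
  by apply: smul_in => //; apply: gs_bnd.
move=> n.
(* The tail of the defining sum from n on is [p^n]_G times the convergent sum of the Q_m h_(n+m). *)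
have [Q HQ] := choice (gs_quot n).
have Qb m : sbnd (Q m) by case: (HQ m).
have Qn i : null (fun m => smul (Q m) (h (n + m)%N) i).
  apply: (@null_flt (fun m => smul (Q m) (h (n + m)%N)) i) => m; have [_ Qf _] := HQ m.
  by have := flt_smul Qf (flt0 (hb (n + m)%N)); rewrite addn0.
exists (fun i => tsum (fun m => smul (Q m) (h (n + m)%N) i)).
  by move=> i; apply: cr_tsum => // m; apply: smul_in.
move=> i; rewrite /f (tsum_split n (hnull i)) addrA -part; congr (_ + _).
have -> : smul (gs G (p ^ n)) (fun i => tsum (fun m => smul (Q m) (h (n + m)%N) i)) i =
    tsum (fun m => smul (gs G (p ^ n)) (smul (Q m) (h (n + m)%N)) i).
  apply/esym/tsum_uniq.
  have hs (j : 'I_i.+1) := cvgMl (gs G (p ^ n) j) (tsumP (Qn (i - j)%N)).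
  have := cvg_sum (index_enum 'I_i.+1) hs.
  apply: (cvg_eventually (N := 0)) => N _ /=.
  under eq_bigr do rewrite mulr_sumr.
  by rewrite exchange_big.
apply: eq_tsum => m; rewrite smulA //; last exact: gs_bnd.
by have [_ _ <-] := HQ m; rewrite addnC.
Qed.

(** [p^(n+1)](x) is [p^n](x) times [om n] at x, a factor of norm at most max(|p|, |x|) < 1. *)
Lemma gm_null x : nm x < 1 -> null (fun n => gm G (p ^ n) x).
Proof.
move=> x1; pose r := Num.max np (nm x).
have r0 : 0 <= r by rewrite le_max nm_ge0.
have r1 : r < 1 by rewrite gt_max nm_p_lt1 x1.
apply: (null_geom r0 r1) => n; elim: n => [|n IH].
  by rewrite expn0 gm1 // expr0 ltW.
rewrite gm_om // nmM exprSr ler_pM ?nm_ge0 // ev_om //.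
have h := gm_lt1 G (p ^ n) x1.
rewrite ev_recl //; last exact: rr_bnd.
apply: nmD; first by rewrite rr0 le_max lexx.
apply: nmMr_le; last by apply: ev_le1 => // i; apply: rr_bnd.
by apply: (le_trans (gm_le G _ x1)); rewrite le_max lexx orbT.
Qed.

Lemma fsp_close t f n x : T t -> fsp t f -> nm x < 1 ->
  nm (ev f x - mev (Phi n) [tuple x; t n]) <= nm (gm G (p ^ n) x).
Proof.
move=> /TpHP[t1 t0 tS] [fb h] x1; have [g gb e] := h n.
have Pb := Phi_bnd n; have Gb := gs_bnd G (p ^ n).
have -> : f = fun i => pev (Phi n) (t n) i + smul (gs G (p ^ n)) g i by apply: funext.
rewrite evD ?ev_smul ?ev_pev //; [|exact: pev_bnd | exact: smul_in].
by rewrite addrAC subrr add0r; apply: nmMr_le => //; apply: ev_le1.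
Qed.

(** At level n the failure of multiplicativity is bounded by [p^n]_G at x, y and their sum, and all
    three tend to 0. *)
Lemma fsp_mul t f x y : T t -> fsp t f -> nm x < 1 -> nm y < 1 ->
  ev f (gadd G x y) = ev f x * ev f y.
Proof.
move=> Tt hf x1 y1; have fb := hf.1; have /TpHP[t1 t0 tS] := Tt.
have g1 := gadd_lt1 G x1 y1.
apply/eqP; rewrite -subr_eq0; apply/eqP/small_eq0 => e e0.
have small z : nm z < 1 -> exists N, forall n, (N <= n)%N -> nm (gm G (p ^ n) z) < e.
  by move=> z1; have /nullE/(_ _ e0) := gm_null z1.
have [N1 h1] := small _ x1; have [N2 h2] := small _ y1; have [N3 h3] := small _ g1.
pose n := maxn N1 (maxn N2 N3).
have lx := h1 n (leq_maxl _ _).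
have ly : nm (gm G (p ^ n) y) < e by apply: h2; rewrite /n; lia.
have lg : nm (gm G (p ^ n) (gadd G x y)) < e by apply: h3; rewrite /n; lia.
have tz : gm H (p ^ n) (t n) = 0 by have := TpH_gm n 0 Tt; rewrite addn0 t0.
have hm := Phi_mul x1 y1 (t1 n) tz.
have cx := fsp_close n Tt hf x1; have cy := fsp_close n Tt hf y1; have cg := fsp_close n Tt hf g1.
set a := mev (Phi n) [tuple gadd G x y; t n] in hm cg; set b := mev (Phi n) [tuple x; t n] in hm cx.
set c := mev (Phi n) [tuple y; t n] in hm cy.
have b1 : nm b <= 1 by apply: mev_le1; [apply: disc2 | apply: Phi_bnd].
have -> : ev f (gadd G x y) - ev f x * ev f y =
   (ev f (gadd G x y) - a) + (a - b * c) + (- (ev f x - b) * ev f y - b * (ev f y - c)) by ring.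
apply: nmD_lt; first apply: nmD_lt.
- exact: le_lt_trans cg lg.
- by apply: (le_lt_trans hm); rewrite gt_max lx ly.
apply: nmB_lt.
  by apply: (le_lt_trans _ lx); apply: nmMr_le; [rewrite nmN | apply: ev_le1].
by apply: (le_lt_trans _ ly); apply: nmM_le.
Qed.

Lemma fsp_corresponds t f : T t -> fsp t f -> corresponds p (@Cp_norm _ _ F) G Phi t (mk f).
Proof.
move=> Tt hf; have [fb fE] := hf; have /TpHP[t1 t0 tS] := Tt.
have mb := mk_in fb; have vb i : bnd (var F 2 i) by apply: var_bnd.
split; [split|].
- exact: mb.
- rewrite -/(ser (mk f) 0%N) serK; have [g gb ->] := fE 0%N.
  rewrite Phi_unit //; last by rewrite expn0 gm1 // t0.
  by rewrite /smul big_ord1 gs0 mul0r addr0.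
- have cb i : bnd (mps_comp (mk f) [tuple var F 2 i]).
    by apply: mps_comp_in => //; apply: tnth1_in.
  move=> m; suff -> : mps_comp (mk f) [tuple fg G] =
     mpsM (mps_comp (mk f) [tuple var F 2 0]) (mps_comp (mk f) [tuple var F 2 1]) by [].
  apply: mev2_inj => [||x y x1 y1].
  + by apply: mps_comp_in => //; apply: tnth1_in; apply: fg_bnd.
  + exact: mpsM_in.
  have dv := disc2 x1 y1.
  have e0 : mev (var F 2 0) [tuple x; y] = x := mev_var (ord0 : 'I_2) dv.
  have e1 : mev (var F 2 1) [tuple x; y] = y := mev_var (ord_max : 'I_2) dv.
  rewrite (mevM dv (cb 0%N) (cb 1%N)) (mev_comp1 dv mb (fg_bnd G) (fg_const G)).
  rewrite (mev_comp1 dv mb (vb 0%N) (var0 F (ltn0Sn 1))) (mev_comp1 dv mb (vb 1%N) (var0 F (ltnSn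
    1))).
  by rewrite serK e0 e1; apply: fsp_mul.
move=> n; have [g gb e] := fE n.
exists (fun=> mk g) => [_|m]; first exact: (mk_in gb).
rewrite big_ord1 /= -(exp1_mdeg m) -/(ser (mpsM _ _) _) ser_mpsM serK.
rewrite /mpsB -/(ser (mk f) _) serK -/(ser (mps_eval2 _ _ _) _) ser_eval2 e.
by rewrite addrAC subrr add0r.
Qed.

Lemma corresponds_fsp t (f : mps F 1) :
  corresponds p (@Cp_norm _ _ F) G Phi t f -> fsp t (ser f).
Proof.
move=> [[fb _ _] h]; split; first by apply: ser_in.
move=> n; have [g gb e] := h n; exists (ser (g ord0)); first by apply: ser_in; apply: gb.
move=> i; have := e (exp1 i); rewrite big_ord1 /= -/(ser (mpsM _ _) _) ser_mpsM.
rewrite /mpsB -/(ser f i) -/(ser (mps_eval2 _ _ _) i) ser_eval2 => /eqP.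
by rewrite subr_eq addrC => /eqP.
Qed.

Notation fser t := (ser (series_of p (@Cp_norm _ _ F) G Phi t)).

Lemma series_of_fsp t : T t -> fsp t (fser t).
Proof.
move=> Tt; have [f hf] := fsp_exists Tt; apply: corresponds_fsp.
apply: (@xgetPex _ _ [set f | corresponds p (@Cp_norm _ _ F) G Phi t f]%classic).
by exists (mk f); apply: fsp_corresponds.
Qed.

End Characters.

(** * Continuous functionals *)

Section Division.
Variables (R : realType) (p : nat) (F : Cp_field R p) (k : unram_field F).
Notation sOK := (ser_over (OKr k)).
Notation sbnd := (ser_over (@OCr R p F)).
Notation np := (nm (p%:R : F)).
Implicit Types (a b c f g h : nat -> F) (x y : F).

Lemma np_in : (p%:R : F) \in cr (OKr k). Proof. exact: cr_nat. Qed.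

Lemma OK_factor x n : x \in cr (OKr k) -> nm x <= np ^+ n ->
  exists2 y, y \in cr (OKr k) & x = p%:R ^+ n * y.
Proof.
move=> hx h; exists (x / p%:R ^+ n); first exact: OK_divp.
by rewrite mulrC divfK // expf_neq0 // p_neq0.
Qed.

Lemma OK_factors a n : sOK a -> (forall i, nm (a i) <= np ^+ n) ->
  exists2 b, sOK b & forall i, a i = p%:R ^+ n * b i.
Proof.
move=> ha h; exists (fun i => a i / p%:R ^+ n) => i; first exact: OK_divp.
by rewrite mulrC divfK // expf_neq0 // p_neq0.
Qed.

Lemma wdeg_low g q : wdeg k g q -> forall i, (i < q)%N -> exists2 x, x \in cr (OKr k) & g i =
  p%:R * x.
Proof.
move=> [hg low _] i hi; have := @OK_factor (g i) 1 (hg i); rewrite !expr1; apply.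
by apply: (OK_lt1 (hg i)); apply: low.
Qed.

Lemma wdeg_division g q f : wdeg k g q -> sOK f -> exists h r : nat -> F,
  [/\ sOK h, sOK r, forall i, (q <= i)%N -> r i = 0 & forall i, f i = smul g h i + r i].
Proof.
move=> hw; have [hg low gq] := hw.
exact: (weierstrass_division hg gq np_in (nm_p_lt1 F) (wdeg_low hw)).
Qed.

Lemma wdeg_unique g q h r : wdeg k g q -> sbnd h -> (forall i, (q <= i)%N -> r i = 0) ->
  (forall i, smul g h i + r i = 0) -> (forall i, h i = 0) /\ (forall i, r i = 0).
Proof.
move=> hw; have [hg low gq] := hw.
exact: (weierstrass_unique hg gq (nm_p_lt1 F) (wdeg_low hw)).
Qed.

Lemma smul_low g q h i : wdeg k g q -> sbnd h -> (i < q)%N -> nm (smul g h i) < 1.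
Proof.
move=> [_ low _] hh iq; apply: nm_sum_lt => // -[j /= hj] _; rewrite nmM.
apply: (@le_lt_trans _ _ (nm (g j))); last by apply: low; lia.
by rewrite ler_piMr ?nm_ge0 // sbndE.
Qed.

Lemma smul_delta g n : smul g (fun i => (i == n)%:R) = xshift n g.
Proof.
apply: funext => i; rewrite smulC.
have -> : (fun j : nat => (j == n)%:R : F) = xshift n (fun j => (j == 0%N)%:R).
  apply: funext => j; rewrite /xshift; case: ltnP => jn; first by rewrite ltn_eqF.
  by congr (_%:R); rewrite subn_eq0 eqn_leq jn andbT.
rewrite smul_xshift /xshift; case: ltnP => // ni.
rewrite /smul big_ord_recl eqxx mul1r subn0 big1 ?addr0 // => j _.
by rewrite mul0r.
Qed.

End Division.

(** * Functionals as null sequences *)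

Section Functionals.
Variables (R : realType) (p : nat) (F : Cp_field R p) (k : unram_field F).
Notation cvg s l := (cvg_seq (@Cp_norm _ _ F) s l).
Notation sOK := (ser_over (OKr k)).
Notation sbnd := (ser_over (@OCr R p F)).
Notation bnd := (coefs_in (cr (@OCr R p F))).
Notation cOK := (coefs_in (cr (OKr k))).
Notation np := (nm (p%:R : F)).
Notation lin := (OK_linear (@Cp_norm _ _ F) (uK k)).
Notation Uh := (Uhat p (@Cp_norm _ _ F) (uK k)).
Implicit Types (a b c h : nat -> F) (x y : F) (u : mps F 1 -> F).

Lemma ser_Xn n i : ser (Xn F n) i = (i == n)%:R.
Proof. by rewrite /ser /Xn; congr (nat_of_bool _)%:R; apply/eqP/eqP => [/exp1_inj|->]. Qed.

Lemma Xn_mk n : Xn F n = mk (fun i => (i == n)%:R).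
Proof. by rewrite -[LHS]mkK; congr mk; apply: funext => i; rewrite ser_Xn. Qed.

Lemma linE u (c : F) (f g : mps F 1) : lin u -> c \in cr (OKr k) -> cOK f -> cOK g ->
  u (fun m => c * f m + g m) = c * u f + u g.
Proof. by case=> _; apply. Qed.

Lemma lin_in u f : lin u -> cOK f -> u f \in cr (OKr k). Proof. by case=> + _; apply. Qed.

Lemma lin0 u : lin u -> u (mps0 F 1) = 0.
Proof.
move=> hu; have h0 : cOK (mps0 F 1) by move=> m; apply: cr0.
have := linE hu (cr1 _) h0 h0.
rewrite (_ : (fun m => 1 * mps0 F 1 m + mps0 F 1 m) = mps0 F 1); last first.
  by apply: funext => m; rewrite /mps0 mulr0 addr0.
by move/eqP; rewrite mul1r -subr_eq0 opprD addrA subrr sub0r oppr_eq0 => /eqP.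
Qed.

Lemma linD u f g : lin u -> cOK f -> cOK g -> u (fun m => f m + g m) = u f + u g.
Proof.
move=> hu hf hg; have := linE hu (cr1 _) hf hg; rewrite mul1r => <-; congr u.
by apply: funext => m; rewrite mul1r.
Qed.

Definition upto M a : nat -> F := fun i => if (i < M)%N then a i else 0.
Definition from M a : nat -> F := fun i => if (i < M)%N then 0 else a i.

Lemma upto_in M a : sOK a -> sOK (upto M a).
Proof. by move=> h i; rewrite /upto; case: ifP => // _; apply: cr0. Qed.
Lemma from_in M a : sOK a -> sOK (from M a).
Proof. by move=> h i; rewrite /from; case: ifP => // _; apply: cr0. Qed.

Lemma lin_upto u M a : lin u -> sOK a -> u (mk (upto M a)) = \sum_(i < M) a i * u (Xn F i).
Proof.
move=> hu ha; elim: M => [|M IH]; first by rewrite big_ord0 -(lin0 hu).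
rewrite big_ord_recr /= -IH addrC -linE //; [| exact: Xn_in | exact: mk_in (upto_in _ ha)].
congr u; apply: funext => m; rewrite Xn_mk /mk /upto ltnS.
by case: (ltngtP (mdeg m) M) => h; rewrite ?mulr0 ?mulr1 ?add0r ?addr0 // h.
Qed.

Lemma lin_split u M a : lin u -> sOK a ->
  u (mk a) = \sum_(i < M) a i * u (Xn F i) + u (mk (from M a)).
Proof.
move=> hu ha; rewrite -lin_upto // -linD //; try by apply: mk_in; [apply: upto_in | apply: from_in].
- congr u; apply: funext => m; rewrite /mk /upto /from.
  by case: ifP; rewrite ?addr0 ?add0r.
- exact: mk_in (upto_in _ ha).
- exact: mk_in (from_in _ ha).
Qed.

(** Continuity for the X-adic topology only; in the p-adic direction linearity is enough. *)
Definition ucont u := forall e, exists M, forall a, sOK a -> (forall i, (i < M)%N -> a i = 0) ->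
  nm (u (mk a)) <= np ^+ e.

Definition urep u c := [/\ sOK c, null c, forall i, u (Xn F i) = c i &
  forall f, cOK f -> u f = tsum (fun i => ser f i * c i)].

Lemma null_pairing a c : sbnd a -> null c -> null (fun i => a i * c i).
Proof. by move=> ha; apply: null_mulr => i; apply: sbndE. Qed.

Lemma null_pow_le a : (forall n, exists N, forall i, (N <= i)%N -> nm (a i) <= np ^+ n) -> null a.
Proof.
move=> h; apply/nullE => e e0; have [n hn] := expr_small (nm_ge0 (p%:R : F)) (nm_p_lt1 F) e0.
by have [N hN] := h n; exists N => i /hN; move/le_lt_trans; apply; apply: hn.
Qed.

Lemma null_pow_bound a n : null a -> exists N, forall i, (N <= i)%N -> nm (a i) <= np ^+ n.
Proof.
move/nullE => /(_ _ (exprn_gt0 n (nm_p_gt0 F)))[N hN]; exists N => i /hN; exact: ltW.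
Qed.

Lemma pow_small_eq0 x : (forall n, nm x <= np ^+ n) -> x = 0.
Proof.
move=> h; apply: small_eq0 => e e0.
have [n hn] := expr_small (nm_ge0 (p%:R : F)) (nm_p_lt1 F) e0.
exact: le_lt_trans (h n) (hn n (leqnn n)).
Qed.

Lemma pow_np_ge0 n : 0 <= np ^+ n. Proof. by rewrite exprn_ge0 ?nm_ge0. Qed.

(** Cut f at a large index M: on the polynomial part linearity applies, and the tail is small on
    both sides. *)
Lemma ucont_urep u : lin u -> ucont u -> urep u (fun i => u (Xn F i)).
Proof.
move=> hu hc.
have cin : sOK (fun i => u (Xn F i)) by move=> i; apply: lin_in hu _; apply: Xn_in.
have cnull : null (fun i => u (Xn F i)).
  apply: null_pow_le => n; have [M hM] := hc n; exists M => i Mi; rewrite Xn_mk.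
  apply: hM => [j|j jM]; first exact: bool_in.
  by rewrite ltn_eqF // (leq_trans jM).
split=> // f hf; rewrite -{1}[f]mkK; have fa := ser_in hf.
apply/eqP; rewrite -subr_eq0; apply/eqP; apply: pow_small_eq0 => n.
have [M1 hM1] := hc n; have [M2 hM2] := null_pow_bound n cnull; pose M := maxn M1 M2.
rewrite (lin_split M hu fa) -opprB nmN.
rewrite [X in nm X](_ : _ = (tsum (fun i => ser f i * u (Xn F i)) - \sum_(i < M) ser f i * u (Xn
  F i))
   - u (mk (from M (ser f)))); last by ring.
apply: nmB.
  apply: tsum_tail; [exact: pow_np_ge0 | exact: null_pairing (sin_OC fa) cnull |].
  move=> i Mi; apply: nmM_le; first by apply: cr_le1 (fa i).
  by apply: hM2; apply: leq_trans Mi; rewrite leq_maxr.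
apply: hM1; first exact: from_in.
by move=> i iM; rewrite /from (leq_trans iM) ?leq_maxl.
Qed.

Lemma smul0r a n : smul a (fun=> 0) n = 0.
Proof. by rewrite /smul big1 // => i _; rewrite mulr0. Qed.

Lemma pX_power_high n a : sOK a -> (forall i, (i < n)%N -> a i = 0) ->
  in_pX_power p (@Cp_norm _ _ F) (uK k) n (mk a).
Proof.
move=> ha a0.
(* Only the last generator p^0 X^n is used. *)
exists (fun i : 'I_n.+1 => if i == ord_max then mk (fun j => a (j + n)%N) else mps0 F 1).
  by move=> i m; case: ifP => _; [apply: ha | apply: (cr0 (OKr k))].
move=> m; rewrite big_ord_recr /= eqxx tnth_mktuple /= subnn.
rewrite big1 => [|i _]; last first.
  rewrite ifF; last by apply/eqP => /(congr1 val) /=; have := ltn_ord i; lia.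
  rewrite -(exp1_mdeg m) -/(ser (mpsM _ _) _) ser_mpsM; exact: smul0r.
rewrite add0r -(exp1_mdeg m) -/(ser (mpsM _ _) _) ser_mpsM serK.
have -> : ser (fun m => p%:R ^+ 0 * Xn F n m) = fun i => (i == n)%:R.
  by apply: funext => i; rewrite /ser mul1r -/(ser (Xn F n) i) ser_Xn.
rewrite smulC smul_delta /xshift -/(ser (mk a) _) serK.
by case: ltnP => h; [apply: a0 | rewrite subnK].
Qed.

Lemma pX_power_flt n f : in_pX_power p (@Cp_norm _ _ F) (uK k) n f -> flt n (ser f).
Proof.
move=> [h hh e] j; rewrite /ser e; apply: nm_sum => [|i _]; first exact: pow_np_ge0.
rewrite -/(ser (mpsM _ _) j) ser_mpsM tnth_mktuple -[n in np ^+ (n - j)]addn0.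
apply: flt_smul; last by apply: flt0; apply: (sin_OC (S := OKr k)); apply: ser_in; apply: hh.
move=> l; rewrite /ser -/(ser (Xn F i) l) ser_Xn; case: eqP => [->|_].
  by rewrite mulr1 nmX.
by rewrite mulr0 nm0 pow_np_ge0.
Qed.

Lemma Uhat_ucont u : Uh u -> ucont u.
Proof.
move=> [hu hc] e; have h0 : cOK (mps0 F 1) by move=> m; apply: cr0.
have [n hn] := hc (mps0 F 1) e h0; exists n => a ha a0.
have := hn (mk a) (mk_in ha); rewrite lin0 // subr0; apply.
have -> : mpsB (mk a) (mps0 F 1) = mk a by apply: funext => m; rewrite /mpsB subr0.
exact: pX_power_high.
Qed.

Lemma urep_Uhat u c : lin u -> urep u c -> Uh u.
Proof.
move=> hu [cin cn _ ue]; split=> // f e hf.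
(* Beyond M the sequence c is already small; below M a series in the (M+e)-th power of (p, X) has
   coefficients divisible by p^e. *)
have [M hM] := null_pow_bound e cn; exists (M + e)%N => g hg /pX_power_flt hfl.
have fb := sin_OC (ser_in (S := OKr k) hf); have gb := sin_OC (ser_in (S := OKr k) hg).
rewrite !ue // -tsumB; try exact: null_pairing.
have dn : null (fun i => ser f i * c i) := null_pairing fb cn.
apply: tsum_le; first exact: pow_np_ge0.
  by apply: nullB => //; apply: null_pairing.
move=> i; rewrite -mulrBl; case: (leqP M i) => Mi.
  by apply: nmM_le; [apply: nmB; apply: sbndE | apply: hM].
apply: nmMr_le; last by apply: cr_le1 (cin i).
apply: (le_trans (hfl i)); rewrite ler_wiXn2l ?nm_ge0 ?(ltW (nm_p_lt1 F)) //; lia.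
Qed.

Definition uof c : mps F 1 -> F := fun f => tsum (fun i => ser f i * c i).

Lemma uof_lin c : sOK c -> null c -> lin (uof c).
Proof.
move=> cin cn; split=> [f hf|e f g he hf hg].
  apply: (cr_tsum (S := OKr k)); first exact: null_pairing (sin_OC (ser_in (S := OKr k) hf)) cn.
  by move=> i; apply: crM => //; apply: ser_in.
have fb := sin_OC (ser_in (S := OKr k) hf); have gb := sin_OC (ser_in (S := OKr k) hg).
have fn := null_pairing fb cn; have gn := null_pairing gb cn.
rewrite /uof -(tsumMl e fn) -(tsumD (nullMl e fn) gn).
by apply: eq_tsum => i; rewrite /ser mulrDl mulrA.
Qed.

Lemma uof_rep c : sOK c -> null c -> urep (uof c) c.
Proof.
move=> cin cn; split=> // i; rewrite /uof (@tsum1 _ _ _ i) => [|j ji].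
  by rewrite ser_Xn eqxx mul1r.
by rewrite ser_Xn (negbTE ji) mul0r.
Qed.

Lemma uof_Uhat c : sOK c -> null c -> Uh (uof c).
Proof. by move=> cin cn; apply: urep_Uhat (uof_lin cin cn) (uof_rep cin cn). Qed.

(** * Functionals that factor through a torsion level *)

Variable G : fgroup k.
Notation tors := (torsion_dual p (@Cp_norm _ _ F) (uK k) G).
Notation q2 := (p ^ 2)%N.

Lemma tors_lin n u : tors n u -> lin u. Proof. by case. Qed.

Lemma tors_kill0 n u a : tors n u -> sOK a -> u (mk (smul (gs G (p ^ n)) a)) = 0.
Proof.
move=> [_ h] ha; have := h (mk a) (mk_in ha).
by rewrite -[mpsM _ _]mkK ser_mpsM serK.
Qed.

(** Being in [torsion_dual] asks for no continuity. It is automatic: with q the degree of [p^n]_G,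
    X^q is a multiple of p modulo [p^n]_G, so u is divisible by p^d on multiples of X^(dq). *)
Lemma tors_ucont n u : tors n u -> ucont u.
Proof.
move=> ht; have hu := tors_lin ht; have hw := wdeg_gs G n; set q := (q2 ^ n)%N in hw.
have dq : sOK (fun i => (i == q)%:R) by move=> i; apply: bool_in.
have [h0 [r [hh0 hr r0 e]]] := wdeg_division hw dq.
have rlow i : nm (r i) <= np ^+ 1.
  case: (ltnP i q) => iq; last by rewrite r0 // nm0 pow_np_ge0.
  rewrite expr1; apply: (OK_lt1 (hr i)).
  have -> : r i = - smul (gs G (p ^ n)) h0 i.
    by apply/eqP; rewrite eq_sym -subr_eq0 -opprD oppr_eq0 -e ltn_eqF.
  by rewrite nmN; apply: (smul_low hw) => //; apply: sin_OC hh0.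
have [r' hr' re] := OK_factors hr rlow.
have gb := gs_bnd G (p ^ n); have hb := sin_OC hh0.
have key d a : sOK a -> (forall i, (i < d * q)%N -> a i = 0) -> nm (u (mk a)) <= np ^+ d.
  elim: d a => [|d IH] a ha a0.
    by rewrite expr0; apply: cr_le1 (lin_in hu (mk_in ha)).
  pose a' i := a (i + q)%N.
  have ha' : sOK a' by move=> i; apply: ha.
  have aE i : a i = smul (gs G (p ^ n)) (smul h0 a') i + p%:R * smul r' a' i.
    have -> : a i = smul a' (fun i => (i == q)%:R) i.
      rewrite smul_delta /xshift /a'; case: ltnP => h; last by rewrite subnK.
      by apply: a0; rewrite mulSn; lia.
    rewrite (smulA gb hb (sin_OC ha')) -smulZl -smulDl smulC /smul.
    by apply: eq_bigr => j _; rewrite e re expr1.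
  have h1 := smul_in hh0 ha'; have h2 := smul_in (gs_in G (p ^ n)) h1; have h3 := smul_in hr' ha'.
  have -> : mk a = fun m => p%:R * mk (smul r' a') m + mk (smul (gs G (p ^ n)) (smul h0 a')) m.
    by apply: funext => m; rewrite /mk aE addrC.
  rewrite (linE hu (np_in k) (mk_in h3) (mk_in h2)) (tors_kill0 ht h1) addr0 nmM exprS.
  rewrite ler_wpM2l ?nm_ge0 //; apply: IH => // i hi; rewrite /smul big1 // => -[j /= hj] _.
  by rewrite /a' a0 ?mulr0 // mulSn; lia.
by move=> d; exists (d * q)%N => a; apply: key.
Qed.

Lemma tors_urep n u : tors n u -> urep u (fun i => u (Xn F i)).
Proof. by move=> h; apply: ucont_urep (tors_lin h) (tors_ucont h). Qed.

(** By definition u kills the multiples of [p^n]_G by series over O_K only, whereas t(X) has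
    coefficients in O_C. Expanding h in monomials and exchanging the sums extends the vanishing. *)
Lemma tors_kill n u h : tors n u -> sbnd h ->
  tsum (fun i => smul (gs G (p ^ n)) h i * u (Xn F i)) = 0.
Proof.
move=> ht hh; have [cin cn _ ue] := tors_urep ht; set c := fun i => u (Xn F i) in cin cn ue.
have gin := gs_in G (p ^ n); have gb := sin_OC gin.
pose a i j := if (j <= i)%N then h j * gs G (p ^ n) (i - j)%N * c i else 0.
have n2 : null2 a.
  move=> e e0; have /nullE/(_ _ e0)[N hN] := cn; exists N => i j ij; rewrite /a.
  case: (leqP j i) => ji; last by rewrite nm0.
  apply: (@le_lt_trans _ _ (nm (c i))); last by apply: hN; lia.
  by apply: nmM_le => //; apply: nmM_le1; apply: sbndE.
rewrite (_ : tsum _ = tsum (fun i => tsum (a i))); last first.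
  apply: eq_tsum => i; rewrite (@tsum_fin _ _ _ (a i) i.+1) => [|j ij]; last first.
    by rewrite /a leqNgt ij.
  rewrite smulC /smul mulr_suml; apply: eq_bigr => j _.
  by rewrite /a -ltnS ltn_ord.
rewrite (exchange_tsum n2) -[RHS](@tsum0 _ _ F); apply: eq_tsum => j.
have dj : sOK (fun i => (i == j)%:R) by move=> i; apply: bool_in.
have := tors_kill0 ht dj; rewrite ue; last by apply: mk_in; apply: smul_in.
rewrite serK smul_delta => e0.
transitivity (h j * tsum (fun i => xshift j (gs G (p ^ n)) i * c i)); last by rewrite e0 mulr0.
rewrite -tsumMl; last first.
  by apply: null_pairing => // i; rewrite /xshift; case: ifP => _; [apply: cr0 | apply: gb].
apply: eq_tsum => i; rewrite /a /xshift leqNgt; case: ltnP => _ /=; first by rewrite mul0r mulr0.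
by rewrite mulrA.
Qed.

(* the coefficient sequence of [contract u Ph], where u maps X^i to c i *)
Definition con c (Ph : mps F 2) : nat -> F := fun j => tsum (fun i => Ph (exp2 i j) * c i).

Lemma con_in c Ph : sOK c -> null c -> cOK Ph -> sOK (con c Ph).
Proof.
move=> cin cn hP j; apply: cr_tsum => [|i]; last exact: crM.
by apply: null_pairing => // i; apply: (in_OC hP).
Qed.

Lemma ser_contract u c Ph : urep u c -> cOK Ph -> ser (contract u Ph) = con c Ph.
Proof.
move=> [_ _ _ ue] hP; apply: funext => j; rewrite /ser /contract mdeg_exp1.
rewrite -/(mk (fun i => Ph (exp2 i j))) ue ?serK // => m; exact: hP.
Qed.

Lemma ev_con c Ph y : sbnd c -> null c -> bnd Ph -> nm y < 1 ->
  ev (con c Ph) y = tsum (fun i => pev Ph y i * c i).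
Proof.
move=> cb cn hP y1; pose a i j := Ph (exp2 i j) * c i * y ^+ j.
have n2 : null2 a.
  move=> e e0; have /nullE/(_ _ e0)[N hN] := cn.
  have [M hM] := expr_small (nm_ge0 y) y1 e0; exists (maxn N M) => i j ij; rewrite /a.
  have Pij : nm (Ph (exp2 i j)) <= 1 by have := hP (exp2 i j); rewrite OCrE.
  case: (leqP N i) => Ni.
    apply: (le_lt_trans _ (hN _ Ni)); apply: nmMr_le; last by apply: nmX_le1; apply: ltW.
    exact: nmM_le.
  have Mj : (M <= j)%N by lia.
  apply: (le_lt_trans _ (hM _ Mj)); rewrite -nmX; apply: nmM_le => //.
  by apply: nmM_le1 => //; apply: sbndE.
have -> : tsum (fun i => pev Ph y i * c i) = tsum (fun i => tsum (a i)).
  apply: eq_tsum => i; rewrite /pev /ev mulrC -tsumMl; last first.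
    by apply: null_ev => // j; apply: hP.
  by apply: eq_tsum => j; rewrite /a; ring.
rewrite (exchange_tsum n2); apply: eq_tsum => j; rewrite /con mulrC -tsumMl; last first.
  by apply: null_pairing => // i; apply: hP.
by apply: eq_tsum => i; rewrite /a; ring.
Qed.

(* Modulo p^e, c already factors through the quotient by [p^N]; Weierstrass division makes
   that quotient free, so the values of c on the first monomials extend to it. *)
Lemma tors_approx c e : sOK c -> null c -> exists N0, forall N, (N0 <= N)%N ->
  exists2 u, tors N u & forall i, nm (c i - u (Xn F i)) <= np ^+ e.
Proof.
(* Multiples of [p^N]_G lie in the N-th power of (p, X). For N >= M + e their coefficients below M
   are divisible by p^e, and those from M on meet a small c_i. *)
move=> cin cn; have [M hM] := null_pow_bound e cn; exists (M + e)%N => N hN.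
have hw := wdeg_gs G N; set q := (q2 ^ N)%N in hw.
have hf (f : nat -> F) : exists r, sOK f -> [/\ sOK r, forall i, (q <= i)%N -> r i = 0 &
    exists2 h, sOK h & forall i, f i = smul (gs G (p ^ N)) h i + r i].
  have [fin|] := EM (sOK f); last by exists f.
  by have [h [r [? ? ? ?]]] := wdeg_division hw fin; exists r => _; split=> //; exists h.
have [rem hrem] := choice hf.
have gb := gs_bnd G (p ^ N).
have rem_uniq f r h : sOK f -> sOK r -> sOK h -> (forall i, (q <= i)%N -> r i = 0) ->
    (forall i, f i = smul (gs G (p ^ N)) h i + r i) -> rem f = r.
  move=> fin rin hin r0 fe; have [rin' r0' [h' hin' fe']] := hrem f fin.
  have [|||_ rr] := @wdeg_unique _ _ _ k _ q (fun i => h i - h' i) (fun i => r i - rem f i) hw.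
  - by move=> i; apply: crB; apply: (sin_OC (S := OKr k)).
  - by move=> i qi; rewrite r0 // r0' // subrr.
  - move=> i; have -> : smul (gs G (p ^ N)) (fun i => h i - h' i) i =
      smul (gs G (p ^ N)) h i - smul (gs G (p ^ N)) h' i.
      by rewrite /smul -sumrB; apply: eq_bigr => j _; rewrite mulrBr.
    by have := fe i; rewrite fe' => E; rewrite addrACA -opprD -E subrr.
  by apply: funext => i; apply/eqP; rewrite eq_sym -subr_eq0 rr.
(* u applies c to the remainder modulo [p^N]_G; uniqueness of the remainder makes this linear. *)
pose u (f : mps F 1) := \sum_(i < q) rem (ser f) i * c i.
have hu : lin u.
  split=> [f hf'|d f g hd hf' hg'].
    have [rin _ _] := hrem _ (ser_in (S := OKr k) hf').
    by apply: (cr_sum (S := OKr k)) => i _; apply: crM.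
  have fin := ser_in (S := OKr k) hf'; have gin := ser_in (S := OKr k) hg'.
  have [rf rf0 [h1 hh1 e1]] := hrem _ fin; have [rg rg0 [h2 hh2 e2]] := hrem _ gin.
  rewrite /u (@rem_uniq _ (fun i => d * rem (ser f) i + rem (ser g) i) (fun i => d * h1 i + h2 i)).
  - by rewrite mulr_sumr -big_split; apply: eq_bigr => i _; rewrite mulrDl mulrA.
  - by move=> i; apply: crD; [apply: crM => //; apply: fin | apply: gin].
  - by move=> i; apply: crD => //; apply: crM.
  - by move=> i; apply: crD => //; apply: crM.
  - by move=> i qi; rewrite rf0 // rg0 // mulr0 addr0.
  - move=> i; rewrite smulDr smulZr; have := e1 i; have := e2 i; rewrite /ser => -> ->.
    by ring.
have ht : tors N u.
  split=> // f hf'; have fin := ser_in (S := OKr k) hf'.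
  rewrite /u ser_mpsM (@rem_uniq _ (fun=> 0) (ser f)) //.
  - by rewrite big1 // => i _; rewrite mul0r.
  - exact: smul_in (gs_in G _) fin.
  - by move=> i; apply: cr0.
  - by move=> i; rewrite addr0.
exists u => // i.
have di : sOK (ser (Xn F i)) by apply: ser_in; apply: Xn_in.
have [rin r0 [h hin re]] := hrem _ di.
have -> : c i - u (Xn F i) = tsum (fun j => smul (gs G (p ^ N)) h j * c j).
  have -> : c i = tsum (fun j => ser (Xn F i) j * c j).
    rewrite (@tsum1 _ _ _ i) => [|j ji]; first by rewrite ser_Xn eqxx mul1r.
    by rewrite ser_Xn (negbTE ji) mul0r.
  rewrite /u -(@tsum_fin _ _ _ (fun j => rem (ser (Xn F i)) j * c j) q); last first.
    by move=> j qj; rewrite r0 // mul0r.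
  rewrite -tsumB; [|exact: null_pairing (sin_OC di) cn | exact: null_pairing (sin_OC rin) cn].
  by apply: eq_tsum => j; rewrite re; ring.
apply: tsum_le; first exact: pow_np_ge0.
  by apply: null_pairing => //; apply: smul_in gb (sin_OC hin).
move=> j; case: (leqP M j) => Mj.
  apply: nmM_le; last exact: hM.
  by apply: sbndE; apply: smul_in gb (sin_OC hin).
apply: nmMr_le; last by apply: cr_le1 (cin j).
apply: (le_trans (flt_gsM G N (sin_OC hin) j)).
rewrite ler_wiXn2l ?nm_ge0 ?(ltW (nm_p_lt1 F)) //; lia.
Qed.

End Functionals.

Section TorsionPairing.
Variables (R : realType) (p : nat) (F : Cp_field R p) (k : unram_field F) (D : dual_pair k).
Notation np := (nm (p%:R : F)).

(** f is Phi_n(X, t_n) plus a multiple of [p^n]_G, which u kills. Applying u to Phi_n(X, Y) and then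
    setting Y = t_n gives the same as the opposite order. *)
Lemma tors_pairing n u t f : torsion_dual p (@Cp_norm _ _ F) (uK k) (dG D) n u ->
  TpH p (@Cp_norm _ _ F) (dH D) t -> fsp D t f ->
  tsum (fun i => f i * u (Xn F i)) = ev (con (fun i => u (Xn F i)) (dPhi D n)) (t n).
Proof.
move=> ht Tt [fb fe]; have [cin cn _ _] := tors_urep ht; have /TpHP[t1 _ _] := Tt.
have [h hb e] := fe n; have Pb := Phi_bnd D n.
rewrite (ev_con (sin_OC cin) cn Pb (t1 n)).
have gh := smul_in (gs_bnd (dG D) (p ^ n)) hb.
rewrite -[RHS]addr0 -(tors_kill ht hb) -tsumD.
- by apply: eq_tsum => i; rewrite e mulrDl.
- by apply: null_pairing => //; apply: pev_bnd.
- exact: null_pairing.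
Qed.

End TorsionPairing.

(** * The Katz map *)

Section GaloisAction.
Variables (R : realType) (p : nat) (F : Cp_field R p) (k : unram_field F).
Notation cvg s l := (cvg_seq (@Cp_norm _ _ F) s l).
Notation sOK := (ser_over (OKr k)).
Notation sbnd := (ser_over (@OCr R p F)).
Notation np := (nm (p%:R : F)).
Variable s : {rmorphism F -> F}.
Hypothesis s_gal : galois_aut (@Cp_norm _ _ F) (uK k) s.
Implicit Types (x y : F) (a h : nat -> F).

Lemma gal_fix x : x \in cr (OKr k) -> s x = x.
Proof. by rewrite OKrE => /andP[xK _]; case: s_gal => _ _ h _; apply: h. Qed.

Lemma gal_cvg a l : cvg a l -> cvg (fun n => s (a n)) (s l).
Proof.
case: s_gal => _ _ _ sc h e e0; have [d d0 hd] := sc l e e0.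
by have [N hN] := h d d0; exists N => n /hN; apply: hd.
Qed.

Lemma gal_null a : null a -> null (fun n => s (a n)).
Proof. by move/gal_cvg; rewrite rmorph0. Qed.

Lemma gal_tsum a : null a -> s (tsum a) = tsum (fun i => s (a i)).
Proof.
move=> /tsumP/gal_cvg h; apply/esym/tsum_uniq.
by apply: (cvg_eventually (N := 0) _ h) => n _; rewrite rmorph_sum.
Qed.

(** [galois_aut] only assumes continuity: x^n tends to 0, hence so does s(x)^n. *)
Lemma gal_lt1 x : nm x < 1 -> nm (s x) < 1.
Proof.
move=> x1; rewrite ltNge; apply/negP => h.
have /gal_null/nullE/(_ 1 ltr01)[N hN] := null_pow x1.
by have := hN N (leqnn _); rewrite rmorphXn nmX ltNge exprn_ege1.
Qed.

(** If |s(x)| > 1, then p x^N has norm < 1 while its image p s(x)^N has norm >= 1 for large N. *)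
Lemma gal_le1 x : nm x <= 1 -> nm (s x) <= 1.
Proof.
move=> x1; rewrite leNgt; apply/negP => h.
have r0 : 0 < nm (s x) by apply: lt_trans h.
have ri : 0 <= (nm (s x))^-1 by rewrite invr_ge0 ltW.
have r1 : (nm (s x))^-1 < 1 by rewrite invf_lt1.
have [N hN] := expr_small ri r1 (nm_p_gt0 F).
have : nm (s (p%:R * x ^+ N)) < 1.
  apply: gal_lt1; rewrite nmM; apply: le_lt_trans (nm_p_lt1 F).
  by rewrite ler_piMr ?nm_ge0 // nmX_le1.
rewrite rmorphM rmorph_nat rmorphXn nmM nmX -ltr_pdivlMr ?exprn_gt0 // mul1r -exprVn.
by rewrite ltNge (ltW (hN N (leqnn N))).
Qed.

Lemma gal_sbnd a : sbnd a -> sbnd (fun i => s (a i)).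
Proof. by move=> ha i; rewrite OCrE gal_le1 // sbndE. Qed.

Lemma gal_ev a x : nm x < 1 -> sOK a -> s (ev a x) = ev a (s x).
Proof.
move=> x1 ha; rewrite /ev gal_tsum; last exact: null_ev (sin_OC ha).
by apply: eq_tsum => i; rewrite rmorphM rmorphXn gal_fix.
Qed.

Lemma gal_smul a h i : sOK a -> s (smul a h i) = smul a (fun j => s (h j)) i.
Proof.
move=> ha; rewrite /smul rmorph_sum; apply: eq_bigr => j _.
by rewrite rmorphM /= gal_fix.
Qed.

Lemma gal_TpH (H : fgroup k) t : TpH p (@Cp_norm _ _ F) H t -> TpH p (@Cp_norm _ _ F) H (s \o t).
Proof.
move=> /TpHP[t1 t0 tS]; apply/TpHP; split=> [n||n] /=.
- exact: gal_lt1.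
- by rewrite t0 rmorph0.
- by rewrite /gm -gal_ev //; [rewrite -/(gm H p _) tS | apply: gs_in].
Qed.

(** Phi_n and [p^n]_G have coefficients in O_K, fixed by s, so s carries the congruences for t to
    those for its image. With [fsp_uniq] this yields equivariance. *)
Lemma gal_fsp (D : dual_pair k) t f : TpH p (@Cp_norm _ _ F) (dH D) t ->
  fsp D t f -> fsp D (s \o t) (fun i => s (f i)).
Proof.
move=> /TpHP[t1 _ _] [fb fe]; split; first exact: gal_sbnd.
move=> n; have [h hb e] := fe n; exists (fun i => s (h i)); first exact: gal_sbnd.
move=> i; rewrite e rmorphD /= gal_smul; last exact: gs_in.
by rewrite /pev gal_ev // => j; apply: Phi_in.
Qed.

End GaloisAction.

(** * The Katz map on null sequences: values, continuity, equivariance *)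

Section KatzMap.
Variables (R : realType) (p : nat) (F : Cp_field R p) (k : unram_field F) (D : dual_pair k).
Notation cvg s l := (cvg_seq (@Cp_norm _ _ F) s l).
Notation sOK := (ser_over (OKr k)).
Notation sbnd := (ser_over (@OCr R p F)).
Notation bnd := (coefs_in (cr (@OCr R p F))).
Notation cOK := (coefs_in (cr (OKr k))).
Notation np := (nm (p%:R : F)).
Notation G := (dG D).
Notation H := (dH D).
Notation Phi := (dPhi D).
Notation T := (TpH p (@Cp_norm _ _ F) H).
Notation Uh := (Uhat p (@Cp_norm _ _ F) (uK k)).
Notation tors := (torsion_dual p (@Cp_norm _ _ F) (uK k) G).
Notation fser t := (ser (series_of p (@Cp_norm _ _ F) G Phi t)).
Notation katz := (Katz p (@Cp_norm _ _ F) G Phi).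
Implicit Types (t : nat -> F) (u v : mps F 1 -> F).

(* the Katz map on the functional that sends X^i to c i *)
Definition kz (c : nat -> F) t := tsum (fun i => fser t i * c i).

Lemma katzE u t : katz u t = kz (fun i => u (Xn F i)) t.
Proof. by []. Qed.

Lemma Uhat_urep u : Uh u -> urep k u (fun i => u (Xn F i)).
Proof. by move=> h; apply: ucont_urep (h.1) (Uhat_ucont h). Qed.

Lemma kz_null c t : T t -> null c -> null (fun i => fser t i * c i).
Proof. by move=> /series_of_fsp[fb _]; apply: null_pairing. Qed.

Lemma kz_le c t B : 0 <= B -> T t -> null c -> (forall i, nm (c i) <= B) -> nm (kz c t) <= B.
Proof.
move=> B0 Tt cn cB; have [fb _] := series_of_fsp Tt.
apply: tsum_le => // [|i]; first exact: kz_null.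
by apply: nmM_le => //; apply: sbndE.
Qed.

Lemma kzB c c' t : T t -> null c -> null c' -> kz (fun i => c i - c' i) t = kz c t - kz c' t.
Proof.
move=> Tt cn cn'; rewrite /kz -tsumB; try exact: kz_null.
by apply: eq_tsum => i; rewrite mulrBr.
Qed.

Lemma kzZ c x t : T t -> null c -> kz (fun i => x * c i) t = x * kz c t.
Proof.
move=> Tt cn; rewrite /kz -tsumMl; last exact: kz_null.
by apply: eq_tsum => i; rewrite mulrCA.
Qed.

Lemma katz_C0_Gal u : Uh u -> C0_Gal p (@Cp_norm _ _ F) (uK k) H (katz u).
Proof.
move=> hu; have [cin cn _ _] := Uhat_urep hu; set c := fun i => u (Xn F i) in cin cn.
split.
- move=> t Tt; rewrite katzE inE /=; apply: kz_le => // i; exact: cr_le1 (cin i).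
- move=> t e Tt e0.
  have [d hd] := expr_small (nm_ge0 (p%:R : F)) (nm_p_lt1 F) e0.
  have [M hM] := null_pow_bound d cn.
  (* Equal coordinates at level M + d make the two series congruent modulo [p^(M+d)]_G, so their
     coefficients below M agree modulo p^d; from M on the c_i are small. *)
  exists (M + d)%N => s Ts st; apply: (le_lt_trans _ (hd d (leqnn d))).
  have [fb /(_ (M + d)%N)[h hb he]] := series_of_fsp Ts.
  have [fb' /(_ (M + d)%N)[h' hb' he']] := series_of_fsp Tt.
  rewrite !katzE /kz -tsumB; try exact: kz_null.
  apply: tsum_le; first exact: pow_np_ge0.
    by apply: nullB; apply: kz_null.
  move=> i; rewrite -mulrBl; case: (leqP M i) => Mi.
    by apply: nmM_le; [apply: nmB; apply: sbndE | apply: hM].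
  apply: nmMr_le; last by apply: cr_le1 (cin i).
  rewrite he he' st // [X in nm X](_ : _ = smul (gs G (p ^ (M + d))) h i -
     smul (gs G (p ^ (M + d))) h' i); last by ring.
  have le : np ^+ (M + d - i) <= np ^+ d.
    by rewrite ler_wiXn2l ?nm_ge0 ?(ltW (nm_p_lt1 F)) //; lia.
  by apply: nmB; apply: (le_trans _ le); apply: flt_gsM.
- move=> s t hs Tt; rewrite !katzE /kz (gal_tsum hs); last exact: kz_null.
  have Ts := gal_TpH hs Tt.
  rewrite (fsp_uniq (series_of_fsp Ts) (gal_fsp hs Tt (series_of_fsp Tt))).
  by apply: eq_tsum => i; rewrite rmorphM /= (gal_fix hs (cin i)).
Qed.

Lemma tors_kz n u t : tors n u -> T t ->
  kz (fun i => u (Xn F i)) t = ev (con (fun i => u (Xn F i)) (Phi n)) (t n).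
Proof. by move=> ht Tt; apply: tors_pairing (series_of_fsp Tt). Qed.

Lemma TpH_neq0 s n : T s -> s 1%N != 0 -> s n.+1 != 0.
Proof.
by move=> Ts s10; apply: contraNneq s10 => h; rewrite -(TpH_gm n 1 Ts) addn1 h gm_at0.
Qed.

(** * Surjectivity onto the integers of K_infty for a primitive t *)

Section Surjectivity.
Variable t : nat -> F.
Hypotheses (Tt : T t) (t10 : t 1%N != 0).

Notation L := (generated_field (uK k) t).

Let t1 n : nm (t n) < 1. Proof. by have /TpHP[] := Tt. Qed.
Let t00 : t 0%N = 0. Proof. by have /TpHP[] := Tt. Qed.
Let tS n : gm H p (t n.+1) = t n. Proof. by have /TpHP[] := Tt. Qed.

Lemma gen_fieldP x : reflect (forall A : {pred F}, divring_closed A -> {subset uK k <= A} ->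
  (forall n, (1 <= n)%N -> t n \in A) -> x \in A) (x \in L).
Proof. by apply: (iffP idP) => [/asboolP|h] //; apply/asboolP. Qed.

Lemma gen_field_divring : divring_closed L.
Proof.
split=> [|x y /gen_fieldP hx /gen_fieldP hy|x y /gen_fieldP hx /gen_fieldP hy];
  apply/gen_fieldP => A hA KA tA; have [A1 AB AV] := hA => //.
- by apply: AB; [apply: hx | apply: hy].
- by apply: AV; [apply: hx | apply: hy].
Qed.

Definition KIr := int_ring (adh_divring gen_field_divring) (@adh_cvg _ _ _ L).

Lemma OK_KI x : x \in cr (OKr k) -> x \in cr KIr.
Proof.
rewrite OKrE int_ringE => /andP[xK ->]; rewrite andbT; apply: sub_adh.
by apply/gen_fieldP => A _ KA _; apply: KA.
Qed.

Lemma t_KI n : t n \in cr KIr.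
Proof.
case: n => [|n]; first by rewrite t00 cr0.
rewrite int_ringE (ltW (t1 _)) andbT; apply: sub_adh.
by apply/gen_fieldP => A _ _ tA; apply: tA.
Qed.

(** A coefficient of t(X) is the limit of those of Phi_n(X, t_n), which are values at t_n of series
    over O_K. *)
Lemma fser_KI i : fser t i \in cr KIr.
Proof.
have [fb fe] := series_of_fsp Tt.
have [h hP] := choice (fun n => ltac:(by have [h hb e] := fe n; exists h; split;
  [exact: hb | exact: e])
  : exists h, sbnd h /\ forall i, fser t i = pev (Phi n) (t n) i + smul (gs G (p ^ n)) h i).
apply: (cr_cvg (s := fun n => pev (Phi n) (t n) i)) => [n|].
  by apply: ev_in => [//|j|]; [apply: OK_KI; apply: Phi_in | apply: t_KI].
apply: (cvg_close (cvg_cst (fser t i))).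
have := @null_flt _ _ _ (fun n => smul (gs G (p ^ n)) (h n)) i (fun n => flt_gsM G n (hP n).1).
by apply: eq_null => n; rewrite (hP n).2 addrAC subrr add0r.
Qed.

Lemma kz_KI c : sOK c -> null c -> kz c t \in cr KIr.
Proof.
move=> cin cn; apply: cr_tsum => [|i]; first exact: kz_null.
by apply: crM; [apply: fser_KI | apply: OK_KI].
Qed.

(* the ring O_K[[t_n]] *)
Definition On n z := exists2 g, sOK g & z = ev g (t n).

Lemma On_step n z : On n z -> On n.+1 z.
Proof.
move=> [g hg ->]; exists (scomp H g p); first exact: scomp_in.
by rewrite ev_scomp // ?tS //; apply: sin_OC hg.
Qed.

Lemma On_le n m z : (n <= m)%N -> On n z -> On m z.
Proof. by move=> nm hz; rewrite -(subnK nm); elim: (m - n)%N => //= d; apply: On_step. Qed.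

Lemma OnB n x y : On n x -> On n y -> On n (x - y).
Proof.
move=> [g hg ->] [h hh ->]; exists (fun i => g i - h i); first by move=> i; apply: crB.
by rewrite evB //; [apply: sin_OC hg | apply: sin_OC hh].
Qed.

Lemma OnM n x y : On n x -> On n y -> On n (x * y).
Proof.
move=> [g hg ->] [h hh ->]; exists (smul g h); first exact: smul_in.
by rewrite ev_smul //; [apply: sin_OC hg | apply: sin_OC hh].
Qed.

Lemma On_const n x : x \in cr (OKr k) -> On n x.
Proof.
move=> hx; exists (fun i => if i == 0%N then x else 0); last by rewrite ev_const.
by move=> i; case: ifP => // _; apply: cr0.
Qed.

Lemma On_t n : On n (t n).
Proof. by exists (fun i => (i == 1%N)%:R); [move=> i; apply: bool_in | rewrite ev_X]. Qed.

Lemma On1 n : On n 1. Proof. by apply: On_const; apply: cr1. Qed.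
Lemma OnX n x d : On n x -> On n (x ^+ d).
Proof. by move=> h; elim: d => [|d IH]; rewrite ?expr0 ?exprS; [apply: On1 | apply: OnM]. Qed.

Lemma OnD n x y : On n x -> On n y -> On n (x + y).
Proof.
move=> hx hy; rewrite -[y]opprK -[- y]sub0r; apply: OnB => //; apply: OnB => //.
by apply: On_const; apply: cr0.
Qed.

Lemma On_le1 n z : On n z -> nm z <= 1.
Proof. by move=> [g hg ->]; apply: ev_le1 => //; apply: sin_OC hg. Qed.

(* [om n] vanishes at t_(n+1) and has constant term p. *)
Lemma p_factor n : exists2 z, On n.+1 z & p%:R = t n.+1 * z.
Proof.
have ob := om_bnd H n; pose w := ev (fun i => om H n i.+1) (t n.+1).
exists (0 - w).
  by apply: OnB; [apply: On_const; apply: cr0 | exists (fun i => om H n i.+1) => // i;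
    apply: om_in].
have := TpH_om n Tt t10; rewrite ev_recl // om0 -/w => /eqP.
by rewrite addr_eq0 sub0r mulrN => /eqP.
Qed.

Definition Ounit n z := exists g, [/\ sOK g, nm (g 0%N) = 1 & z = ev g (t n)].

Lemma Ounit_On n z : Ounit n z -> On n z. Proof. by move=> [g [? _ ?]]; exists g. Qed.

Lemma Ounit_nm n z : Ounit n z -> nm z = 1.
Proof. by move=> [g [hg g0 ->]]; apply: unit_ev => //; apply: sin_OC hg. Qed.

Lemma Ounit_inv n z : Ounit n z -> On n z^-1.
Proof.
move=> hz; have z1 := Ounit_nm hz; move: hz => [g [hg g0 e]].
have d0 : sOK (fun i => if i == 0%N then 1 else 0).
  by move=> i; case: ifP => _; [apply: cr1 | apply: cr0].
have dg := sdiv_in g0 hg d0; exists (sdiv (fun i => if i == 0%N then 1 else 0) g) => //.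
have z0 : z != 0 by apply/negP => /eqP z0; move: z1; rewrite z0 nm0 => /esym/eqP; rewrite oner_eq0.
have g00 : g 0%N != 0 by apply/negP => /eqP z0'; move: g0; rewrite z0' nm0 => /esym/eqP;
  rewrite oner_eq0.
apply: (mulfI z0); rewrite divff // e -ev_smul //; [| exact: sin_OC hg | exact: sin_OC dg].
by rewrite smul_sdiv // ev_const.
Qed.

(** A constant term that is not a unit is a multiple of p, hence of t_(n+1) by [p_factor]. *)
Lemma On_factor n z : On n.+1 z -> Ounit n.+1 z \/ exists2 z', On n.+1 z' & z = t n.+1 * z'.
Proof.
move=> [g hg ->]; case: (OK_nmP (hg 0%N)) => g0; last by left; exists g.
right; have [w hw pe] := p_factor n.
have [x hx ge] : exists2 x, x \in cr (OKr k) & g 0%N = p%:R * x.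
  have := @OK_factor _ _ _ k (g 0%N) 1 (hg 0%N); rewrite !expr1; apply.
  exact: OK_lt1 (hg 0%N) g0.
exists (w * x + ev (fun i => g i.+1) (t n.+1)).
  apply: OnD; first by apply: OnM => //; apply: On_const.
  by exists (fun i => g i.+1) => // i; apply: hg.
rewrite ev_recl //; last exact: sin_OC hg.
by rewrite ge pe; ring.
Qed.

(** t_(n+1) acts as a uniformizer: if dividing by it never ended in a unit, z would be divisible by
    all its powers and vanish. *)
Lemma On_unit_form n z : On n.+1 z -> z != 0 ->
  exists j e, Ounit n.+1 e /\ z = t n.+1 ^+ j * e.
Proof.
move=> hz z0; apply: contrapT => hn.
have h j : exists2 z', On n.+1 z' & z = t n.+1 ^+ j * z'.
  elim: j => [|j [z' hz' e]]; first by exists z; rewrite ?mul1r.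
  case: (On_factor hz') => [hu|[z2 hz2 e2]]; first by case: hn; exists j, z'.
  by exists z2; rewrite // e e2 exprSr mulrA.
move/negP: z0; apply; apply/eqP; apply: small_eq0 => e e0.
have [N hN] := expr_small (nm_ge0 (t n.+1)) (t1 _) e0.
have [z' hz' ->] := h N; rewrite nmM nmX; apply: le_lt_trans (hN N (leqnn _)).
by rewrite ler_piMr ?exprn_ge0 ?nm_ge0 // (On_le1 hz').
Qed.

(** The union of the rings O_K[[t_(n+1)]][1/p], which turns out to contain the generated field.
    Levels start at 1 since t_0 = 0. *)
Definition Lfrac z := exists n d, On n.+1 (p%:R ^+ d * z).

Lemma On_pow n d : On n (p%:R ^+ d).
Proof. by apply: OnX; apply: On_const; apply: np_in. Qed.

Lemma Lfrac2 x y : Lfrac x -> Lfrac y ->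
  exists n d, On n.+1 (p%:R ^+ d * x) /\ On n.+1 (p%:R ^+ d * y).
Proof.
move=> [n1 [d1 h1]] [n2 [d2 h2]]; exists (maxn n1 n2), (d1 + d2)%N; split.
  rewrite addnC exprD -mulrA; apply: OnM (On_pow _ _) _.
  by apply: On_le h1; rewrite ltnS leq_maxl.
rewrite exprD -mulrA; apply: OnM (On_pow _ _) _.
by apply: On_le h2; rewrite ltnS leq_maxr.
Qed.

Lemma LfracB x y : Lfrac x -> Lfrac y -> Lfrac (x - y).
Proof.
by move=> hx hy; have [n [d [h1 h2]]] := Lfrac2 hx hy; exists n, d; rewrite mulrBr; apply: OnB.
Qed.

Lemma LfracM x y : Lfrac x -> Lfrac y -> Lfrac (x * y).
Proof.
move=> hx hy; have [n [d [h1 h2]]] := Lfrac2 hx hy; exists n, (d + d)%N.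
by rewrite exprD mulrACA; apply: OnM.
Qed.

Lemma LfracV x : Lfrac x -> Lfrac x^-1.
Proof.
move=> [n [d h]]; have [->|x0] := eqVneq x 0.
  by rewrite invr0; exists 0%N, 0%N; rewrite mulr0; apply: On_const; apply: cr0.
have p0 : (p%:R : F) ^+ d != 0 by rewrite expf_neq0 // p_neq0.
have [|j [e [he E]]] := On_unit_form h; first by rewrite mulf_neq0.
have [w hw pe] := p_factor n; exists n, j.
have tn0 : t n.+1 ^+ j != 0 by rewrite expf_neq0 // TpH_neq0.
have e0 : e != 0 by apply/negP => /eqP e0; move: E => /eqP;
  rewrite e0 mulr0 mulf_eq0 (negbTE p0) (negbTE x0).
(* From p = t_(n+1) w and p^d x = t_(n+1)^j e, with e a unit. *)
have -> : p%:R ^+ j * x^-1 = p%:R ^+ d * (w ^+ j * e^-1).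
  rewrite pe exprMn -pe; apply: (mulIf (mulf_neq0 p0 x0)).
  rewrite {2}E; move: (x0); set a := p%:R ^+ d; set b := t n.+1 ^+ j => _.
  by rewrite -[LHS]/(b * w ^+ j * x^-1 * (a * x)); field; rewrite e0 x0.
by apply: OnM; [apply: On_pow | apply: OnM; [apply: OnX | apply: Ounit_inv]].
Qed.

(** Write p as t_(n+1)^j' and p^d z as t_(n+1)^j, up to units. Comparing norms, |z| <= 1 forces j >=
    j' d, so the denominator cancels within the same ring. *)
Lemma Lfrac_int z : Lfrac z -> nm z <= 1 -> exists n, On n.+1 z.
Proof.
move=> [n [d h]] z1; have [->|z0] := eqVneq z 0.
  by exists 0%N; apply: On_const; apply: cr0.
exists n.
have p0 : (p%:R : F) ^+ d != 0 by rewrite expf_neq0 // p_neq0.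
have [|j [e [he E]]] := On_unit_form h; first by rewrite mulf_neq0.
have [|j' [e' [he' E']]] := On_unit_form (On_const n.+1 (np_in k)); first exact: p_neq0.
have T0 := TpH_neq0 n Tt t10; have Tp := nm_gt0 T0; have Tl := t1 n.+1.
have E2 : p%:R ^+ d = t n.+1 ^+ (j' * d) * e' ^+ d :> F by rewrite E' exprMn exprM.
have ne := Ounit_nm he; have ne' := Ounit_nm he'.
have le : (j' * d <= j)%N.
  rewrite leqNgt; apply/negP => lt.
  have := congr1 nm E; rewrite E2 !nmM !nmX ne ne' expr1n !mulr1 => E3.
  have : nm (t n.+1) ^+ (j' * d) * nm z <= nm (t n.+1) ^+ (j' * d).
    by rewrite ler_piMr ?exprn_ge0 ?nm_ge0.
  by rewrite E3 leNgt ltr_iXn2l // lt.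
have e'0 : e' ^+ d != 0.
  by rewrite expf_neq0 //; apply/negP => /eqP e0; move: ne'; rewrite e0 nm0 => /esym/eqP;
    rewrite oner_eq0.
have -> : z = t n.+1 ^+ (j - j' * d) * (e * (e'^-1) ^+ d).
  apply: (mulfI p0); rewrite E E2 -{1}(subnK le) exprD exprVn.
  by move: e'0; set a := e' ^+ d => a0; field.
apply: OnM; first by apply: OnX; apply: On_t.
by apply: OnM; [apply: Ounit_On | apply: OnX; apply: Ounit_inv].
Qed.

Lemma gen_field_Lfrac z : z \in L -> Lfrac z.
Proof.
move=> /gen_fieldP/(_ [pred z | `[< Lfrac z >]]) h; apply/asboolP; apply: h.
- split.
  + by apply/asboolP; exists 0%N, 0%N; rewrite mulr1; apply: On_pow.
  + by move=> x y /asboolP hx /asboolP hy; apply/asboolP; apply: LfracB.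
  + by move=> x y /asboolP hx /asboolP hy; apply/asboolP; apply: LfracM => //; apply: LfracV.
- move=> x xK; apply/asboolP.
  have [N hN] : exists N, nm (p%:R ^+ N * x) <= 1.
    have [->|x0] := eqVneq x 0; first by exists 0%N; rewrite mulr0 nm0.
    have i0 : 0 < (nm x)^-1 by rewrite invr_gt0 nm_gt0.
    have [N hN] := expr_small (nm_ge0 (p%:R : F)) (nm_p_lt1 F) i0; exists N.
    by rewrite nmM nmX -ler_pdivlMr ?nm_gt0 // mul1r ltW // hN.
  exists 0%N, N; apply: On_const; rewrite OKrE hN andbT.
  have [K1 KB KV] := uK_divring k.
  have pK : p%:R ^+ N \in uK k by have := crX N (np_in k); rewrite OKrE => /andP[].
  by rewrite -[x]invrK KV // -[x^-1]mul1r KV.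
- move=> [//|n] _; apply/asboolP; exists n, 0%N; rewrite mul1r; exact: On_t.
Qed.

(** The surjective half of Cartier duality at level n realizes g modulo [p^n]_H, and this modulus
    vanishes at t_n. *)
Lemma On_tors n z : On n z -> exists2 u, tors n u & kz (fun i => u (Xn F i)) t = z.
Proof.
move=> [g hg ->]; case: (dP D) => /(_ n) [_ _ _ _ [_ hs]] _ _.
have [u hu hi] := hs _ (mk_in hg); exists u => //.
rewrite (tors_kz hu Tt); have rep := tors_urep hu; have [cin cn _ _] := rep.
have Pin := Phi_in D n; have sc := ser_contract rep Pin.
have cin' := con_in cin cn Pin.
have cb : bnd (contract u (Phi n)).
  by rewrite -[contract _ _]mkK sc; apply: mk_in; apply: sin_OC cin'.
have gb : bnd (mk g) by apply: mk_in; apply: sin_OC hg.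
have [h hh he] := in_ideal_ev1 (S := OKr k) hi (fg_mul_bnd H _).
have := he _ (disc1 (t1 n)); rewrite (mev_fg_mul H _ (t1 n)).
have -> : gm H (p ^ n) (t n) = 0 by have := TpH_gm n 0 Tt; rewrite addn0 t00.
rewrite mul0r (mevB (disc1 (t1 n)) cb gb) (mev1E (t1 n) cb) (mev1E (t1 n) gb) sc serK.
by move/eqP; rewrite subr_eq0 => /eqP.
Qed.

(** An element of the generated field within |p| of y is integral, so it lies in the image, and the
    difference is p times an integer of K_infty. *)
Lemma KI_approx y : y \in cr KIr -> exists c, [/\ sOK c, null c &
  exists2 y', y' \in cr KIr & y = kz c t + p%:R * y'].
Proof.
rewrite int_ringE => /andP[hy y1]; have /adhP/(_ _ (nm_p_gt0 F))[z zL yz] := hy.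
have z1 : nm z <= 1.
  have -> : z = y - (y - z) by ring.
  by apply: nmB => //; apply: ltW; apply: lt_trans yz (nm_p_lt1 F).
have [n hz] := Lfrac_int (gen_field_Lfrac zL) z1.
have [u hu kze] := On_tors hz; have [cin cn _ _] := tors_urep hu.
exists (fun i => u (Xn F i)); split=> //; rewrite kze; exists ((y - z) / p%:R); last first.
  by rewrite mulrC divfK ?p_neq0 // addrC subrK.
rewrite int_ringE; apply/andP; split; last first.
  by rewrite nmM nmV ler_pdivrMr ?nm_p_gt0 // mul1r ltW.
have [A1 AB AV] := adh_divring gen_field_divring.
apply: AV; first by apply: AB => //; apply: sub_adh.
apply: sub_adh; apply/gen_fieldP => A _ KA _; apply: KA.
by have := np_in k; rewrite OKrE => /andP[].
Qed.

(** Iterating [KI_approx] gives sequences c_m for the successive p-adic digits of y. Their sum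
    weighted by p^m is again null, and the Katz map commutes with that sum by an exchange of
    sums. *)
Lemma kz_surjective y : y \in cr KIr -> exists c, [/\ sOK c, null c & kz c t = y].
Proof.
move=> hy.
have st (x : F) : exists cx : (nat -> F) * F, x \in cr KIr ->
    [/\ sOK cx.1, null cx.1, cx.2 \in cr KIr & x = kz cx.1 t + p%:R * cx.2].
  have [hx|] := EM (x \in cr KIr); last by exists ((fun=> 0), x).
  by have [c [h1 h2 [x' h3 h4]]] := KI_approx hx; exists (c, x').
have [nx hnx] := choice st.
pose Y := fix Y n := if n is n'.+1 then (nx (Y n')).2 else y.
have hY n : Y n \in cr KIr by elim: n => //= n IH; have [] := hnx _ IH.
pose c n := (nx (Y n)).1.
have cin n : sOK (c n) by have [] := hnx _ (hY n).
have cn n : null (c n) by have [] := hnx _ (hY n).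
have YS n : Y n = kz (c n) t + p%:R * Y n.+1 by have [] := hnx _ (hY n).
have part N : y = \sum_(m < N) p%:R ^+ m * kz (c m) t + p%:R ^+ N * Y N.
  elim: N => [|N IH]; first by rewrite big_ord0 add0r mul1r.
  by rewrite big_ord_recr /= {1}IH {1}(YS N) exprSr mulrDr addrA !mulrA.
have [fb _] := series_of_fsp Tt.
(* For m >= M the factor p^m is small; for the finitely many m < M each c_m is null, whence one
   bound on i for all of them. *)
have small (a : nat -> F) : sbnd a -> null2 (fun i m => a i * (p%:R ^+ m * c m i)).
  move=> ab e e0; have [M hM] := expr_small (nm_ge0 (p%:R : F)) (nm_p_lt1 F) e0.
  have hN m : exists N, forall i, (N <= i)%N -> nm (c m i) < e by have /nullE/(_ _ e0) := cn m.
  have [N hN'] := choice hN.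
  exists (maxn M (\max_(m < M) N m)) => i m im.
  have am : nm (a i) <= 1 by apply: sbndE.
  case: (leqP M m) => Mm.
    apply: (le_lt_trans _ (hM m Mm)); rewrite -nmX; apply: nmM_le => //.
    by apply: nmMr_le => //; apply: cr_le1 (cin m i).
  have Ni : (N m <= i)%N.
    have := leq_bigmax (F := fun m : 'I_M => N m) (Ordinal Mm) => /= h.
    apply: (leq_trans h); case/orP: im; rewrite geq_max => /andP[] //.
    by rewrite leqNgt Mm.
  apply: (le_lt_trans _ (hN' m i Ni)); apply: nmM_le => //; apply: nmM_le => //.
  by apply: nmX_le1; apply: ltW; apply: nm_p_lt1.
have pcn i : null (fun m => p%:R ^+ m * c m i).
  have := null_pow (nm_p_lt1 F); apply: null_nm_le => m; apply: nmMr_le => //.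
  exact: cr_le1 (cin m i).
exists (fun i => tsum (fun m => p%:R ^+ m * c m i)); split.
- move=> i; apply: cr_tsum => // m; apply: crM; [apply: crX; exact: np_in | exact: cin].
- have one : sbnd (fun=> 1) by move=> i; apply: cr1.
  have := null2_tsum (small _ one); apply: eq_null => i.
  by apply: eq_tsum => m; rewrite mul1r.
have -> : kz (fun i => tsum (fun m => p%:R ^+ m * c m i)) t =
    tsum (fun i => tsum (fun m => fser t i * (p%:R ^+ m * c m i))).
  by apply: eq_tsum => i; rewrite -tsumMl.
rewrite (exchange_tsum (small _ fb)).
have -> : tsum (fun m => tsum (fun i => fser t i * (p%:R ^+ m * c m i))) =
    tsum (fun m => p%:R ^+ m * kz (c m) t).
  by apply: eq_tsum => m; rewrite -kzZ.
apply: tsum_uniq.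
have hn : null (fun N => p%:R ^+ N * Y N).
  have := null_pow (nm_p_lt1 F); apply: null_nm_le => m; apply: nmMr_le => //.
  exact: cr_le1 (hY m).
have := cvgB (cvg_cst y) hn; rewrite subr0; apply: (cvg_eventually (N := 0)) => N _.
by rewrite {1}(part N) addrK.
Qed.

End Surjectivity.

(** * Injectivity, by comparing orders modulo p *)

Section Injectivity.
Notation Q := (p ^ 2)%N.

(** The Newton polygon of [om n] at its zero s_(n+1): the constant term p can only be cancelled by
    the term of degree d, those in between having norm < |p|. *)
Lemma primitive_norm s n : T s -> s 1%N != 0 -> nm (s n.+1) ^+ (Q.-1 * Q ^ n) = np.
Proof.
move=> Ts s10; have s1 : nm (s n.+1) < 1 by have /TpHP[] := Ts.
have [oin low unit] := wdeg_om H n; set d := (_ * _)%N in low unit *.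
have d0 : (0 < d)%N by rewrite /d muln_gt0 !expn_gt0 (p_gt0 F); have := p2_gt1 F; lia.
have := TpH_om n Ts s10; rewrite (ev_split d s1 (sin_OC oin)).
rewrite -(prednK d0) big_ord_recl /= expr0 mulr1 om0 prednK // => e.
set lo := \sum_(i < d.-1) _ in e.
have nlo : nm lo < np.
  apply: nm_sum_lt => [|i _]; first exact: nm_p_gt0.
  rewrite nmM nmX /=; apply: (@le_lt_trans _ _ (np * nm (s n.+1))).
    apply: ler_pM; rewrite ?exprn_ge0 ?nm_ge0 //.
      apply: (OK_lt1 (oin _)); apply: low; rewrite /bump /=; have := ltn_ord i; lia.
    by rewrite /bump /= add1n exprS ler_piMr ?nm_ge0 // exprn_ile1 ?nm_ge0 // ltW.
  by rewrite gtr_pMr ?nm_p_gt0.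
have nu : nm (s n.+1 ^+ d * ev (fun i => om H n (i + d)%N) (s n.+1)) = nm (s n.+1) ^+ d.
  by rewrite nmM nmX unit_ev ?mulr1 // => i; apply: (sin_OC oin).
move/eqP: e; rewrite addrC addr_eq0 => /eqP /(congr1 nm).
by rewrite nu nmN nmD_eq.
Qed.

(** If r were not divisible by p, its Weierstrass degree j would be less than that of [om n], and
    its value would have norm |s_(n+1)|^j > |p|. So r can be divided by p, repeatedly. *)
Lemma rem_small s n e r : T s -> s 1%N != 0 -> sOK r ->
  (forall i, (Q.-1 * Q ^ n <= i)%N -> r i = 0) -> nm (ev r (s n.+1)) <= np ^+ e ->
  forall i, nm (r i) <= np ^+ e.
Proof.
move=> Ts s10; have s1 : nm (s n.+1) < 1 by have /TpHP[] := Ts.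
have sd := primitive_norm n Ts s10; have sn0 := nm_gt0 (TpH_neq0 n Ts s10).
elim: e r => [|e IH] r rin r0 hr i; first by rewrite expr0; apply: cr_le1 (rin i).
case: (wdeg_dichotomy rin) => [rp|[j hj]].
  have rp1 i' : nm (r i') <= np ^+ 1 by rewrite expr1.
  have [r' rin' re] := OK_factors rin rp1.
  have rE : r = fun i => p%:R * r' i by apply: funext => l; rewrite re expr1.
  rewrite re expr1 nmM exprS ler_wpM2l ?nm_ge0 //; apply: IH => //.
    move=> l hl; have := r0 l hl; rewrite re expr1 => /eqP.
    by rewrite mulf_eq0 (negbTE (p_neq0 F)) => /eqP.
  move: hr; rewrite rE evZ //; last exact: sin_OC rin'.
  by rewrite nmM exprS ler_pM2l // nm_p_gt0.
have [_ _ rj] := hj.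
have jd : (j < Q.-1 * Q ^ n)%N.
  rewrite ltnNge; apply/negP => /r0 z; move: rj; rewrite z nm0 => /esym/eqP.
  by rewrite oner_eq0.
have nps : np < nm (s n.+1) ^+ j by rewrite -sd ltr_iXn2l.
move: hr; rewrite (wdeg_ev hj s1 nps) leNgt => /negP; case.
apply: le_lt_trans nps; rewrite exprS ler_piMr ?nm_ge0 // exprn_ile1 ?nm_ge0 //.
exact: ltW (nm_p_lt1 F).
Qed.

(* Dividing by [om], which vanishes at s_N and equals p at the lower s_(N-i), removes one
   torsion level at the cost of one power of p. *)
Lemma small_low_coefs s m : T s -> s 1%N != 0 -> forall N e g, (m <= N)%N -> (m <= e)%N -> sOK g ->
  (forall i, (i < m)%N -> nm (ev g (s (N - i)%N)) <= np ^+ e) ->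
  forall j, (j < Q ^ N - Q ^ (N - m))%N -> nm (g j) < 1.
Proof.
move=> Ts s10; have /TpHP[s1 s00 sS] := Ts.
elim: m => [|m IH] N e g mN me gin hg j; first by rewrite subn0 subnn.
case: N mN hg => // n mN hg; case: e me hg => // e me hg jb.
have hw := wdeg_om H n; set d := (_ * _)%N in hw.
have [oin low unit] := hw.
have [h [r [hin rin r0 ge]]] := wdeg_division hw gin.
have gE : g = fun i => smul (om H n) h i + r i by apply: funext.
have ob := sin_OC oin; have hb := sin_OC hin; have rb := sin_OC rin.
have gev x : nm x < 1 -> ev g x = ev (om H n) x * ev h x + ev r x.
  by move=> x1; rewrite gE evD ?ev_smul //; apply: smul_in.
have rs : forall i, nm (r i) <= np ^+ e.+1.
  apply: (rem_small Ts s10 rin r0).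
  by have := hg 0%N isT; rewrite subn0 gev // (TpH_om n Ts s10) mul0r add0r.
have np1 := nm_p_lt1 F.
have r1 i : nm (r i) < 1.
  apply: (le_lt_trans (rs i)); rewrite exprS; apply: (le_lt_trans _ np1).
  by rewrite ler_piMr ?nm_ge0 // exprn_ile1 ?nm_ge0 // ltW.
have hs i : (i < m)%N -> nm (ev h (s (n - i)%N)) <= np ^+ e.
  move=> im; have := hg i.+1 im; rewrite subSS gev //.
  have -> : ev (om H n) (s (n - i)%N) = p%:R.
    rewrite ev_om //; have -> : gm H (p ^ n) (s (n - i)%N) = 0.
      have := TpH_mul i Ts => Ti; have := TpH_gm n 0 Ti; rewrite addn0 => ->.
      by rewrite sub0n s00.
    by rewrite ev0 rr0.
  move=> h1; have : nm (p%:R * ev h (s (n - i)%N)) <= np ^+ e.+1.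
    rewrite -[p%:R * _](addrK (ev r (s (n - i)%N))); apply: nmB => //.
    by apply: ev_bound => //; rewrite exprn_ge0 ?nm_ge0.
  by rewrite nmM exprS ler_pM2l // nm_p_gt0.
have hlow := IH n e h mN me hin hs.
rewrite gE; apply: nmD_lt => //; apply: nm_sum_lt => // -[i /= ij] _; rewrite nmM.
case: (ltnP i d) => id.
  apply: (le_lt_trans _ (low i id)).
  by rewrite ler_piMr ?nm_ge0 // sbndE.
(* Since d = Q^(n+1) - Q^n, the bound j < Q^(n+1) - Q^(n-m) becomes j - d < Q^n - Q^(n-m), the range
   of the induction hypothesis. *)
have : nm (h (j - i)%N) < 1.
  apply: hlow; move: jb id; rewrite /d expnS subSS -subn1 mulnBl mul1n.
  have : (Q ^ n <= Q * Q ^ n)%N by rewrite leq_pmull // ltnW // (p2_gt1 F).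
  have : (Q ^ (n - m) <= Q ^ n)%N by rewrite leq_exp2l ?leq_subr // (p2_gt1 F).
  move: (Q * Q ^ n)%N (Q ^ n)%N (Q ^ (n - m))%N => X Y Z; lia.
by apply: le_lt_trans; rewrite ler_piMl ?nm_ge0 // sbndE.
Qed.

Lemma tors_mono n m u : (n <= m)%N -> tors n u -> tors m u.
Proof.
move=> nm hu; rewrite -(subnK nm); elim: (m - n)%N => // l [hl hk]; split=> // f hf.
have fin := ser_in (S := OKr k) hf.
rewrite -[mpsM _ _]mkK ser_mpsM addSn -/(gs G _) gs_om -smulA.
- by apply: (tors_kill0 (conj hl hk)); apply: smul_in => //; apply: om_in.
- exact: gs_bnd.
- exact: om_bnd.
- exact: sin_OC fin.
Qed.

Lemma con_lin (c c' : nat -> F) x (Ph : mps F 2) j : null c -> null c' -> bnd Ph ->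
  con (fun i => c i - x * c' i) Ph j = con c Ph j - x * con c' Ph j.
Proof.
move=> cn cn' hP; have Pb : sbnd (fun i => Ph (exp2 i j)) by move=> i; apply: hP.
have n1 := null_pairing Pb cn; have n2 := null_pairing Pb cn'.
rewrite /con -(tsumMl x n2) -(tsumB n1 (nullMl x n2)).
by apply: eq_tsum => i; ring.
Qed.

(** A functional of level n also has level n+1, and its image in the algebra of H[p^(n+1)] is the
    pull-back along multiplication by p to H[p^n]. The cofactor of [p^n]_G in [pev_step] is killed
    by u. *)
Lemma con_step n u : tors n u -> exists2 h, sOK h & forall y, nm y < 1 ->
  ev (con (fun i => u (Xn F i)) (Phi n.+1)) y =
    ev (con (fun i => u (Xn F i)) (Phi n)) (gm H p y) + gm H (p ^ n.+1) y * ev h y.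
Proof.
move=> hu; have [cin cn _ _] := tors_urep hu; set c := fun i => u (Xn F i) in cin cn *.
have [h1 [h2 [hh1 hh2 he]]] := pev_step D n.
exists (con c h2) => [|y y1]; first exact: con_in.
have Hy := gm_lt1 H p y1; have cb := sin_OC cin.
have b1 := pev_bnd (in_OC hh1) y1; have b2 := pev_bnd (in_OC hh2) y1.
have b3 := pev_bnd (Phi_bnd D n) Hy.
have b4 := smul_in (gs_bnd G (p ^ n)) b1.
rewrite (ev_con cb cn (Phi_bnd D n.+1) y1) (ev_con cb cn (Phi_bnd D n) Hy) (ev_con cb cn (in_OC
  hh2) y1).
have n2 := null_pairing b2 cn; have n3 := null_pairing b3 cn; have n4 := null_pairing b4 cn.
rewrite -(tsumMl _ n2) -[X in _ = X + _]addr0 -(tors_kill hu b1) -(tsumD n3 n4).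
rewrite -(tsumD (nullD n3 n4) (nullMl _ n2)).
by apply: eq_tsum => i; rewrite he // /c; ring.
Qed.

Lemma con_iter n l u : tors n u -> exists2 h, sOK h & forall y, nm y < 1 ->
  ev (con (fun i => u (Xn F i)) (Phi (n + l))) y =
    ev (con (fun i => u (Xn F i)) (Phi n)) (gm H (p ^ l) y) + gm H (p ^ (n + l)) y * ev h y.
Proof.
move=> hu; elim: l => [|l [h hin he]].
  exists (fun=> 0) => [i|y y1]; first exact: cr0.
  rewrite addn0 expn0 gm1 // (_ : ev (fun=> 0) y = 0) ?mulr0 ?addr0 //.
  by rewrite /ev -[RHS](@tsum0 _ _ F); apply: eq_tsum => i; rewrite mul0r.
have [h' hin' he'] := con_step (tors_mono (leq_addr l n) hu).
exists (fun i => scomp H h p i + h' i) => [i|y y1].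
  by apply: crD => //; apply: scomp_in.
have hb := sin_OC hin; have hb' := sin_OC hin'; have sb := sin_OC (scomp_in H p hin).
rewrite addnS he' // he; last exact: gm_lt1.
by rewrite evD // ev_scomp // -!gm_pSr //; ring.
Qed.

(** By contradiction from a unit c_i0: one coefficient J of a contraction at level N is found to be
    both a unit and not a unit. *)
Lemma kz_eq0_small c : sOK c -> null c -> (forall t, T t -> kz c t = 0) -> forall i, nm (c i) <= np.
Proof.
move=> cin cn c0 i0; case: (OK_nmP (cin i0)) => ci0; first exact: OK_lt1 (cin i0) ci0.
exfalso.
(* The level n depends on the precision p only, and is fixed before N is chosen. *)
have [n hn] := tors_approx G 1 cin cn; have [u2 hu2 cu2] := hn n (leqnn n).
have rep2 := tors_urep hu2; have [cin2 cn2 _ ue2] := rep2.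
set c2 := fun i => u2 (Xn F i) in cin2 cn2 ue2 rep2.
have Pin := Phi_in D; have np1 := nm_p_lt1 F.
set b2 := con c2 (Phi n); have b2in : sOK b2 := con_in cin2 cn2 (Pin n).
have hwH := wdeg_gs H n.
(* Otherwise b2 is p times a series r' modulo [p^n]_H. Surjectivity of the duality realizes r' by
   some u1, injectivity gives u2 = p u1, and c_i0 would not be a unit. *)
have [j jn hj] : exists2 j, (j < Q ^ n)%N & wdeg k b2 j.
  apply: contrapT => hno.
  have low j : (j < Q ^ n)%N -> nm (b2 j) < 1.
    move=> jn; case: (wdeg_dichotomy b2in) => [h|[q hq]]; first exact: le_lt_trans (h j) np1.
    have [_ hlow _] := hq; apply: hlow; apply: (leq_trans jn); rewrite leqNgt.
    by apply/negP => qn; apply: hno; exists q.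
  have [h [r [hin rin r0 be]]] := wdeg_division hwH b2in.
  have rs i : nm (r i) <= np ^+ 1.
    case: (ltnP i (Q ^ n)) => iq; last by rewrite r0 // nm0 pow_np_ge0.
    rewrite expr1; apply: (OK_lt1 (rin i)).
    have -> : r i = b2 i - smul (gs H (p ^ n)) h i by rewrite be addrAC subrr add0r.
    by apply: nmB_lt; [apply: low | apply: (smul_low hwH (sin_OC hin))].
  have [r' rin' re] := OK_factors rin rs.
  case: (dP D) => /(_ n) [_ _ _ _ [hinj hsur]] _ _.
  have [u1 hu1 [h1 hh1 he1]] := hsur _ (mk_in rin').
  have rep1 := tors_urep hu1; have [cin1 cn1 _ ue1] := rep1.
  have l2 := tors_lin hu2; have l1 := tors_lin hu1.
  pose w f := u2 f - p%:R * u1 f.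
  have hw : tors n w.
    split; [split|].
    - by move=> f hf; apply: (crB (S := OKr k)); [apply: lin_in l2 _ | apply: crM;
      [apply: np_in | apply: lin_in l1 _]].
    - by move=> d f g hd hf hg; rewrite /w (linE l2 hd hf hg) (linE l1 hd hf hg); ring.
    - by move=> f hf; rewrite /w (hu1.2 f hf) (hu2.2 f hf) mulr0 subr0.
  have h1in := ser_in (S := OKr k) (hh1 ord0).
  have wX0 : w (Xn F i0) = 0.
    apply: (hinj w hw _ (Xn F i0) (Xn_in (OKr k) i0)).
    exists (fun=> mk (fun i => h i - p%:R * ser (h1 ord0) i)) => [_|m].
      by apply: (mk_in (S := OKr k)) => i; apply: crB => //; apply: crM => //; apply: np_in.
    rewrite big_ord1 /= -(exp1_mdeg m) -/(ser (mpsM _ _) _) -/(ser (contract _ _) _) ser_mpsM serK.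
    set i := mdeg m; rewrite (ser_contract (tors_urep hw) (Pin n)).
    rewrite (con_lin p%:R i cn2 cn1 (Phi_bnd D n)) -/b2 be.
    have := he1 (exp1 i); rewrite big_ord1 /= /mpsB -/(ser (mk r') i) serK.
    rewrite -/(ser (contract _ _) i) (ser_contract rep1 (Pin n)) -/(ser (mpsM _ _) _) ser_mpsM =>
      /eqP.
    rewrite subr_eq => /eqP ->; rewrite re expr1 -/(gs H _).
    have -> : smul (gs H (p ^ n)) (fun i => h i - p%:R * ser (h1 ord0) i) i =
        smul (gs H (p ^ n)) h i - p%:R * smul (gs H (p ^ n)) (ser (h1 ord0)) i.
      by rewrite -smulZr /smul -sumrB; apply: eq_bigr => l _; rewrite mulrBr.
    by ring.
  have c2p : nm (c2 i0) <= np.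
    move/eqP: wX0; rewrite subr_eq0 => /eqP e; rewrite /c2 e.
    by apply: nmMr_le => //; apply: cr_le1 (cin1 i0).
  have : nm (c i0) <= np.
    by rewrite -(subrK (c2 i0) (c i0)); apply: nmD => //; have := cu2 i0; rewrite expr1.
  by rewrite ci0 leNgt np1.
(* Each of the n+1 divisions in [small_low_coefs] costs a power of p, hence the precision p^(n+1); N
   > n gives room for n+1 levels. *)
have [N1 hN1] := tors_approx G n.+1 cin cn; pose N := maxn N1 n.+1.
have [u3 hu3 cu3] := hN1 N (leq_maxl _ _).
have [cin3 cn3 _ _] := tors_urep hu3; set c3 := fun i => u3 (Xn F i) in cin3 cn3.
have nN : (n.+1 <= N)%N by rewrite leq_maxr.
have [s Ts s10] := TpH_primitive H.
have hlow := @small_low_coefs s n.+1 Ts s10 N n.+1 (con c3 (Phi N)) nN (leqnn _)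
  (con_in cin3 cn3 (Pin N)).
have {}hlow : forall j, (j < Q ^ N - Q ^ (N - n.+1))%N -> nm (con c3 (Phi N) j) < 1.
  (* s_(N-i) is the N-th coordinate of p^i s. There the Katz map kills c, so the value for c3 is the
     one for c3 - c, divisible by p^(n+1). *)
  apply: hlow => i _; have Ti := TpH_mul i Ts.
  rewrite -(tors_kz hu3 Ti).
  have -> : kz (fun l => u3 (Xn F l)) (fun l => s (l - i)%N) =
     0 - kz (fun l => c l - c3 l) (fun l => s (l - i)%N).
    by rewrite (kzB Ti cn cn3) (c0 _ Ti) sub0r opprB subr0.
  rewrite sub0r nmN; apply: kz_le => //; first exact: pow_np_ge0.
  exact: nullB.
have nN' := ltnW nN.
have [h hin he] := con_iter (N - n) hu2; rewrite (subnKC nN') -/c2 -/b2 in he.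
have b2b := sin_OC b2in.
have con2E : con c2 (Phi N) = fun i => scomp H b2 (p ^ (N - n)) i + smul (gs H (p ^ N)) h i.
  have sb := sin_OC (scomp_in H (p ^ (N - n)) b2in); have hb := sin_OC hin.
  have gb := gs_bnd H (p ^ N); have gh := smul_in gb hb.
  apply: ev_inj; [exact: sin_OC (con_in cin2 cn2 (Pin N)) | by move=> i; apply: crD |].
  by move=> y y1; rewrite he // evD // ev_scomp // ev_smul.
have wB : wdeg k (scomp H b2 (p ^ (N - n))) (j * Q ^ (N - n)).
  apply: (wdeg_comp _ hj (wdeg_gs H (N - n))); first by rewrite !expn_gt0 (p_gt0 F).
    exact: scomp_in.
  by move=> x x1; rewrite ev_scomp.
pose J := (j * Q ^ (N - n))%N.
have QN : (Q ^ N = Q ^ n * Q ^ (N - n))%N by rewrite -expnD subnKC.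
have Qp : (0 < Q ^ (N - n))%N by rewrite !expn_gt0 (p_gt0 F).
have JN : (J < Q ^ N)%N by rewrite /J QN ltn_pmul2r.
have JL : (J < Q ^ N - Q ^ (N - n.+1))%N.
  (* j <= Q^n - 1 gives J <= Q^N - Q^(N-n), which is strictly below the range covered by [hlow]. *)
  have h1 : (J + Q ^ (N - n) <= Q ^ N)%N by rewrite /J QN addnC -mulSn leq_pmul2r.
  have h2 : (Q ^ (N - n.+1) < Q ^ (N - n))%N by rewrite ltn_exp2l ?(p2_gt1 F) //; lia.
  by move: h1 h2; move: (Q ^ N)%N (Q ^ (N - n))%N (Q ^ (N - n.+1))%N => X Y Z; lia.
have [_ _ uB] := wB.
(* The correction is a multiple of [p^N]_H, whose coefficients below Q^N are not units; hence it
   does not affect the unit coefficient J. *)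
have n2 : nm (con c2 (Phi N) J) = 1.
  rewrite con2E nmD_eq uB //; exact: smul_low (wdeg_gs H N) (sin_OC hin) JN.
(* c2 and c3 are both congruent to c modulo p, so their contractions with Phi_N agree modulo p. *)
have : nm (con c2 (Phi N) J) < 1.
  have -> : con c2 (Phi N) J = con c3 (Phi N) J + con (fun i => c2 i - 1 * c3 i) (Phi N) J.
    by rewrite (con_lin 1 J cn2 cn3 (Phi_bnd D N)); ring.
  apply: nmD_lt; first exact: hlow.
  apply: (le_lt_trans _ np1); apply: tsum_le; first exact: nm_ge0.
    apply: null_pairing; first by move=> i; apply: Phi_bnd.
    by apply: nullB => //; apply: nullMl.
  move=> i; apply: nmM_le; first by have := Phi_bnd D N (exp2 i J); rewrite OCrE.
  have -> : c2 i - 1 * c3 i = (c i - c3 i) - (c i - c2 i) by ring.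
  apply: nmB; last by have := cu2 i; rewrite expr1.
  apply: (le_trans (cu3 i)); rewrite exprS ler_piMr ?nm_ge0 // exprn_ile1 ?nm_ge0 //.
  exact: ltW.
by rewrite n2 ltxx.
Qed.

(** By [kz_eq0_small] c is divisible by p, and the quotient is again killed by the Katz map.
    Repeating this makes c divisible by every power of p. *)
Lemma kz_injective c : sOK c -> null c -> (forall t, T t -> kz c t = 0) -> forall i, c i = 0.
Proof.
move=> cin cn c0 i; apply: pow_small_eq0 => d; move: i.
elim: d c cin cn c0 => [|d IH] c cin cn c0 i; first by rewrite expr0; apply: cr_le1 (cin i).
have cp j : nm (c j) <= np ^+ 1 by rewrite expr1; apply: kz_eq0_small.
have [c' cin' ce] := OK_factors cin cp.
have p0 := p_neq0 F.
have c'E : c' = fun j => p%:R^-1 * c j by apply: funext => j; rewrite ce expr1 mulKf.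
rewrite ce expr1 nmM exprS ler_wpM2l ?nm_ge0 //; apply: IH => // [|t Tt].
  by rewrite c'E; apply: nullMl.
by rewrite c'E kzZ // c0 // mulr0.
Qed.

End Injectivity.

End KatzMap.

Theorem theoremB (R : realType) (p : nat) (C : fieldType) (nrm : C -> R)
    (K : {pred C}) (G H : mps C 2) (Phi : nat -> mps C 2)
    (p_prime : prime p) (C_is_Cp : is_Cp p nrm)
    (K_finite : finite_over_Qp nrm K) (K_unramified : unramified nrm K)
    (G_fgl : formal_group_law (integers nrm K) G) (G_height : has_height p nrm G 2)
    (H_fgl : formal_group_law (integers nrm K) H) (H_height : has_height p nrm H 2)
    (GH_dual : cartier_dual p nrm K G H Phi) :
  [/\ forall u, Uhat p nrm K u -> C0_Gal p nrm K H (Katz p nrm G Phi u),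
      forall u v, Uhat p nrm K u -> Uhat p nrm K v ->
        (forall t, TpH p nrm H t -> Katz p nrm G Phi u t = Katz p nrm G Phi v t) ->
        forall f, coefs_in (integers nrm K) f -> u f = v f &
      forall t, TpHx p nrm H t ->
        (forall u, Uhat p nrm K u ->
           Katz p nrm G Phi u t \in integers nrm (K_infty nrm K t)) /\
        (forall y, y \in integers nrm (K_infty nrm K t) ->
           exists2 u, Uhat p nrm K u & Katz p nrm G Phi u t = y)].
Proof.
pose F := CpField p_prime C_is_Cp.
pose k : unram_field F := @UnramField _ _ F K K_finite K_unramified.
pose g : fgroup k := @FGroup _ _ F k G G_fgl G_height.
pose h : fgroup k := @FGroup _ _ F k H H_fgl H_height.
pose D : dual_pair k := @DualPair _ _ F k g h Phi GH_dual.
split.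
- exact: (katz_C0_Gal D).
- move=> u v hu hv uv f hf.
  have [cin cn _ ue] := @Uhat_urep _ _ F k u hu; have [din dn _ ve] := @Uhat_urep _ _ F k v hv.
  (* The Katz map sees only the values on monomials; by continuity these determine u and v on all of
     O_K[[X]]. *)
  have e i : u (Xn C i) - v (Xn C i) = 0.
    apply: (@kz_injective _ _ F k D (fun i => u (Xn C i) - v (Xn C i))).
    - by move=> j; apply: crB.
    - exact: nullB.
    - move=> t Tt; rewrite (kzB Tt cn dn); apply/eqP; rewrite subr_eq0; apply/eqP; exact: uv.
  rewrite (ue f hf) (ve f hf); apply: (@eq_tsum _ _ F) => i; congr (_ * _).
  by apply/eqP; rewrite -subr_eq0 e.
- move=> t ht; have t10 := @TpHx_neq0 _ _ F k h t ht; have Tt := ht.1; split=> [u hu|y hy].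
    have [cin cn _ _] := @Uhat_urep _ _ F k u hu.
    exact: (@kz_KI _ _ F k D t Tt _ cin cn).
  have [c [cin cn e]] := @kz_surjective _ _ F k D t Tt t10 y hy.
  exists (@uof _ _ F c); first exact: (uof_Uhat cin cn).
  have [_ _ ce _] := uof_rep cin cn.
  rewrite -[LHS]/(kz D (fun i => @uof _ _ F c (Xn F i)) t) -e; congr (kz D _ t).
  exact: funext.
Qed.
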